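(* Let $d\ge1$ be an integer and let $\beta,\gamma\in(0,1)$ be such that $\beta+d\gamma>d$. There exists a unique bilinear map $$\int_{[0,1]^d}: C^\beta([0,1]^d)\times\operatorname{sch}^\gamma([0,1]^d)\to\mathbb{R},\qquad (f,\boldsymbol{\omega})\mapsto\int_{[0,1]^d}f\,\boldsymbol{\omega},$$ satisfying: (A) for all $f\in C^\beta([0,1]^d)$ and $g\in L^{1/(1-\gamma)}([0,1]^d)$, $\int_{[0,1]^d}f\,(g\,d\mathcal{L})=\int_{[0,1]^d}fg$ (the right side being a Lebesgue integral); (B) if $(f_p)$ is a sequence in $C^\beta([0,1]^d)$ converging uniformly to $f$, $(\boldsymbol{\omega}_p)$ is a sequence in $\operatorname{sch}^\gamma([0,1]^d)$ converging to $\boldsymbol{\omega}$ in norm in $\operatorname{sch}([0,1]^d)$, $\sup_p\operatorname{Lip}^\beta(f_p)<\infty$ and $\sup_p\|\boldsymbol{\omega}_p\|_\gamma<\infty$, then $\lim_{p\to\infty}\int_{[0,1]^d}f_p\,\boldsymbol{\omega}_p=\int_{[0,1]^d}f\,\boldsymbol{\omega}$. Furthermore, there is a constant $C\ge 0$, independent of $f$ and $\boldsymbol{\omega}$, such that for all $f\in C^\beta([0,1]^d)$ and $\boldsymbol{\omega}\in\operatorname{sch}^\gamma([0,1]^d)$, $$\left|\int_{[0,1]^d}f\,\boldsymbol{\omega}\right|\le C\left(\|f\|_\infty+\operatorname{Lip}^\beta(f)\right)\|\boldsymbol{\omega}\|_\gamma.$$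
   Context: $|E|$ denotes Lebesgue measure. For integrable $u:\mathbb{R}^d\to\mathbb{R}$, $\mathbf{V}u=\sup\{\int u\operatorname{div}v: v\in C^1_c(\mathbb{R}^d;\mathbb{R}^d),\ |v(x)|\le 1\ \forall x\}$. The perimeter of a measurable set $A$ is $\|A\|=\mathbf{V}\mathbf{1}_A$; a $BV$-set is a bounded measurable set of finite perimeter. $\mathcal{BV}([0,1]^d)$ is the collection of $BV$-subsets of $[0,1]^d$. A sequence $(B_n)$ in $\mathcal{BV}([0,1]^d)$ $BV$-converges to $B$ if $|B_n\triangle B|\to0$ and $\sup_n\|B_n\|<\infty$. A charge on $[0,1]^d$ is a function $\boldsymbol{\omega}:\mathcal{BV}([0,1]^d)\to\mathbb{R}$ such that $\boldsymbol{\omega}(B_1\cup B_2)=\boldsymbol{\omega}(B_1)+\boldsymbol{\omega}(B_2)$ whenever $|B_1\cap B_2|=0$, and $\boldsymbol{\omega}(B_n)\to\boldsymbol{\omega}(B)$ whenever $(B_n)$ $BV$-converges to $B$. For $g\in L^1([0,1]^d)$, $g\,d\mathcal{L}$ is the charge $B\mapsto\int_Bg$. Strong charges: let $BV([0,1]^d)$ be the space of functions of bounded variation on $\mathbb{R}^d$ vanishing a.e. outside $[0,1]^d$, normed by $\|u\|_{BV}=\mathbf{V}u$. For $g\in L^d([0,1]^d)$ let $T_g\in BV([0,1]^d)^*$, $T_g(u)=\int gu$. A charge $\boldsymbol{\omega}$ is strong if there is $\lambda$ in the norm closure of $\{T_g:g\in L^d\}$ in $BV([0,1]^d)^*$ with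 $\boldsymbol{\omega}(B)=\lambda(\mathbf{1}_B)$ for all $B$; such $\lambda$ is unique and $\|\boldsymbol{\omega}\|$ denotes its operator norm. $\operatorname{sch}([0,1]^d)$ is the Banach space of strong charges. A dyadic cube is a set $\prod_{i=1}^d[2^{-n}k_i,2^{-n}(k_i+1)]$ with integers $n\ge0$, $0\le k_i\le 2^n-1$. For $\frac{d-1}{d}<\gamma\le1$, a charge is $\gamma$-Hölder if $\|\boldsymbol{\omega}\|_\gamma:=\sup\{|\boldsymbol{\omega}(K)|/|K|^\gamma: K\text{ dyadic cube}\}<\infty$; $\operatorname{sch}^\gamma([0,1]^d)$ is the space of $\gamma$-Hölder charges, which are automatically strong. If $g\in L^{1/(1-\gamma)}$ then $g\,d\mathcal{L}\in\operatorname{sch}^\gamma([0,1]^d)$. For $f$ on $[0,1]^d$, $\operatorname{Lip}^\beta(f)=\sup_{x\ne y}|f(x)-f(y)|/|x-y|^\beta$; $C^\beta([0,1]^d)$ is the set of $f$ with $\operatorname{Lip}^\beta(f)<\infty$. *)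

(* Defs.v *)
From HB Require Import structures.
From mathcomp Require Import all_boot all_order all_algebra.
From mathcomp Require Import all_classical all_reals all_analysis.

Set Implicit Arguments.
Unset Strict Implicit.
Unset Printing Implicit Defensive.

Import Order.TTheory GRing.Theory Num.Theory.
Import numFieldNormedType.Exports.

Local Open Scope classical_set_scope.
Local Open Scope ring_scope.

Section transport.
Context d1 d2 (T1 : measurableType d1) (T2 : measurableType d2) (R : realType).
Variables (f : T1 -> T2) (g : T2 -> T1).
Variables (mf : measurable_fun setT f) (mg : measurable_fun setT g).
Variables (fK : cancel f g) (mu : {measure set T1 -> \bar R}).
Hypothesis mu_sigma_finite : sigma_finite setT mu.

Let image_measure := pushforward mu f.

#[local] Hint Resolve mf : core.

Let image_measure0 : image_measure set0 = 0%E.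
Proof. exact: measure0. Qed.

Let image_measure_ge0 A : (0 <= image_measure A)%E.
Proof. exact: measure_ge0. Qed.

Let image_measure_sigma_additive : semi_sigma_additive image_measure.
Proof. exact: measure_semi_sigma_additive. Qed.

HB.instance Definition _ := isMeasure.Build _ _ _ image_measure
  image_measure0 image_measure_ge0 image_measure_sigma_additive.

Let image_measure_sigma_finite : sigma_finite setT image_measure.
Proof.
have [S ST Sfin] := mu_sigma_finite.
exists (fun n => g @^-1` S n).
  by rewrite -preimage_bigcup -ST preimage_setT.
move=> n; have [mS Soo] := Sfin n; split.
  by rewrite -[X in measurable X]setTI; exact: mg.
rewrite /image_measure /pushforward -comp_preimage.
by rewrite (_ : g \o f = id) //; apply/funext => x /=; rewrite fK.
Qed.

HB.instance Definition _ := Measure_isSigmaFinite.Build _ _ _ image_measure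
  image_measure_sigma_finite.

Definition transport : {sigma_finite_measure set T2 -> \bar R} :=
  image_measure.
End transport.

Lemma product_sigma_finite d1 d2 (T1 : measurableType d1)
    (T2 : measurableType d2) (R : realType)
    (m1 : {sigma_finite_measure set T1 -> \bar R})
    (m2 : {sigma_finite_measure set T2 -> \bar R}) :
  sigma_finite setT (m1 \x m2)%E.
Proof.
have /sigma_finiteP[F [TF ndF Foo]] := sigma_finiteT m1.
have /sigma_finiteP[G [TG ndG Goo]] := sigma_finiteT m2.
exists (fun n => F n `*` G n).
  rewrite -setXTT TF TG predeqE => -[x y]; split.
    move=> [/= [n _ Fnx] [k _ Gky]]; exists (maxn n k) => //; split.
    - by move: x Fnx; exact/subsetPset/ndF/leq_maxl.
    - by move: y Gky; exact/subsetPset/ndG/leq_maxr.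
  by move=> [n _ []/= ? ?]; split; exists n.
move=> k; have [? ?] := Foo k; have [? ?] := Goo k.
split; first exact: measurableX.
by rewrite product_measure1E// lte_mul_pinfty// ge0_fin_numE.
Qed.

Section lebesgue.
Context {R : realType}.
Notation mR := (measurableTypeR R).

Definition tcons n (p : mR * n.-tuple mR) : n.+1.-tuple mR :=
  [tuple of p.1 :: p.2].
Definition tuncons n (t : n.+1.-tuple mR) : mR * n.-tuple mR :=
  (thead t, [tuple of behead t]).

Lemma measurable_tcons n : measurable_fun setT (@tcons n).
Proof. exact: measurable_cons. Qed.

Lemma measurable_tuncons n : measurable_fun setT (@tuncons n).
Proof.
apply/measurable_fun_pair; first exact: measurable_tnth.
exact: measurable_behead.
Qed.

Lemma tconsK n : cancel (@tcons n) (@tuncons n).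
Proof. by move=> [x t]; congr pair; apply/val_inj. Qed.

Fixpoint lebesgue_tuple n :
    {sigma_finite_measure set (n.-tuple mR) -> \bar R} :=
  if n is n'.+1 then
    transport (@measurable_tcons n') (@measurable_tuncons n') (@tconsK n')
      (product_sigma_finite lebesgue_measure (lebesgue_tuple n'))
  else dirac [tuple].

Section rV.
Variable d : nat.

Definition tuple_of_rV (x : 'rV[R]_d) : d.-tuple mR := [tuple x ord0 i | i < d].

(* R^d with its Borel sigma-algebra. *)
Definition rVborel := g_sigma_algebra_preimageType tuple_of_rV.

Definition rV_of_tuple (t : d.-tuple mR) : rVborel := \row_i tnth t i.

Lemma tuple_of_rVK : cancel tuple_of_rV rV_of_tuple.
Proof. by move=> x; apply/rowP => i; rewrite mxE tnth_mktuple. Qed.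

Lemma rV_of_tupleK : cancel rV_of_tuple tuple_of_rV.
Proof. by move=> t; apply/eq_from_tnth => i; rewrite tnth_mktuple mxE. Qed.

Lemma measurable_tuple_of_rV : measurable_fun setT (tuple_of_rV : rVborel -> _).
Proof. by move=> _ A mA; exists A. Qed.

Lemma measurable_rV_of_tuple : measurable_fun setT rV_of_tuple.
Proof.
move=> _ _ [A mA <-]; rewrite !setTI -comp_preimage.
by rewrite (_ : _ \o _ = id) //; apply/funext => t /=; rewrite rV_of_tupleK.
Qed.

Definition lebesgue_borel : {sigma_finite_measure set rVborel -> \bar R} :=
  transport measurable_rV_of_tuple measurable_tuple_of_rV rV_of_tupleK
    (@sigma_finiteT _ _ _ (lebesgue_tuple d)).

(* R^d with the Caratheodory completion of its Borel sigma-algebra, i.e. with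
   the Lebesgue measurable sets. *)
Definition rVleb : measurableType _ :=
  caratheodory_type (lebesgue_borel^*)%mu.

Definition leb : {measure set rVleb -> \bar R} :=
  @completed_measure_extension _ _ _ lebesgue_borel.
End rV.
End lebesgue.
Arguments rVleb R d : clear implicits.
Arguments leb {R d}.

Section defs.
Context (R : realType) (d : nat).

(* The norm `|x| of 'rV[R]_d in the library is the sup norm. *)
Definition enorm (x : 'rV[R]_d) : R := Num.sqrt (\sum_(i < d) x ord0 i ^+ 2).

Definition cube01 : set 'rV[R]_d := [set x | forall i, 0 <= x ord0 i <= 1].

Definition ext0 (f : cube01 -> R) : 'rV[R]_d -> R := 'valL_(0 : R) f.

Definition test_field (v : 'rV[R]_d -> 'rV[R]_d) : Prop :=
  [/\ (forall x, differentiable v x),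
      continuous (jacobian v),
      compact (closure [set x | v x != 0]) &
      forall x, enorm (v x) <= 1].

Definition divergence (v : 'rV[R]_d -> 'rV[R]_d) (x : 'rV[R]_d) : R :=
  \tr (jacobian v x).

Definition variation (u : 'rV[R]_d -> R) : \bar R :=
  ereal_sup [set (\int[leb]_x (u x * divergence v x)%:E)%E | v in test_field].

Definition perimeter (A : set 'rV[R]_d) : \bar R := variation \1_A.

Definition BVset : set (set 'rV[R]_d) :=
  [set A | [/\ measurable (A : set (rVleb R d)), bounded_set A &
               (perimeter A < +oo)%E]].

Definition BVcube : set (set 'rV[R]_d) := [set A | BVset A /\ A `<=` cube01].

Definition BVcvg (B_ : nat -> BVcube) (B : BVcube) : Prop :=
  leb (\val (B_ n) `+` \val B) @[n --> \oo] --> 0%E /\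
  (ereal_sup (range (fun n => perimeter (\val (B_ n)))) < +oo)%E.

(* BVcube is closed under unions, so B below is just the element B1 `|` B2. *)
Definition charge01 (w : BVcube -> R) : Prop :=
  (forall B1 B2 B : BVcube, \val B = \val B1 `|` \val B2 ->
     leb (\val B1 `&` \val B2) = 0%E -> w B = w B1 + w B2) /\
  (forall (B_ : nat -> BVcube) (B : BVcube), BVcvg B_ B ->
     w (B_ n) @[n --> \oo] --> w B).

Definition density_charge (g : cube01 -> R) (B : BVcube) : R :=
  \int[leb]_(x in \val B) ext0 g x.

Definition Lpcube (p : R) : set (cube01 -> R) :=
  [set g | (ext0 g : rVleb R d -> R) \in Lfun leb p%:E].

Definition BVfun : set ('rV[R]_d -> R) :=
  [set u | [/\ leb.-integrable setT (EFin \o u), (variation u < +oo)%E &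
               {ae leb, forall x, ~ cube01 x -> u x = 0}]].

(* Operator norm on the dual of BVfun normed by variation; functionals are
   represented by functions whose values outside of BVfun are irrelevant. *)
Definition opnorm (l : ('rV[R]_d -> R) -> R) : \bar R :=
  ereal_sup [set `|l u|%:E | u in BVfun `&` [set u | (variation u <= 1)%E]].

Definition BVdual : set (('rV[R]_d -> R) -> R) :=
  [set l | (forall (a : R) u v, BVfun u -> BVfun v ->
              l (a *: u + v) = a * l u + l v) /\
           (opnorm l < +oo)%E].

Definition density_dual (g : cube01 -> R) (u : 'rV[R]_d -> R) : R :=
  \int[leb]_x (ext0 g x * u x).

Definition strong_dual : set (('rV[R]_d -> R) -> R) :=
  [set l | BVdual l /\
     forall e : R, 0 < e -> exists2 g, Lpcube d%:R g &
       (opnorm (fun u => l u - density_dual g u)%R < e%:E)%E].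

Definition represents (l : ('rV[R]_d -> R) -> R) (w : BVcube -> R) : Prop :=
  forall B : BVcube, w B = l \1_(\val B).

Definition strong_charge (w : BVcube -> R) : Prop :=
  charge01 w /\ exists2 l, strong_dual l & represents l w.

(* The functional l representing a strong charge is unique on BVfun, so the
   infimum ranges over a single value, the operator norm of l; the value is +oo
   for a charge that is not strong. *)
Definition strong_norm (w : BVcube -> R) : \bar R :=
  ereal_inf [set opnorm l | l in [set l | strong_dual l /\ represents l w]].

Definition dyadic_cube (K : set 'rV[R]_d) : Prop :=
  exists (n : nat) (k : 'I_d -> nat), (forall i, (k i < 2 ^ n)%N) /\
    K = [set x | forall i,
      (k i)%:R / 2 ^+ n <= x ord0 i <= (k i).+1%:R / 2 ^+ n].

(* Dyadic cubes are BV sets, so the restriction to K : BVcube is harmless. *)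
Definition holder_norm (gamma : R) (w : BVcube -> R) : \bar R :=
  ereal_sup [set (`|w K| / fine (leb (\val K)) `^ gamma)%:E |
             K in [set K : BVcube | dyadic_cube (\val K)]].

Definition sch_pred (gamma : R) : {pred (BVcube -> R)} :=
  mem [set w | charge01 w /\ (holder_norm gamma w < +oo)%E].

Definition lip (beta : R) (f : cube01 -> R) : \bar R :=
  ereal_sup [set (`|f xy.1 - f xy.2| / enorm (\val xy.1 - \val xy.2) `^ beta)%:E |
             xy in [set xy : cube01 * cube01 | xy.1 != xy.2]].

Definition supnorm (f : cube01 -> R) : \bar R :=
  ereal_sup (range (fun x => `|f x|%:E)).

Definition Cbeta_pred (beta : R) : {pred (cube01 -> R)} :=
  mem [set f | (lip beta f < +oo)%E].

Lemma ereal_sup_lt_pinfty (T : Type) (A : set T) (F : T -> R) :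
  (ereal_sup [set (F x)%:E | x in A] < +oo)%E <->
  exists M, forall x, A x -> F x <= M.
Proof.
split=> [|[M FM]]; last first.
  apply: (@le_lt_trans _ _ M%:E); last exact: ltry.
  by apply: ge_ereal_sup => _ [x Ax <-]; rewrite lee_fin FM.
move=> Foo; exists (fine (ereal_sup [set (F x)%:E | x in A])) => x Ax.
have FS : ((F x)%:E <= ereal_sup [set (F x)%:E | x in A])%E.
  by apply: ereal_sup_ubound; exists x.
rewrite -lee_fin fineK // fin_numElt Foo andbT.
exact: lt_le_trans (ltNyr _) FS.
Qed.

Lemma ratio_submod (T T' : Type) (A : set T') (D : (T -> R) -> T' -> R)
    (q : T' -> R) :
  (forall x, 0 <= q x) ->
  (forall (a : R) f g x, D (a *: f + g) x = a * D f x + D g x) ->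
  forall a f g,
  (ereal_sup [set (`|D f x| / q x)%:E | x in A] < +oo)%E ->
  (ereal_sup [set (`|D g x| / q x)%:E | x in A] < +oo)%E ->
  (ereal_sup [set (`|D (a *: f + g)%R x| / q x)%:E | x in A] < +oo)%E.
Proof.
move=> q0 DE a f g /ereal_sup_lt_pinfty[M fM] /ereal_sup_lt_pinfty[N gN].
apply/ereal_sup_lt_pinfty; exists (`|a| * M + N) => x Ax.
rewrite DE (le_trans _ (lerD (ler_wpM2l (normr_ge0 a) (fM _ Ax)) (gN _ Ax)))//.
by rewrite mulrA -normrM -mulrDl ler_wpM2r ?invr_ge0// ler_normD.
Qed.

Lemma Cbeta_submod_closed beta : submod_closed (Cbeta_pred beta).
Proof.
split.
  rewrite inE /=; apply/ereal_sup_lt_pinfty; exists 0 => x _.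
  by rewrite subrr normr0 mul0r.
move=> a f g; rewrite !inE /=.
apply: (ratio_submod (D := fun f xy => f xy.1 - f xy.2)) => [x|b h k x].
  exact: powR_ge0.
by rewrite !fctE /= mulrBr opprD addrACA.
Qed.

Lemma sch_submod_closed gamma : submod_closed (sch_pred gamma).
Proof.
split.
  rewrite inE /=; split; last first.
    apply/ereal_sup_lt_pinfty; exists 0 => x _.
    by rewrite normr0 mul0r.
  split=> [B1 B2 B _ _|B_ B _]; first by rewrite addr0.
  exact: cvg_cst.
move=> a w z; rewrite !inE /= => -[[wD wc] woo] [[zD zc] zoo]; split; last first.
  by apply: (ratio_submod (D := fun w B => w B)) woo zoo => // x; exact: powR_ge0.
split=> [B1 B2 B BE B0|B_ B BB].
  by rewrite !fctE (wD B1 B2 B)// (zD B1 B2 B)// scalerDr addrACA.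
by apply: cvgD; [apply: cvgZr; exact: wc|exact: zc].
Qed.

HB.instance Definition _ beta := GRing.isSubmodClosed.Build R (cube01 -> R)
  (Cbeta_pred beta) (Cbeta_submod_closed beta).
HB.instance Definition _ gamma := GRing.isSubmodClosed.Build R (BVcube -> R)
  (sch_pred gamma) (sch_submod_closed gamma).

Definition Cbeta (beta : R) := {f | f \in Cbeta_pred beta}.
Definition sch (gamma : R) := {w | w \in sch_pred gamma}.

HB.instance Definition _ beta := SubChoice.on (Cbeta beta).
HB.instance Definition _ beta := [SubChoice_isSubLmodule of Cbeta beta by <:].
HB.instance Definition _ gamma := SubChoice.on (sch gamma).
HB.instance Definition _ gamma := [SubChoice_isSubLmodule of sch gamma by <:].

(* density_charge g is Holder when g is in L^(1/(1-gamma)), so the equation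
   below only names it as an element w of sch. Similarly the limits f and w in
   the continuity clause belong to Cbeta and sch as soon as the hypotheses of
   that clause hold. *)
Definition charge_integral beta gamma (I : Cbeta beta -> sch gamma -> R) : Prop :=
  [/\ bilinear_for *%R *%R I,
      forall (f : Cbeta beta) (g : cube01 -> R) (w : sch gamma),
        Lpcube (1 - gamma)^-1 g -> \val w = density_charge g ->
        I f w = \int[leb]_(x in cube01) (ext0 (\val f) x * ext0 g x) &
      forall (f_ : nat -> Cbeta beta) (f : Cbeta beta)
             (w_ : nat -> sch gamma) (w : sch gamma),
        {uniform, (fun p => \val (f_ p)) @ \oo --> \val f} ->
        strong_norm (\val (w_ p) - \val w) @[p --> \oo] --> 0%E ->
        (ereal_sup (range (fun p => lip beta (\val (f_ p)))) < +oo)%E ->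
        (ereal_sup (range (fun p => holder_norm gamma (\val (w_ p)))) < +oo)%E ->
        I (f_ p) (w_ p) @[p --> \oo] --> I f w].
End defs.
Arguments cube01 R d : clear implicits.
Arguments BVcube R d : clear implicits.

(* Main.v *)
Require Import Defs.
From HB Require Import structures.
From mathcomp Require Import all_boot all_order all_algebra.
From mathcomp Require Import zify lra.
From mathcomp Require Import all_classical all_reals all_analysis.
From mathcomp Require Import measurable_realfun.
(* Again, as all_analysis shadows variation. *)
Require Import Defs.

Set Implicit Arguments.
Unset Strict Implicit.
Unset Printing Implicit Defensive.

Import Order.TTheory GRing.Theory Num.Theory.
Import numFieldNormedType.Exports.

Local Open Scope classical_set_scope.
Local Open Scope ring_scope.

(* The Riemann sums S_n = sum_K f(corner of K) w(K) over the dyadic cubes of side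
   2^-n satisfy |S_(n+1) - S_n| <= c Lip(f) ||w||_gamma 2^(- n (beta + d gamma - d)),
   because w is additive; the integral is their limit. As this rate is uniform,
   (B) follows from the convergence of w_p on each single dyadic cube.

   For uniqueness, a charge w is approximated by the charges w_m whose density is
   w(K) / |K| on each dyadic cube K of side 2^-m. Tested against u in BV, the
   densities of w_(m+1) and w_m differ by oscillations of the averages of u between
   neighbouring cubes, which add up to at most 2^-m V(u) times a constant. Since
   1 + d gamma > d, the w_m converge in operator norm. The limit agrees with w on
   figures (finite unions of dyadic cubes), hence everywhere, because a BV set B
   is the BV-limit of figures: take the cubes on which the average of 1_B is at
   least t, where a suitable t in [1/4, 3/4] keeps the perimeter below a multiple
   of that of B. So any solution is determined by (A) and (B). *)

(** Since V(u) is a supremum over C^1 fields, a single well-chosen field bounds it from below, but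
    an upper bound must treat all fields at once. Both directions are reduced to translations along
    the axes. From below, one explicit field tests all differences between neighbouring cubes
    simultaneously, so that u is never regularised. From above, the integral of a partial derivative
    over a set is a limit of difference quotients, which are controlled by how much the set moves
    under a small translation; for a figure this counts faces, and no divergence theorem on cubes is
    involved.

    Approximation in measure alone would not carry identities from figures to BV sets, because a
    charge is continuous only along sequences of bounded perimeter; this is what forces the choice
    of t. The interval [1/4, 3/4] stays away from 0 and 1 so that every misclassified cube costs a
    fixed fraction of its volume.

    Dyadic cubes are closed and share faces, whereas the telescoping and partition arguments need
    disjoint cubes. Hence every cube has a half-open twin, and the two differ by a null set. *)

(** * Translation invariance of Lebesgue measure *)

Section lebesgue_translation.
Context {R : realType}.
Notation mR := (measurableTypeR R).

Lemma measurable_addr (h : R) : measurable_fun setT (fun x : mR => x + h : mR).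
Proof. exact: measurable_funD. Qed.

(** By uniqueness of Lebesgue measure, it is enough that the pushforward gives the intervals ]a, b]
    their length. *)
Lemma lebesgue_measure_translation (h : R) (A : set mR) : measurable A ->
  lebesgue_measure ((fun x : mR => x + h : mR) @^-1` A) = lebesgue_measure A.
Proof.
move=> mA.
pose phi : mR -> mR := fun x => x + h.
have mphi : measurable_fun setT phi by exact: measurable_addr.
rewrite [RHS](@lebesgue_measure_unique _
  (pushforward (@lebesgue_measure R) phi))// => X.
move=> [[a b] /= _ <-].
rewrite /pushforward (_ : phi @^-1` _ = `]a - h, b - h]%classic); last first.
  by apply/seteqP; split=> x /=; rewrite /phi !in_itv/= ltrBlDr lerBrDr.
rewrite !lebesgue_measure_itv/= !lte_fin ltrD2r; case: ifPn => // _.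
by rewrite -!EFinB; congr EFin; lra.
Qed.

Lemma ge0_integral_translation (h : R) (f : mR -> \bar R) :
  measurable_fun setT f -> (forall x, (0 <= f x)%E) ->
  (\int[lebesgue_measure]_x f (x + h)%R = \int[lebesgue_measure]_x f x)%E.
Proof.
move=> mf f0; pose phi : mR -> mR := fun x => x + h.
have mphi : measurable_fun setT phi by exact: measurable_addr.
transitivity (\int[pushforward (@lebesgue_measure R) phi]_x f x)%E.
  by rewrite ge0_integral_pushforward ?preimage_setT//.
apply: (@eq_measure_integral _ mR _ setT lebesgue_measure
  (pushforward (@lebesgue_measure R) phi)) => A mA _.
exact: lebesgue_measure_translation.
Qed.

Definition tuple_translate n (u t : n.-tuple mR) : n.-tuple mR :=
  [tuple tnth t i + tnth u i | i < n].

Lemma measurable_tuple_translate n (u : n.-tuple mR) :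
  measurable_fun setT (tuple_translate u).
Proof.
apply/measurable_fun_tnthP => i.
rewrite (_ : _ \o _ = (fun t : n.-tuple mR => tnth t i + tnth u i : mR)).
  apply: (@measurableT_comp _ _ _ _ _ _ (fun x : mR => x + tnth u i : mR)).
    exact: measurable_addr.
  exact: measurable_tnth.
by apply/funext => t /=; rewrite tnth_mktuple.
Qed.

(** Induction along the iterated product: the induction hypothesis moves the sections, and the
    one-dimensional invariance moves the variable of the outer integral. *)
Lemma lebesgue_tuple_translate n (u : n.-tuple mR) (A : set (n.-tuple mR)) :
  measurable A ->
  lebesgue_tuple n (tuple_translate u @^-1` A) = lebesgue_tuple n A.
Proof.
elim: n u A => [|n IH] u A mA.
  rewrite (_ : _ @^-1` A = A)//; apply/seteqP.
  by split=> t /=; rewrite (tuple0 (tuple_translate u t)) (tuple0 t).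
rewrite /= /pushforward /product_measure1.
pose B := @tcons R n @^-1` A.
have mB : measurable B.
  by rewrite -[B]setTI; apply: measurable_tcons.
(* A section of the translated set is a translate of the section over the shifted base point. *)
have E (x : mR) : xsection (@tcons R n @^-1` (tuple_translate u @^-1` A)) x =
    tuple_translate [tuple of behead u] @^-1` xsection B (x + thead u).
  apply/seteqP; split=> t; rewrite /xsection/= !inE /B/=;
  rewrite (_ : tuple_translate u _ = tcons (x + thead u, tuple_translate [tuple of behead u] t))//.
    apply/eq_from_tnth => i; rewrite tnth_mktuple [in LHS](tuple_eta u).
    have [->|i0] := eqVneq i ord0; first by rewrite !tnth0.
    have [j ->] : exists j, i = lift ord0 j.
      by case: (unliftP ord0 i) i0 => [j ->|-> /eqP//]; exists j.
    by rewrite !tnthS tnth_mktuple.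
  apply/eq_from_tnth => i; rewrite tnth_mktuple [in LHS](tuple_eta u).
  have [->|i0] := eqVneq i ord0; first by rewrite !tnth0.
  have [j ->] : exists j, i = lift ord0 j.
    by case: (unliftP ord0 i) i0 => [j ->|-> /eqP//]; exists j.
  by rewrite !tnthS tnth_mktuple.
pose phi x := lebesgue_tuple n (xsection B x).
transitivity (\int[lebesgue_measure]_x phi (x + thead u)%R)%E.
  apply: eq_integral => x _ /=; rewrite E IH//.
  exact: measurable_xsection.
rewrite ge0_integral_translation//.
exact: measurable_fun_xsection.
Qed.

End lebesgue_translation.

Section leb_basics.
Context {R : realType} {d : nat}.
Implicit Types (A B : set 'rV[R]_d) (v x : 'rV[R]_d).

Lemma measurable_borel_leb (A : set (@rVborel R d)) : measurable A ->
  measurable (A : set (rVleb R d)).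
Proof.
by move=> mA; apply: sub_caratheodory; exact: sub_sigma_algebra.
Qed.

Lemma leb_borelE (A : set (@rVborel R d)) : measurable A ->
  leb (A : set (rVleb R d)) = lebesgue_borel d A.
Proof. move=> mA; exact: (@measurable_mu_extE _ _ _ (lebesgue_borel d)). Qed.

Definition translate v x := x + v.

Lemma measurable_borel_translate v :
  measurable_fun setT (translate v : @rVborel R d -> @rVborel R d).
Proof.
rewrite (_ : translate v = @rV_of_tuple R d \o
   tuple_translate (tuple_of_rV v) \o @tuple_of_rV R d).
  apply: measurableT_comp; last exact: measurable_tuple_of_rV.
  apply: measurableT_comp; last exact: measurable_tuple_translate.
  exact: measurable_rV_of_tuple.
by apply/funext => x; apply/rowP => i; rewrite /= !mxE !tnth_mktuple.
Qed.

Lemma lebesgue_borel_translate v (A : set (@rVborel R d)) : measurable A ->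
  lebesgue_borel d (translate v @^-1` A) = lebesgue_borel d A.
Proof.
move=> mA; rewrite /lebesgue_borel /= /pushforward.
have -> : @rV_of_tuple R d @^-1` (translate v @^-1` A) =
    tuple_translate (tuple_of_rV v) @^-1` (@rV_of_tuple R d @^-1` A).
  apply/funext => t; apply: (congr1 A); apply/rowP => i.
  by rewrite /= /translate /rV_of_tuple !mxE !tnth_mktuple.
apply: lebesgue_tuple_translate.
rewrite -[X in measurable X]setTI; exact: measurable_rV_of_tuple.
Qed.

Lemma translateNK v : cancel (translate (- v)) (translate v).
Proof. by move=> x; rewrite /translate subrK. Qed.

(** Translating a Borel cover of A gives a cover of the translate with the same total measure. The
    reverse inequality is this one applied to - v. *)
Lemma mu_ext_translate_le v A :
  ((lebesgue_borel d)^* (translate v @^-1` A) <= (lebesgue_borel d)^* A)%mu%E.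
Proof.
apply: le_ereal_inf_tmp => _ [F [mF AF] <-].
apply: ereal_inf_lbound; exists (fun k => translate v @^-1` F k).
  split=> [k|x /= /AF[k _ Fk]]; last by exists k.
  by rewrite -[X in measurable X]setTI; apply: measurable_borel_translate.
by apply: eq_eseriesr => k _; rewrite lebesgue_borel_translate.
Qed.

Lemma mu_ext_translate v A :
  ((lebesgue_borel d)^* (translate v @^-1` A) = (lebesgue_borel d)^* A)%mu%E.
Proof.
apply/eqP; rewrite eq_le mu_ext_translate_le/=.
rewrite -[X in (mu_ext _ X <= _)%E](_ : translate (- v) @^-1` (translate v @^-1` A) = A).
  exact: mu_ext_translate_le.
by apply/seteqP; split => x /=; rewrite translateNK.
Qed.

(** Measurability here is the Caratheodory criterion and not Borel measurability. Splitting X by the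
    preimage of A is the same as splitting a translate of X by A, and the outer measure does not see
    the translation. *)
Lemma measurable_translate v :
  measurable_fun setT (translate v : rVleb R d -> rVleb R d).
Proof.
move=> _ A mA; rewrite -[X in measurable X]/(setT `&` (translate v @^-1` A)).
rewrite (setTI (translate v @^-1` A)).
suff : caratheodory_measurable (lebesgue_borel d)^*%mu (translate v @^-1` A) by [].
move=> X; have {}mA : caratheodory_measurable (lebesgue_borel d)^*%mu A by [].
rewrite -(mu_ext_translate (- v) X) [LHS](mA (translate (- v) @^-1` X)).
by congr (_ + _)%E; rewrite -[RHS](mu_ext_translate (- v)); congr mu_ext;
  apply/seteqP; split => x /=; rewrite ?translateNK.
Qed.

Lemma leb_translate v A : leb (translate v @^-1` A) = leb A.
Proof. exact: mu_ext_translate. Qed.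

End leb_basics.

(** * Volumes of boxes and a local criterion of measurability *)

Section boxes.
Context {R : realType}.
Notation mR := (measurableTypeR R).

Lemma measurable_tuple_box n (B : 'I_n -> set mR) :
  (forall i, measurable (B i)) ->
  measurable [set t : n.-tuple mR | forall i, B i (tnth t i)].
Proof.
move=> mB.
rewrite [X in measurable X](_ : _ = \bigcap_(i in [set: 'I_n]) ((fun t : n.-tuple mR => tnth t i) @^-1` B i)).
  apply: fin_bigcap_measurable => // i _.
  by rewrite -[X in measurable X]setTI; exact: measurable_tnth.
by apply/seteqP; split => t /= H i; [move=> _|]; exact: H.
Qed.

Lemma lebesgue_tuple_box n (B : 'I_n -> set mR) (b : 'I_n -> R) :
  (forall i, measurable (B i)) ->
  (forall i, lebesgue_measure (B i) = (b i)%:E) ->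
  lebesgue_tuple n [set t | forall i, B i (tnth t i)] = (\prod_i b i)%:E.
Proof.
elim: n B b => [|n IH] B b mB Bb.
  by rewrite /= big_ord0 diracE mem_set// => -[].
rewrite /= /pushforward.
have -> : @tcons R n @^-1` [set t | forall i, B i (tnth t i)] =
    B ord0 `*` [set t | forall i : 'I_n, B (lift (ord0 : 'I_n.+1) i) (tnth t i)].
  apply/seteqP; split => -[x t] /=.
    move=> H; split; first by have := H ord0; rewrite tnth0.
    by move=> i; have := H (lift ord0 i); rewrite tnthS.
  move=> [Bx H] i; case: (unliftP ord0 i) => [j ->|->].
    by rewrite tnthS; exact: H.
  by rewrite tnth0.
rewrite product_measure1E//; last first.
  exact: (@measurable_tuple_box n (fun i => B (lift (ord0 : 'I_n.+1) i))).
rewrite big_ord_recl EFinM; congr (_ * _)%E; first exact: Bb.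
by apply: (IH (fun i => B (lift (ord0 : 'I_n.+1) i))) => i; [exact: mB|exact: Bb].
Qed.

End boxes.

Section leb_boxes.
Context {R : realType} {d : nat}.
Notation mR := (measurableTypeR R).
Implicit Types (x y a : 'rV[R]_d) (s h : R).

Definition box (B : 'I_d -> set mR) : set 'rV[R]_d :=
  [set x | forall i, B i (x ord0 i)].

Lemma tuple_box_borel (B : 'I_d -> set mR) :
  box B = @tuple_of_rV R d @^-1` [set t | forall i, B i (tnth t i)].
Proof.
by apply/seteqP; split => x /= H i; have := H i; rewrite tnth_mktuple.
Qed.

Lemma measurable_borel_box (B : 'I_d -> set mR) : (forall i, measurable (B i)) ->
  measurable (box B : set (@rVborel R d)).
Proof.
move=> mB; rewrite tuple_box_borel -[X in measurable X]setTI.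
by apply: measurable_tuple_of_rV => //; exact: measurable_tuple_box.
Qed.

Lemma measurable_box (B : 'I_d -> set mR) : (forall i, measurable (B i)) ->
  measurable (box B : set (rVleb R d)).
Proof. by move=> mB; apply: measurable_borel_leb; exact: measurable_borel_box. Qed.

Lemma leb_box (B : 'I_d -> set mR) (b : 'I_d -> R) :
  (forall i, measurable (B i)) ->
  (forall i, lebesgue_measure (B i) = (b i)%:E) ->
  leb (box B) = (\prod_i b i)%:E.
Proof.
move=> mB Bb; rewrite leb_borelE; last exact: measurable_borel_box.
rewrite /lebesgue_borel /= /pushforward -(lebesgue_tuple_box mB Bb).
rewrite (_ : _ @^-1` box B = [set t | forall i, B i (tnth t i)])//.
by apply/seteqP; split => t /= H i; have := H i; rewrite mxE.
Qed.

Lemma measurable_coord (i : 'I_d) :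
  measurable_fun setT (fun x : rVleb R d => x ord0 i : mR).
Proof.
move=> _ A mA; rewrite setTI.
rewrite (_ : _ @^-1` A = box (fun j => if j == i then A else setT)).
  by apply: measurable_box => j; case: ifP.
apply/seteqP; split => x /=; last by move=> /(_ i); rewrite eqxx.
by move=> Ax j; case: eqP => // ->.
Qed.

(** A superlevel set is the union of its traces on the rational boxes on which f exceeds a, and
    these are countably many. The domain D is kept general because a Hölder function on the closed
    cube jumps when extended by 0. *)
Lemma measurable_fun_locally (D : set (rVleb R d)) (f : 'rV[R]_d -> R) :
  measurable D ->
  (forall x, D x -> forall e, 0 < e -> exists2 r, 0 < r &
     forall y, D y -> (forall i, `|y ord0 i - x ord0 i| < r) ->
       `|f y - f x| < e) ->
  measurable_fun D (f : rVleb R d -> R).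
Proof.
move=> mD cf; apply: (measurability _ (RGenOInfty.measurableE R)).
move=> /= _ [_ [a ->] <-]; rewrite preimage_itvoy.
(* The open box with rational centre [p.1] and rational half-side [p.2]. *)
pose bx (p : 'rV[rat]_d * rat) : set 'rV[R]_d := box (fun i =>
  `](ratr (p.1 ord0 i) - ratr p.2 : R), (ratr (p.1 ord0 i) + ratr p.2 : R)[%classic).
pose F p := D `&` (if `[< forall y, D y -> bx p y -> a < f y >] then bx p else set0).
rewrite [X in measurable X](_ : _ = \bigcup_p F p); last first.
  apply/seteqP; split => x /=; last first.
    move=> [p _ [Dx]]; case: ifPn => // /asboolP H bxx; split => //.
    exact: H.
  move=> [Dx afx].
  have [|r r0 fr] := cf _ Dx (f x - a); first by rewrite subr_gt0.
  (* The rational centre is only within rho of x, so points of the box are within 2 rho < r of x. *)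
  have /rat_in_itvoo[rho] : 0 < r / 2 by rewrite divr_gt0.
  rewrite in_itv/= => /andP[rho0 rhor].
  have /choice[q qP] : forall i, exists q : rat,
      `|ratr q - x ord0 i| < (ratr rho : R).
    move=> i; have /rat_in_itvoo[q] : x ord0 i - ratr rho < x ord0 i + ratr rho.
      by rewrite ltrD2l gtrN.
    by rewrite in_itv/= => qi; exists q; rewrite ltr_distl.
  exists (\row_i q i, rho) => //; split => //; rewrite ifT; last first.
    apply/asboolP => y Dy yb.
    have : `|f y - f x| < f x - a.
      apply: fr => // i; have := yb i; rewrite /= in_itv/= !mxE.
      have := qP i; rewrite !ltr_distl => /andP[? ?] /andP[? ?].
      by apply/andP; split; lra.
    by rewrite ltr_distl => /andP[+ _]; rewrite subKr.
  move=> i; rewrite /= in_itv/= !mxE.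
  by have := qP i; rewrite !ltr_distl => /andP[? ?]; apply/andP; split; lra.
apply: countable_bigcupT_measurable; first exact: countableP.
move=> p; apply: measurableI => //; case: ifPn => // _.
by apply: measurable_box => i; exact: measurable_itv.
Qed.

Lemma measurable_fun_continuous_rV (f : 'rV[R]_d -> R) : continuous f ->
  measurable_fun setT (f : rVleb R d -> R).
Proof.
move=> cf; apply: measurable_fun_locally => // x _ e e0.
have /cvgrPdist_lt /(_ e e0)/nbhs_ballP[r /= r0 H] := cf x.
exists r => // y _ yx; rewrite distrC; apply: H; split=> // i j.
by rewrite ord1 /ball/= /ball_ distrC; exact: yx.
Qed.

(** Half-open boxes of a grid are disjoint, which suits sums of integrals; the closed boxes below
    are compact and include the dyadic cubes. *)
Definition hbox a s : set 'rV[R]_d :=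
  [set x | forall i, a ord0 i <= x ord0 i < a ord0 i + s].

Definition cbox a s : set 'rV[R]_d :=
  [set x | forall i, a ord0 i <= x ord0 i <= a ord0 i + s].

Lemma hboxE a s : hbox a s = box (fun i => `[a ord0 i, a ord0 i + s[%classic).
Proof. by apply/seteqP; split => x /= H i; have := H i; rewrite /= in_itv. Qed.

Lemma cboxE a s : cbox a s = box (fun i => `[a ord0 i, a ord0 i + s]%classic).
Proof. by apply/seteqP; split => x /= H i; have := H i; rewrite /= in_itv. Qed.

Lemma measurable_hbox a s : measurable (hbox a s : set (rVleb R d)).
Proof. by rewrite hboxE; apply: measurable_box => i; exact: measurable_itv. Qed.

Lemma measurable_cbox a s : measurable (cbox a s : set (rVleb R d)).
Proof. by rewrite cboxE; apply: measurable_box => i; exact: measurable_itv. Qed.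

Lemma itv_length (a s : R) (b0 b1 : bool) : 0 <= s ->
  lebesgue_measure [set` Interval (BSide b0 a) (BSide b1 (a + s))] = s%:E.
Proof.
move=> s0; rewrite lebesgue_measure_itv/= lte_fin ltrDl.
case: ifPn; first by rewrite -EFinD addrAC subrr add0r.
by rewrite -leNgt => s1; congr EFin; apply/le_anti/andP.
Qed.

Lemma leb_hbox a s : 0 <= s -> leb (hbox a s) = (s ^+ d)%:E.
Proof.
move=> s0; rewrite hboxE (@leb_box _ (fun=> s)).
- by rewrite prodr_const card_ord.
- by move=> i; exact: measurable_itv.
- by move=> i; exact: itv_length.
Qed.

Lemma leb_cbox a s : 0 <= s -> leb (cbox a s) = (s ^+ d)%:E.
Proof.
move=> s0; rewrite cboxE (@leb_box _ (fun=> s)).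
- by rewrite prodr_const card_ord.
- by move=> i; exact: measurable_itv.
- by move=> i; exact: itv_length.
Qed.

End leb_boxes.

(** * Real-valued integrals *)

Section Rintegral_toolkit.
Context d (T : measurableType d) (R : realType) (mu : {measure set T -> \bar R}).
Implicit Types (D : set T) (f g u : T -> R).

Lemma integrable_measurable D f :
  mu.-integrable D (EFin \o f) -> measurable_fun D f.
Proof. by move=> /measurable_int/measurable_EFinP. Qed.

Lemma integrable_scale D f (r : R) : measurable D ->
  mu.-integrable D (EFin \o f) -> mu.-integrable D (EFin \o (fun x => r * f x)).
Proof. by move=> mD fi; exact: (integrableZl mD r fi). Qed.

Lemma integrable_sub D f g : measurable D ->
  mu.-integrable D (EFin \o f) -> mu.-integrable D (EFin \o g) ->
  mu.-integrable D (EFin \o (fun x => f x - g x)).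
Proof. by move=> mD fi gi; exact: (integrableB mD fi gi). Qed.

Lemma integrable_add D f g : measurable D ->
  mu.-integrable D (EFin \o f) -> mu.-integrable D (EFin \o g) ->
  mu.-integrable D (EFin \o (fun x => f x + g x)).
Proof. by move=> mD fi gi; exact: (integrableD mD fi gi). Qed.

Lemma integrable_bounded_mul D u g (M : R) : measurable D ->
  mu.-integrable D (EFin \o u) -> measurable_fun D g ->
  (forall x, D x -> `|g x| <= M) ->
  mu.-integrable D (EFin \o (fun x => u x * g x)).
Proof.
move=> mD iu mg gM.
apply: (le_integrable mD _ _ (integrableZl mD M iu)) => [|x Dx].
  apply/measurable_EFinP/measurable_funM => //.
  exact: integrable_measurable.
rewrite /comp /= lee_fin !normrM mulrC ler_wpM2r//.
by rewrite (le_trans (gM _ Dx))// ler_norm.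
Qed.

Lemma integrable_bounded D g (M : R) : measurable D -> (mu D < +oo)%E ->
  measurable_fun D g -> (forall x, D x -> `|g x| <= M) ->
  mu.-integrable D (EFin \o g).
Proof.
move=> mD Doo mg gM.
apply: measurable_bounded_integrable => //.
exists M; split; first exact: num_real.
by move=> N MN x Dx; rewrite /= (le_trans (gM _ Dx))// ltW.
Qed.

Lemma integrable_Rsum D (I : Type) (s : seq I) (P : pred I) (F : I -> T -> R) :
  measurable D -> (forall i, P i -> mu.-integrable D (EFin \o F i)) ->
  mu.-integrable D (EFin \o (fun x => \sum_(i <- s | P i) F i x)).
Proof.
move=> mD iF; rewrite (_ : _ \o _ = fun x => \sum_(i <- s | P i) (EFin \o F i) x)%E.
  exact: integrable_sum.
by apply/funext => x /=; rewrite sumEFin.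
Qed.

Lemma Rintegral_sum D (I : Type) (s : seq I) (P : pred I) (F : I -> T -> R) :
  measurable D -> (forall i, P i -> mu.-integrable D (EFin \o F i)) ->
  \int[mu]_(x in D) (\sum_(i <- s | P i) F i x) =
  \sum_(i <- s | P i) \int[mu]_(x in D) F i x.
Proof.
move=> mD iF; elim: s => [|i s IH].
  under eq_Rintegral do rewrite big_nil.
  by rewrite big_nil Rintegral_cst// mul0r.
rewrite big_cons; under eq_Rintegral do rewrite big_cons.
case: ifPn => // Pi; rewrite RintegralD ?IH//; first exact: iF.
exact: integrable_Rsum.
Qed.

Lemma Rintegral_indic D A u : measurable D -> measurable A ->
  mu.-integrable D (EFin \o u) ->
  \int[mu]_(x in D) (u x * \1_A x) = \int[mu]_(x in D `&` A) u x.
Proof.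
move=> mD mA iu; rewrite Rintegral_mkcondr; apply: eq_Rintegral => x xD.
by rewrite /patch indicE; case: ifPn; rewrite ?mulr1 ?mulr0.
Qed.

Lemma Rintegral_partition (I : finType) (P : pred I) (A : I -> set T) D u :
  measurable D -> (forall i, P i -> measurable (A i)) ->
  (forall x, D x -> exists2 i, P i & A i x) ->
  (forall i j x, P i -> P j -> A i x -> A j x -> i = j) ->
  (forall i, P i -> A i `<=` D) ->
  mu.-integrable D (EFin \o u) ->
  \int[mu]_(x in D) u x = \sum_(i | P i) \int[mu]_(x in A i) u x.
Proof.
move=> mD mA DA AA AD iu.
transitivity (\int[mu]_(x in D) (\sum_(i | P i) u x * \1_(A i) x)).
  apply: eq_Rintegral => x /set_mem/DA[i Pi Ai].
  rewrite (bigD1 i)//= big1 ?addr0 => [|j /andP[Pj ji]].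
    by rewrite indicE mem_set// mulr1.
  rewrite indicE memNset ?mulr0// => Aj.
  by move/eqP: ji; apply; exact: AA Aj Ai.
rewrite Rintegral_sum// => [|i Pi].
  apply: eq_bigr => i Pi; rewrite Rintegral_indic//; last exact: mA.
  by rewrite setIidr//; exact: AD.
apply: (integrable_bounded_mul (M := 1)) => //.
  exact/measurable_funTS/measurable_indic/mA.
by move=> x _; rewrite indicE; case: (_ \in _); rewrite ?normr1 ?normr0.
Qed.

Lemma Rdominated_convergence D (f_ : nat -> T -> R) f g : measurable D ->
  (forall n, measurable_fun D (f_ n)) -> 
  (forall x, D x -> f_ n x @[n --> \oo] --> f x) ->
  mu.-integrable D (EFin \o g) ->
  (forall n x, D x -> `|f_ n x| <= g x) ->
  \int[mu]_(x in D) f_ n x @[n --> \oo] --> \int[mu]_(x in D) f x.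
Proof.
move=> mD mf ff ig fg.
have mf' : measurable_fun D f by apply: measurable_fun_cvg mf ff.
have [if' _ H] : [/\ mu.-integrable D (EFin \o f),
    (\int[mu]_(x in D) `|(EFin \o f_ n) x - (EFin \o f) x|)%E @[n --> \oo] --> 0%E &
    (\int[mu]_(x in D) (EFin \o f_ n) x)%E @[n --> \oo] -->
    (\int[mu]_(x in D) (EFin \o f) x)%E].
  apply: (@dominated_convergence _ _ _ mu D mD (fun n => EFin \o f_ n)
    (EFin \o f) (EFin \o g)) => //.
  - by move=> n; exact/measurable_EFinP.
  - exact/measurable_EFinP.
  - apply: aeW => x Dx; apply: cvg_EFin; first by near=> n.
    exact: ff.
  - by apply: aeW => x n Dx; rewrite /= lee_fin; exact: fg.
apply: fine_cvg; rewrite fineK//.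
exact: integrable_fin_num.
Unshelve. all: by end_near. Qed.

Lemma Rintegral_mul_le D u g (M : R) : measurable D ->
  mu.-integrable D (EFin \o u) -> measurable_fun D g ->
  (forall x, D x -> `|g x| <= M) ->
  `|\int[mu]_(x in D) (u x * g x)| <= M * \int[mu]_(x in D) `|u x|.
Proof.
move=> mD iu mg gM.
have iug := integrable_bounded_mul mD iu mg gM.
apply: (le_trans (le_normr_Rintegral mD iug)).
rewrite -RintegralZl//; last exact: integrable_norm.
apply: le_Rintegral => //.
- exact: integrable_norm.
- apply: (integrableZl mD M (integrable_norm iu)).
- by move=> x Dx; rewrite normrM mulrC ler_wpM2r// gM.
Qed.

End Rintegral_toolkit.

(** * Smoothed one-dimensional profiles *)

Section one_dimensional_profiles.
Context {R : realType}.
Implicit Types (f g : R -> R) (x y h s dl : R).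

(* The first bound makes f' the derivative of f. *)
Definition C11 f (f' : R -> R) := exists2 C : R, 0 <= C & forall y h,
  `|f (y + h) - f y - h * f' y| <= C * h ^+ 2 /\ `|f' (y + h) - f' y| <= C * `|h|.

Lemma C11_is_derive f f' y : C11 f f' -> is_derive y 1 f (f' y).
Proof.
move=> [C C0 H].
have E : h^-1 *: (f (h *: 1 + y) - f y) @[h --> 0^'] --> f' y.
  apply/cvgrPdist_lt => e e0; near=> h.
  have h0 : h != 0 by near: h; exact: nbhs_dnbhs_neq.
  have [Hh _] := H y h.
  rewrite distrC [h *: 1]mulr1 (addrC h y).
  rewrite (_ : _ - _ = h^-1 * (f (y + h) - f y - h * f' y)); last first.
    by rewrite [in RHS]mulrBr mulKf.
  rewrite normrM normfV mulrC ltr_pdivrMr ?normr_gt0//.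
  apply: le_lt_trans Hh _.
  rewrite -[h ^+ 2]real_normK ?num_real// expr2 mulrA ltr_pM2r ?normr_gt0//.
  have : `|h| < e / (C + 1).
    near: h; apply: dnbhs0_lt; rewrite divr_gt0// ltr_wpDl//.
  rewrite ltr_pdivlMr ?ltr_wpDl// => he; apply: le_lt_trans he.
  by rewrite mulrC ler_wpM2l// lerDl.
by apply: DeriveDef; [apply/cvg_ex; exists (f' y); exact: E | exact: cvg_lim E].
Unshelve. all: by end_near. Qed.

Lemma C11_continuous' f f' : C11 f f' -> continuous f'.
Proof.
move=> [C C0 H] y; apply/cvgrPdist_lt => e e0; near=> z.
have [_ +] := H y (z - y); rewrite (addrC y) subrK distrC => /le_lt_trans; apply.
have : `|z - y| < e / (C + 1).
  rewrite distrC; near: z.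
  by apply: (@cvgr_dist_lt _ _ _ (nbhs y) _ id); rewrite ?divr_gt0// ltr_wpDl.
rewrite ltr_pdivlMr ?ltr_wpDl// => he; apply: le_lt_trans he.
by rewrite mulrC ler_wpM2l// lerDl.
Unshelve. all: by end_near. Qed.

Lemma C11_sub f f' g g' : C11 f f' -> C11 g g' ->
  C11 (fun x => f x - g x) (fun x => f' x - g' x).
Proof.
move=> [C C0 H] [D D0 K]; exists (C + D) => [|y h]; first exact: addr_ge0.
have [H1 H2] := H y h; have [K1 K2] := K y h; split.
  rewrite (_ : _ - _ = (f (y + h) - f y - h * f' y) - (g (y + h) - g y - h * g' y)); last lra.
  by rewrite (le_trans (ler_normB _ _))// mulrDl lerD.
rewrite (_ : _ - _ = (f' (y + h) - f' y) - (g' (y + h) - g' y)); last lra.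
by rewrite (le_trans (ler_normB _ _))// mulrDl lerD.
Qed.

Lemma C11_scale f f' c : C11 f f' -> C11 (fun x => c * f x) (fun x => c * f' x).
Proof.
move=> [C C0 H]; exists (`|c| * C) => [|y h]; first exact: mulr_ge0.
have [H1 H2] := H y h; split.
  rewrite (_ : _ - _ = c * (f (y + h) - f y - h * f' y)); last lra.
  by rewrite normrM -mulrA ler_wpM2l.
by rewrite -mulrBr normrM -mulrA ler_wpM2l.
Qed.

Lemma C11_shift f f' c : C11 f f' -> C11 (fun x => f (x + c)) (fun x => f' (x + c)).
Proof.
move=> [C C0 H]; exists C => // y h; have := H (y + c) h.
by rewrite (addrAC y c).
Qed.

Lemma C11_increment f f' (m M : R) y s : C11 f f' ->
  (forall z, m <= f' z <= M) -> 0 <= s -> m * s <= f (y + s) - f y <= M * s.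
Proof.
move=> cf mM s0.
have [|||c _ ->] := @MVT_segment R f f' y (y + s).
- by rewrite lerDl.
- by move=> z _; exact: C11_is_derive.
- apply: continuous_subspaceT => z.
  apply: differentiable_continuous; apply/derivable1_diffP.
  by have [] := C11_is_derive z cf.
- have /andP[mc cM] := mM c.
  by rewrite (addrC y) addrK !ler_wpM2r.
Qed.

Definition pospart y : R := if 0 <= y then y else 0.

Lemma C11_pospart : C11 (fun y => pospart y ^+ 2) (fun y => 2 * pospart y).
Proof.
exists 2 => // y h; rewrite /pospart.
case: (leP 0 (y + h)) => yh; case: (leP 0 y) => y0; split;
  rewrite -?(@real_normK _ h) ?num_real//;
  rewrite ler_norml; case: (ger0P h) => h0; apply/andP; split; nra.
Qed.

(** A quadratic spline that smooths max(y, 0) at scale [dl]; its derivative is [ramp], which climbs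
    linearly from 0 to 1 on [0, dl]. *)
Definition hinge dl y := (2 * dl)^-1 * (pospart y ^+ 2 - pospart (y - dl) ^+ 2).

Definition ramp dl y := dl^-1 * (pospart y - pospart (y - dl)).

Lemma C11_hinge dl : 0 < dl -> C11 (hinge dl) (ramp dl).
Proof.
move=> dl0.
have := C11_scale (2 * dl)^-1 (C11_sub C11_pospart (C11_shift (- dl) C11_pospart)).
congr C11; apply/funext => y /=.
by rewrite /ramp -mulrBr invfM mulrCA mulrA mulVKf.
Qed.

Lemma ramp_eq0 dl y : 0 < dl -> y <= 0 -> ramp dl y = 0.
Proof.
move=> dl0 y0; rewrite /ramp /pospart.
case: (leP 0 (y - dl)) => ?; first by exfalso; lra.
by case: (leP 0 y) => ?; rewrite ?subrr ?mulr0// (_ : y = 0) ?subr0 ?mulr0//; lra.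
Qed.

Lemma ramp_eq1 dl y : 0 < dl -> dl <= y -> ramp dl y = 1.
Proof.
move=> dl0 y0; rewrite /ramp /pospart !ifT ?subr_ge0//; last by lra.
by rewrite subKr mulVf// gt_eqF.
Qed.

Lemma ramp_nondecreasing dl y s : 0 < dl -> 0 <= s -> ramp dl y <= ramp dl (y + s).
Proof.
move=> dl0 s0; rewrite /ramp ler_pM2l ?invr_gt0// /pospart.
case: ifPn; rewrite -?ltNge => ?; case: ifPn; rewrite -?ltNge => ?;
case: ifPn; rewrite -?ltNge => ?; case: ifPn; rewrite -?ltNge => ?; lra.
Qed.

Lemma ramp01 dl y : 0 < dl -> 0 <= ramp dl y <= 1.
Proof.
move=> dl0; rewrite /ramp mulrC ler_pdivlMr// ler_pdivrMr// mul0r mul1r /pospart.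
case: ifPn; rewrite -?ltNge => ?; case: ifPn; rewrite -?ltNge => ?; lra.
Qed.

Lemma hinge_eq0 dl y : 0 < dl -> y <= 0 -> hinge dl y = 0.
Proof.
move=> dl0 y0; rewrite /hinge /pospart; case: ifPn => ?; case: ifPn => ?.
- by lra.
- by rewrite (_ : y = 0) ?expr0n ?subrr ?mulr0//; lra.
- by lra.
- by rewrite subrr mulr0.
Qed.

Lemma hinge_linear dl y : 0 < dl -> dl <= y -> hinge dl y = y - dl / 2.
Proof.
move=> dl0 y0; rewrite /hinge /pospart !ifT ?subr_ge0//; last by lra.
have d0 : 2 * dl != 0 by rewrite mulf_neq0// gt_eqF.
apply: (mulfI d0); rewrite mulVKf//; lra.
Qed.

Lemma hinge_increment dl y s : 0 < dl -> 0 <= s ->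
  0 <= hinge dl (y + s) - hinge dl y <= s.
Proof.
move=> dl0 s0.
have := C11_increment y (C11_hinge dl0) (fun z => ramp01 z dl0) s0.
by rewrite mul0r mul1r.
Qed.

(** The increment of [hinge] over a step s has derivative ramp (z + s) - ramp z >= 0 in the starting
    point. *)
Lemma hinge_convex dl y s r : 0 < dl -> 0 <= s -> 0 <= r ->
  hinge dl (y + s) - hinge dl y <= hinge dl (y + r + s) - hinge dl (y + r).
Proof.
move=> dl0 s0 r0.
have C := C11_sub (C11_shift s (C11_hinge dl0)) (C11_hinge dl0).
have := @C11_increment _ _ 0 1 y r C.
rewrite mul0r subr_ge0 => H; apply: (proj1 (andP (H _ r0))) => z.
have := ramp01 z dl0; have := ramp01 (z + s) dl0.
have := @ramp_nondecreasing dl z s dl0 s0; lra.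
Qed.

(* With this shift stepup dl is 1 on [0, +oo[, so that plateau s dl converges
   pointwise to the indicator of [0, s[ as dl tends to 0. *)
Definition stepup dl y := dl^-1 * (hinge dl (y + dl + dl) - hinge dl (y + dl)).

Lemma stepup01 dl y : 0 < dl -> 0 <= stepup dl y <= 1.
Proof.
move=> dl0; rewrite /stepup mulrC ler_pdivlMr// ler_pdivrMr// mul0r mul1r.
by apply: hinge_increment => //; exact: ltW.
Qed.

Lemma stepup_nondecreasing dl y s : 0 < dl -> 0 <= s ->
  stepup dl y <= stepup dl (y + s).
Proof.
move=> dl0 s0; rewrite /stepup ler_pM2l ?invr_gt0//.
by have := @hinge_convex dl (y + dl) dl s dl0 (ltW dl0) s0; rewrite (addrAC y s).
Qed.

Lemma stepup_eq1 dl y : 0 < dl -> 0 <= y -> stepup dl y = 1.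
Proof.
move=> dl0 y0; rewrite /stepup !hinge_linear//; [|lra|lra].
by apply: (mulfI (lt0r_neq0 dl0)); rewrite mulVKf ?gt_eqF//; lra.
Qed.

Lemma stepup_eq0 dl y : 0 < dl -> y <= - (2 * dl) -> stepup dl y = 0.
Proof. by move=> dl0 y0; rewrite /stepup !hinge_eq0// ?subrr ?mulr0//; lra. Qed.

Definition plateau s dl x := stepup dl x - stepup dl (x - s).

Definition dplateau s dl x := dl^-1 * (ramp dl (x + dl + dl) - ramp dl (x + dl)) -
   dl^-1 * (ramp dl (x - s + dl + dl) - ramp dl (x - s + dl)).

Lemma C11_plateau s dl : 0 < dl -> C11 (plateau s dl) (dplateau s dl).
Proof.
move=> dl0; have H := C11_hinge dl0.
have S : C11 (stepup dl)
    (fun x => dl^-1 * (ramp dl (x + dl + dl) - ramp dl (x + dl))).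
  apply: C11_scale; apply: C11_sub; last exact: C11_shift.
  by apply: (C11_shift (f := fun x => hinge dl (x + dl))
    (f' := fun x => ramp dl (x + dl))); exact: C11_shift.
by apply: C11_sub => //; exact: (C11_shift (- s) S).
Qed.

Lemma plateau01 s dl x : 0 < dl -> 0 <= s -> 0 <= plateau s dl x <= 1.
Proof.
move=> dl0 s0; have := @stepup_nondecreasing dl (x - s) s dl0 s0.
rewrite subrK /plateau.
have := stepup01 x dl0; have := stepup01 (x - s) dl0; lra.
Qed.

Lemma plateau_eq0 s dl x : 0 < dl -> 0 <= s -> x <= - (2 * dl) \/ s <= x ->
  plateau s dl x = 0.
Proof.
move=> dl0 s0 [x0|sx]; rewrite /plateau.
  by rewrite !stepup_eq0 ?subrr//; lra.
by rewrite !stepup_eq1 ?subrr//; lra.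
Qed.

(** Plateaus at consecutive grid points telescope to a difference of two values of [stepup], each in
    [0, 1]. The smoothing thus costs nothing, although neighbouring plateaus overlap. *)
Lemma plateau_sum s dl x N : 0 < dl -> 0 <= s ->
  \sum_(k < N) plateau s dl (x - s * k%:R) <= 1.
Proof.
move=> dl0 s0.
rewrite -(big_mkord xpredT (fun k => plateau s dl (x - s * k%:R))).
rewrite (eq_bigr (fun k => - stepup dl (x - s * k.+1%:R) - - stepup dl (x - s * k%:R))).
  rewrite telescope_sumr//.
  have := stepup01 (x - s * 0%:R) dl0; have := stepup01 (x - s * N%:R) dl0.
  by rewrite opprK; lra.
move=> k _; rewrite /plateau opprK addrC; congr (- stepup _ _ + _).
by rewrite -natr1 mulrDr mulr1 opprD addrA.
Qed.

(* A primitive, up to smoothing, of 1_[0, s[ - 1_[s, 2 s[. *)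
Definition tent s dl x :=
  (hinge dl (x + dl) - hinge dl (x - s + dl)) -
  (hinge dl (x - s + dl) - hinge dl (x - s - s + dl)).

Definition dtent s dl x :=
  (ramp dl (x + dl) - ramp dl (x - s + dl)) -
  (ramp dl (x - s + dl) - ramp dl (x - s - s + dl)).

Lemma C11_tent s dl : 0 < dl -> C11 (tent s dl) (dtent s dl).
Proof.
move=> dl0; have H := C11_shift dl (C11_hinge dl0).
have H1 := C11_shift (- s) H; have H2 := C11_shift (- s) H1.
by apply: C11_sub; apply: C11_sub.
Qed.

(** A tent is a second difference of the convex function [hinge]. *)
Lemma tent_ge0 s dl x : 0 < dl -> 0 <= s -> 0 <= tent s dl x.
Proof.
move=> dl0 s0; have := @hinge_convex dl (x - s - s + dl) s s dl0 s0 s0.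
rewrite /tent (_ : x - s - s + dl + s = x - s + dl); last lra.
by rewrite (_ : x - s + dl + s = x + dl); lra.
Qed.

Lemma tent_eq0 s dl x : 0 < dl -> 0 <= s -> x <= - dl \/ 2 * s <= x ->
  tent s dl x = 0.
Proof.
move=> dl0 s0 [x0|sx]; rewrite /tent.
  by rewrite !hinge_eq0//; lra.
by rewrite !hinge_linear//; lra.
Qed.

(** A tent is the difference of D at x and at x - s, where D is an increment of [hinge] over a step
    s and so lies in [0, s]. This telescoping is the origin of the factor s in the bound of grid
    differences. *)
Lemma tent_sum s dl x N : 0 < dl -> 0 <= s ->
  \sum_(k < N) tent s dl (x - s * k%:R) <= s.
Proof.
move=> dl0 s0.
pose D y := hinge dl (y + dl) - hinge dl (y - s + dl).
have D01 y : 0 <= D y <= s.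
  have := @hinge_increment dl (y - s + dl) s dl0 s0.
  by rewrite /D (_ : y - s + dl + s = y + dl); lra.
rewrite -(big_mkord xpredT (fun k => tent s dl (x - s * k%:R))).
rewrite (eq_bigr (fun k => - D (x - s * k.+1%:R) - - D (x - s * k%:R))).
  rewrite telescope_sumr//.
  have := D01 (x - s * 0%:R); have := D01 (x - s * N%:R).
  by rewrite opprK; lra.
move=> k _; rewrite /tent opprK addrC; congr (- _ + _).
by rewrite /D -natr1 mulrDr mulr1 opprD addrA.
Qed.

Lemma dtent_le1 s dl x : 0 < dl -> 0 <= s -> `|dtent s dl x| <= 1.
Proof.
move=> dl0 s0; rewrite /dtent ler_norml.
have := @ramp_nondecreasing dl (x - s + dl) s dl0 s0.
have := @ramp_nondecreasing dl (x - s - s + dl) s dl0 s0.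
rewrite (_ : x - s - s + dl + s = x - s + dl); last lra.
rewrite (_ : x - s + dl + s = x + dl); last lra.
have := ramp01 (x + dl) dl0; have := ramp01 (x - s + dl) dl0.
by have := ramp01 (x - s - s + dl) dl0; lra.
Qed.

Let mesh m : R := m.+1%:R^-1.

Lemma mesh_gt0 m : 0 < mesh m. Proof. by rewrite invr_gt0. Qed.

Lemma near_mesh_lt y : 0 < y -> \forall m \near \oo, mesh m < y.
Proof. by move=> y0; exact: (near_infty_natSinv_lt (PosNum y0)). Qed.

(** Because of the shift by [mesh m] the value at y = 0 is already 1, so the limit is the indicator
    of the closed half-line; differences of such limits are indicators of half-open intervals. *)
Lemma ramp_cvg y : ramp (mesh m) (y + mesh m) @[m --> \oo] --> ((0 <= y)%R%:R : R).
Proof.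
apply: cvg_near_cst; case: (leP 0 y) => y0.
  by near=> m; rewrite ramp_eq1 ?mesh_gt0//; lra.
near=> m; rewrite ramp_eq0 ?mesh_gt0//.
have : mesh m < - y by near: m; apply: near_mesh_lt; rewrite oppr_gt0.
lra.
Unshelve. all: by end_near. Qed.

Lemma stepup_cvg y : stepup (mesh m) y @[m --> \oo] --> ((0 <= y)%R%:R : R).
Proof.
apply: cvg_near_cst; case: (leP 0 y) => y0.
  by near=> m; rewrite stepup_eq1 ?mesh_gt0//; lra.
near=> m; rewrite stepup_eq0 ?mesh_gt0//.
have : mesh m < - y / 2 by near: m; apply: near_mesh_lt; rewrite divr_gt0// oppr_gt0.
lra.
Unshelve. all: by end_near. Qed.

Lemma plateau_cvg s y : 0 <= s ->
  plateau s (mesh m) y @[m --> \oo] --> ((0 <= y < s)%R%:R : R).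
Proof.
move=> s0; rewrite (_ : _%:R = (0 <= y)%R%:R - (0 <= y - s)%R%:R).
  by apply: cvgB; exact: stepup_cvg.
rewrite subr_ge0; case: (leP 0 y); case: (leP s y) => /=; rewrite ?subr0 ?subrr//.
by move=> ? ?; lra.
Qed.

Lemma dtent_cvg s y : 0 <= s -> dtent s (mesh m) y @[m --> \oo] -->
  ((0 <= y < s)%R%:R - (0 <= y - s < s)%R%:R : R).
Proof.
move=> s0; rewrite (_ : _ - _ = ((0 <= y)%R%:R - (0 <= y - s)%R%:R) -
    ((0 <= y - s)%R%:R - (0 <= y - s - s)%R%:R)).
  by apply: cvgB; apply: cvgB; exact: ramp_cvg.
case: (leP 0 y); case: (ltP y s) => /=; case: (leP 0 (y - s)) => /=;
 case: (ltP (y - s) s) => /=; case: (leP 0 (y - s - s)) => /=;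
 rewrite ?subr0 ?subrr//; lra.
Qed.

End one_dimensional_profiles.

(** * C^1 functions built from one-dimensional profiles *)

Section C1_functions.
Context {R : realType} {d : nat}.
Local Notation V := 'rV[R]_d.
Implicit Types (f g : V -> R) (v x : V).

Lemma continuousD_rV f g : continuous f -> continuous g ->
  continuous (fun x => f x + g x).
Proof. move=> cf cg x. exact: (continuousD (cf x) (cg x)). Qed.

Lemma continuousM_rV f g : continuous f -> continuous g ->
  continuous (fun x => f x * g x).
Proof. move=> cf cg x; exact: (continuousM (cf x) (cg x)). Qed.

Lemma continuousZ_rV m n f (M : 'M[R]_(m, n)) : continuous f ->
  continuous (fun x => f x *: M).
Proof. by move=> cf x; exact: (continuousZr_tmp (cf x)). Qed.
Lemma continuous_sum_rV m n (I : Type) (r : seq I) (F : I -> V -> 'M[R]_(m, n)) :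
  (forall k, continuous (F k)) -> continuous (fun x => \sum_(k <- r) F k x).
Proof.
move=> cF; elim: r => [|k r IH].
  rewrite (_ : (fun=> _) = fun=> 0); first exact: cst_continuous.
  by apply/funext => x; rewrite big_nil.
rewrite (_ : (fun=> _) = fun x => F k x + \sum_(k <- r) F k x).
  by move=> x; exact: (continuousD (cF k x) (IH x)).
by apply/funext => x; rewrite big_cons.
Qed.

Lemma diffM_at f g x v : differentiable f x -> differentiable g x ->
  'd (fun x => f x * g x) x v = f x * 'd g x v + g x * 'd f x v.
Proof. by move=> df dg; rewrite (_ : (fun x => f x * g x) = f * g)// diffM. Qed.

Lemma diffD_at f g x v : differentiable f x -> differentiable g x ->
  'd (fun x => f x + g x) x v = 'd f x v + 'd g x v.
Proof. by move=> df dg; rewrite (_ : (fun x => f x + g x) = f + g)// diffD. Qed.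

Lemma diff_coord (j : 'I_d) x v : 'd (fun y : V => y ord0 j) x v = v ord0 j.
Proof.
have @f : {linear V -> R}.
  by exists (fun N : V => N ord0 j); do 2![eexists]; do ?[constructor];
     rewrite ?mxE// => ? *; rewrite ?mxE//; move=> ?; rewrite !mxE.
have cf : continuous f by exact: coord_continuous.
by rewrite (_ : (fun _ => _) = f) //; rewrite (diff_lin x cf).
Qed.

Lemma diff_cst_at (c : R) x v : 'd (fun _ : V => c) x v = 0.
Proof. by rewrite (_ : (fun=> c) = cst c)// diff_cst. Qed.

Lemma diffcM_at (c : R) g x v : differentiable g x ->
  'd (fun x => c * g x) x v = c * 'd g x v.
Proof.
move=> dg; have dc : differentiable (fun _ : V => c) x by exact: differentiable_cst.
by rewrite (@diffM_at (fun=> c) g x v dc dg) diff_cst_at mulr0 addr0.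
Qed.

Lemma jacobian0 (x : V) : jacobian (fun _ : V => 0 : V) x = 0.
Proof.
apply/matrixP => j k; rewrite /jacobian mxE.
by rewrite (_ : (fun=> 0) = cst (0 : V))// diff_cst !mxE.
Qed.

Definition C1rV f := (forall x, differentiable f x) /\
  forall v, continuous (fun x => 'd f x v).

Definition unit_rV (i : 'I_d) : V := delta_mx ord0 i.

Lemma unit_rVE i j : unit_rV i ord0 j = (j == i)%:R.
Proof. by rewrite mxE eqxx. Qed.

Lemma C1rV_continuous f : C1rV f -> continuous f.
Proof. by move=> [df _] x; exact: differentiable_continuous. Qed.

Lemma C1rV_cst (c : R) : C1rV (fun=> c).
Proof.
split=> [x|v]; first exact: differentiable_cst.
rewrite (_ : (fun=> _) = fun=> 0); first exact: cst_continuous.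
by apply/funext => x; rewrite diff_cst_at.
Qed.

Lemma C1rVM f g : C1rV f -> C1rV g -> C1rV (fun x => f x * g x).
Proof.
move=> Cf Cg; split=> [x|v].
  rewrite (_ : (fun x => _) = f * g)//.
  by apply: differentiableM; [case: Cf|case: Cg].
rewrite (_ : (fun=> _) = fun x => f x * 'd g x v + g x * 'd f x v); last first.
  by apply/funext => x; rewrite diffM_at//; [case: Cf|case: Cg].
have [cf cg] := (C1rV_continuous Cf, C1rV_continuous Cg).
by apply: continuousD_rV; apply: continuousM_rV => //; [case: Cg|case: Cf].
Qed.

Lemma C1rVD f g : C1rV f -> C1rV g -> C1rV (fun x => f x + g x).
Proof.
move=> Cf Cg; split=> [x|v].
  rewrite (_ : (fun x => _) = f + g)//.
  by apply: differentiableD; [case: Cf|case: Cg].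
rewrite (_ : (fun=> _) = fun x => 'd f x v + 'd g x v); last first.
  by apply/funext => x; rewrite diffD_at//; [case: Cf|case: Cg].
by apply: continuousD_rV; [case: Cf|case: Cg].
Qed.

Lemma diff_coord_comp (h h' : R -> R) (j : 'I_d) x v : C11 h h' ->
  differentiable (fun y : V => h (y ord0 j)) x /\
  'd (fun y : V => h (y ord0 j)) x v = v ord0 j * h' (x ord0 j).
Proof.
move=> hh'; have [dh <-] := C11_is_derive (x ord0 j) hh'.
have dc := @differentiable_coord R _ _ x ord0 j.
have dh' : differentiable h (x ord0 j) by exact/derivable1_diffP.
rewrite (_ : (fun y => _) = h \o (fun y : V => y ord0 j))//.
split; first exact: differentiable_comp.
by rewrite diff_comp//= diff_coord diff1E// derive1E.
Qed.

Lemma C1rV_coord_comp (h h' : R -> R) (j : 'I_d) : C11 h h' ->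
  C1rV (fun y : V => h (y ord0 j)).
Proof.
move=> hh'; split=> [x|v]; first by have [] := diff_coord_comp j x 0 hh'.
rewrite (_ : (fun=> _) = fun x => v ord0 j * h' (x ord0 j)); last first.
  by apply/funext => x; have [_ ->] := diff_coord_comp j x v hh'.
apply: continuousM_rV; first exact: cst_continuous.
move=> x; apply: (@continuous_comp _ _ _ (fun y : V => y ord0 j) h').
  exact: coord_continuous.
exact: C11_continuous' hh' _.
Qed.

(** The second part says that the product ignores directions transverse to the coordinates of P.
    With P the coordinates other than i, only the i-th factor is differentiated in direction i. *)
Lemma C1rV_prod (s : seq 'I_d) (P : pred 'I_d) (h h' : 'I_d -> R -> R) :
  (forall j, C11 (h j) (h' j)) ->
  C1rV (fun y : V => \prod_(j <- s | P j) h j (y ord0 j)) /\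
  forall v, (forall j, P j -> v ord0 j = 0) -> forall x,
   'd (fun y : V => \prod_(j <- s | P j) h j (y ord0 j)) x v = 0.
Proof.
move=> hh'; elim: s => [|j s [IH1 IH2]].
  rewrite (_ : (fun=> _) = fun=> 1); last by apply/funext => y; rewrite big_nil.
  by split=> [|v _ x]; [exact: C1rV_cst|rewrite diff_cst_at].
case: (boolP (P j)) => Pj; last first.
  rewrite (_ : (fun=> _) = fun y : V => \prod_(j <- s | P j) h j (y ord0 j))//.
  by apply/funext => y; rewrite big_cons (negbTE Pj).
rewrite (_ : (fun=> _) = fun y : V => h j (y ord0 j) *
    \prod_(j <- s | P j) h j (y ord0 j)); last first.
  by apply/funext => y; rewrite big_cons Pj.
have Cj := C1rV_coord_comp j (hh' j).
split=> [|v Pv x].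
  exact: (@C1rVM (fun y => h j (y ord0 j)) (fun y => \prod_(j <- s | P j) h j (y ord0 j))).
rewrite (@diffM_at (fun y => h j (y ord0 j))
  (fun y => \prod_(j <- s | P j) h j (y ord0 j)))//; [|by case: Cj|by case: IH1].
rewrite IH2// (diff_coord_comp j x v (hh' j)).2 Pv//.
by rewrite mul0r !mulr0 addr0.
Qed.

Lemma diff_prod_unit (h h' : 'I_d -> R -> R) i x :
  (forall j, C11 (h j) (h' j)) ->
  'd (fun y : V => \prod_j h j (y ord0 j)) x (unit_rV i) =
  h' i (x ord0 i) * \prod_(j | j != i) h j (x ord0 j).
Proof.
move=> hh'.
rewrite (_ : (fun=> _) = fun y : V => h i (y ord0 i) *
    \prod_(j | j != i) h j (y ord0 j)); last first.
  by apply/funext => y; rewrite (bigD1 i).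
have [C D] := C1rV_prod (index_enum 'I_d) (fun j => j != i) hh'.
have [di Di] := diff_coord_comp i x (unit_rV i) (hh' i).
rewrite (@diffM_at (fun y => h i (y ord0 i))
  (fun y => \prod_(j | j != i) h j (y ord0 j)))//; last by case: C.
rewrite D => [|j /negbTE ji]; last by rewrite unit_rVE ji.
by rewrite Di unit_rVE eqxx mul1r mulr0 add0r mulrC.
Qed.

Lemma C1rV_sum (I : finType) (c : I -> R) (F : I -> V -> R) :
  (forall k, C1rV (F k)) ->
  C1rV (fun x => \sum_k c k * F k x) /\
  forall x v, 'd (fun x => \sum_k c k * F k x) x v = \sum_k c k * 'd (F k) x v.
Proof.
move=> CF; elim: (index_enum I) => [|k s [IH1 IH2]].
  rewrite (_ : (fun=> _) = fun=> 0); last by apply/funext => y; rewrite big_nil.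
  by split=> [|x v]; [exact: C1rV_cst|rewrite diff_cst_at big_nil].
have Ck := C1rVM (C1rV_cst (c k)) (CF k).
rewrite (_ : (fun=> _) = fun x => c k * F k x + \sum_(k <- s) c k * F k x); last first.
  by apply/funext => y; rewrite big_cons.
split=> [|x v].
  exact: (@C1rVD (fun x => c k * F k x) (fun x => \sum_(k <- s) c k * F k x)).
have dk : differentiable (fun x => c k * F k x) x by case: Ck.
have ds : differentiable (fun x => \sum_(k <- s) c k * F k x) x by case: IH1.
transitivity ('d (fun x => c k * F k x) x v + 'd (fun x => \sum_(k <- s) c k * F k x) x v).
  exact: (diffD_at v dk ds).
by rewrite big_cons; congr (_ + _); [apply: diffcM_at; case: (CF k)|exact: IH2].
Qed.

End C1_functions.

(** * Test fields with a single component *)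

Section test_fields.
Context {R : realType} {d : nat}.
Local Notation V := 'rV[R]_d.
Implicit Types (f phi : V -> R) (u : V -> R) (x a : V).

Lemma compact_cbox a (s : R) : compact (cbox a s).
Proof.
rewrite (_ : cbox a s = [set x | forall i, `[a ord0 i, a ord0 i + s]%classic (x ord0 i)]).
  apply: (@rV_compact R d (fun i => `[a ord0 i, a ord0 i + s]%classic)) => i.
  exact: segment_compact.
by apply/seteqP; split => x /= H i; have := H i; rewrite in_itv.
Qed.

Lemma test_field_coord phi a (s : R) i : C1rV phi ->
  (forall x, `|phi x| <= 1) -> (forall x, ~ cbox a s x -> phi x = 0) ->
  test_field (fun x => phi x *: unit_rV i).
Proof.
move=> [dphi cphi] phi1 phi0; split.
- by move=> x; exact: differentiableZl.
- rewrite (_ : jacobian _ = fun x => \sum_(j < d) ('d phi x (unit_rV j)) *: delta_mx j i).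
    by apply: continuous_sum_rV => j; apply: continuousZ_rV; exact: cphi.
  apply/funext => x; apply/matrixP => j k; rewrite /jacobian mxE diffZl//.
  rewrite summxE (bigD1 j)//= big1 => [|l lj].
    by rewrite !mxE !eqxx addr0.
  by rewrite !mxE eq_sym (negbTE lj) mulr0.
- have cb : closed (cbox a s).
    by apply: compact_closed; [exact: norm_hausdorff|exact: compact_cbox].
  apply: (@subclosed_compact V _ (cbox a s)); [exact: closed_closure|exact: compact_cbox|].
  rewrite [X in _ `<=` X](closure_id _).1//; apply: closure_subset => x /= vx0.
  by apply: contrapT => /phi0 E; move/eqP: vx0; apply; rewrite E scale0r.
- move=> x; rewrite /enorm (bigD1 i)//= big1 => [|j ji].
    by rewrite addr0 mxE unit_rVE eqxx mulr1 sqrtr_sqr.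
  by rewrite mxE unit_rVE (negbTE ji) mulr0 expr0n.
Qed.

Lemma divergence_coord phi i x : C1rV phi ->
  divergence (fun x => phi x *: unit_rV i) x = 'd phi x (unit_rV i).
Proof.
move=> [dphi _]; rewrite /divergence /mxtrace (bigD1 i)//= big1 => [|j ji].
  by rewrite /jacobian mxE diffZl// mxE unit_rVE eqxx mulr1 addr0.
by rewrite /jacobian mxE diffZl// mxE unit_rVE (negbTE ji) mulr0.
Qed.

Lemma variation_ge0 u : (0 <= variation u)%E.
Proof.
apply: ereal_sup_ubound; exists (fun=> 0).
  split.
  - by move=> x; exact: differentiable_cst.
  - rewrite (_ : jacobian _ = fun=> 0); first exact: cst_continuous.
    by apply/funext => x; exact: jacobian0.
  - rewrite (_ : [set _ | _] = set0) ?closure0; first exact: compact0.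
    by apply/seteqP; split => x //=; rewrite eqxx.
  - by move=> x; rewrite /enorm big1 ?sqrtr0// => i _; rewrite mxE expr0n.
rewrite (eq_integral (fun=> 0%E)) ?integral0// => x _; congr EFin.
by rewrite /divergence jacobian0 mxtrace0 mulr0.
Qed.

(** The field M^-1 phi e_i is admissible, and scaling back gives the factor M. *)
Lemma variation_ge_partial u phi a (s M : R) i : C1rV phi -> 0 < M ->
  (forall x, `|phi x| <= M) -> (forall x, ~ cbox a s x -> phi x = 0) ->
  leb.-integrable setT (EFin \o u) -> (variation u < +oo)%E ->
  leb.-integrable setT (EFin \o (fun x => u x * 'd phi x (unit_rV i))) ->
  \int[leb]_x (u x * 'd phi x (unit_rV i)) <= M * fine (variation u).
Proof.
move=> Cphi M0 phiM phi0 iu Vu iuphi.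
pose psi : V -> R := fun x => M^-1 * phi x.
have Cpsi : C1rV psi := C1rVM (C1rV_cst M^-1) Cphi.
have dpsi x : 'd psi x (unit_rV i) = M^-1 * 'd phi x (unit_rV i).
  by apply: diffcM_at; case: Cphi.
have tf : test_field (fun x => psi x *: unit_rV i).
  apply: (@test_field_coord psi a s) => // x.
    rewrite /psi /= normrM normfV mulrC ler_pdivrMr ?normr_gt0 ?gt_eqF//.
    by rewrite mul1r (gtr0_norm M0).
  by move=> /phi0; rewrite /psi /= => ->; rewrite mulr0.
have : (\int[leb]_x (M^-1 * (u x * 'd phi x (unit_rV i)))%:E <= variation u)%E.
  apply: ereal_sup_ubound; exists (fun x => psi x *: unit_rV i) => //.
  by apply: eq_integral => x _; rewrite divergence_coord// dpsi mulrCA.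
have /fineK <- : variation u \is a fin_num by rewrite ge0_fin_numE// variation_ge0.
have ic : leb.-integrable setT
    (EFin \o (fun x => M^-1 * (u x * 'd phi x (unit_rV i)))).
  exact: integrable_scale.
rewrite -[X in (X <= _)%E]fineK; last exact: integrable_fin_num ic.
rewrite lee_fin -[fine _]/(\int[leb]_x (M^-1 * (u x * 'd phi x (unit_rV i)))).
by rewrite /= RintegralZl// mulrC ler_pdivrMr// mulrC.
Qed.

End test_fields.

(** * Differences between neighbouring grid cells are controlled by the variation *)

Section grid_variation.
Context {R : realType} {d : nat}.
Local Notation V := 'rV[R]_d.
Implicit Types (u : V -> R) (x a o : V) (s : R) (i : 'I_d).

Lemma cvg_prodR (I : Type) (r : seq I) (P : pred I) (f : I -> nat -> R) (l : I -> R) :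
  (forall k, P k -> f k m @[m --> \oo] --> l k) ->
  \prod_(k <- r | P k) f k m @[m --> \oo] --> \prod_(k <- r | P k) l k.
Proof.
move=> H; elim: r => [|k r IH].
  by rewrite big_nil; under eq_fun do rewrite big_nil; exact: cvg_cst.
rewrite big_cons; under eq_fun do rewrite big_cons.
by case: ifPn => // Pk; apply: cvgM => //; exact: H.
Qed.

Lemma cvg_sumR (I : Type) (r : seq I) (P : pred I) (f : I -> nat -> R) (l : I -> R) :
  (forall k, P k -> f k m @[m --> \oo] --> l k) ->
  \sum_(k <- r | P k) f k m @[m --> \oo] --> \sum_(k <- r | P k) l k.
Proof.
move=> H; elim: r => [|k r IH].
  by rewrite big_nil; under eq_fun do rewrite big_nil; exact: cvg_cst.
rewrite big_cons; under eq_fun do rewrite big_cons.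
by case: ifPn => // Pk; apply: cvgD => //; exact: H.
Qed.

Lemma hbox_indic a s x :
  \1_(hbox a s) x = \prod_j ((0 <= x ord0 j - a ord0 j < s)%R%:R) :> R.
Proof.
rewrite indicE; case: (boolP (x \in _)) => [/set_mem H|].
  rewrite big1// => j _; have := H j.
  by rewrite subr_ge0 ltrBlDl => ->.
rewrite notin_setE => /existsNP[j /negP H].
rewrite (bigD1 j)//= subr_ge0 ltrBlDl (negbTE H).
by rewrite mul0r.
Qed.

(** Grid points are indexed by finite functions so that a sum over the grid of products over
    coordinates factors into a product of one-dimensional sums. *)
Definition gpt N o s (k : {ffun 'I_d -> 'I_N}) : V :=
  \row_j (o ord0 j + s * (k j)%:R).

Lemma hbox_indic_shift a s i x : \1_(hbox (a + s *: unit_rV i) s) x =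
  ((0 <= x ord0 i - a ord0 i - s < s)%R%:R) *
  \prod_(j | j != i) ((0 <= x ord0 j - a ord0 j < s)%R%:R) :> R.
Proof.
rewrite hbox_indic (bigD1 i)//= !mxE !eqxx/= mulr1 opprD addrA.
congr (_ * _); apply: eq_bigr => j /negbTE ji.
by rewrite !mxE eqxx ji /= mulr0 addr0.
Qed.

Section approximation.
Variables (N : nat) (o : V) (s : R) (i : 'I_d) (c : {ffun 'I_d -> 'I_N} -> R).
Hypothesis s0 : 0 < s.
Hypothesis c1 : forall k, `|c k| <= 1.

Let mesh m : R := m.+1%:R^-1.
Let profile m (j : 'I_d) := if j == i then tent s (mesh m) else plateau s (mesh m).
Let dprofile m (j : 'I_d) := if j == i then dtent s (mesh m) else dplateau s (mesh m).
Let g := @gpt N o s.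

Let factor m k (j : 'I_d) (y : R) := profile m j (y - g k ord0 j).
Let dfactor m k (j : 'I_d) (y : R) := dprofile m j (y - g k ord0 j).

(** Each summand is a tent in direction i times plateaus in the other directions. The tent spans two
    neighbouring cells, and its derivative is nearly 1 on the lower one and -1 on the upper one. *)
Definition grid_field m (x : V) :=
  \sum_(k : {ffun 'I_d -> 'I_N}) c k * \prod_j factor m k j (x ord0 j).

Let C11_factor m k j : C11 (factor m k j) (dfactor m k j).
Proof.
apply: (C11_shift (- g k ord0 j)); rewrite /profile /dprofile.
by case: ifPn => _; [apply: C11_tent|apply: C11_plateau]; exact: mesh_gt0.
Qed.

Let factor_ge0 m k j y : 0 <= factor m k j y.
Proof.
rewrite /factor /profile; case: ifPn => _.
  by apply: tent_ge0; [exact: mesh_gt0|exact: ltW].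
by have /andP[] := plateau01 (y - g k ord0 j) (mesh_gt0 m) (ltW s0).
Qed.

Lemma C1rV_grid_field m : C1rV (grid_field m).
Proof.
have [|//] := @C1rV_sum R d _ c (fun k (x : V) => \prod_j factor m k j (x ord0 j)).
move=> k; have [//] := C1rV_prod (index_enum 'I_d) xpredT (C11_factor m k).
Qed.

Definition dgrid_field m x := \sum_(k : {ffun 'I_d -> 'I_N}) c k *
  (dtent s (mesh m) (x ord0 i - g k ord0 i) *
   \prod_(j | j != i) plateau s (mesh m) (x ord0 j - g k ord0 j)).

Lemma diff_grid_field m x : 'd (grid_field m) x (unit_rV i) = dgrid_field m x.
Proof.
have [|_ ->] := @C1rV_sum R d _ c (fun k (x : V) => \prod_j factor m k j (x ord0 j)).
  by move=> k; have [] := C1rV_prod (index_enum 'I_d) xpredT (C11_factor m k).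
apply: eq_bigr => k _; rewrite (diff_prod_unit _ _ (C11_factor m k)).
rewrite /dfactor /dprofile eqxx; congr (_ * (_ * _)).
by apply: eq_bigr => j /negbTE ji; rewrite /factor /profile ji.
Qed.

(** As the c k are at most 1 in absolute value, the sum is at most a product over the coordinates of
    one-dimensional sums: at most s for the tents in direction i, and at most 1 for the plateaus in
    every other direction. *)
Lemma grid_field_le m x : `|grid_field m x| <= s.
Proof.
apply: (le_trans (ler_norm_sum _ _ _)).
apply: (@le_trans _ _ (\sum_(k : {ffun 'I_d -> 'I_N}) \prod_j factor m k j (x ord0 j))).
  apply: ler_sum => k _; rewrite normrM [X in _ * X]ger0_norm; last exact: prodr_ge0.
  by rewrite ler_piMl//; exact: prodr_ge0.
rewrite (eq_bigr (fun k : {ffun 'I_d -> 'I_N} =>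
    \prod_j profile m j ((x ord0 j - o ord0 j) - s * (k j)%:R))); last first.
  move=> k _; apply: eq_bigr => j _.
  by rewrite /factor /g mxE opprD addrA.
rewrite -(bigA_distr_bigA (fun j (l : 'I_N) =>
   profile m j ((x ord0 j - o ord0 j) - s * l%:R))).
rewrite (bigD1 i)//= -[leRHS]mulr1; apply: ler_pM.
- apply: sumr_ge0 => l _; rewrite /profile eqxx.
  by apply: tent_ge0; [exact: mesh_gt0|exact: ltW].
- apply: prodr_ge0 => j /negbTE ji; apply: sumr_ge0 => l _; rewrite /profile ji.
  by have /andP[] := plateau01 (x ord0 j - o ord0 j - s * l%:R) (mesh_gt0 m) (ltW s0).
- by rewrite /profile eqxx; apply: tent_sum; [exact: mesh_gt0|exact: ltW].
- apply: prodr_ile1 => j /negbTE ji; rewrite /profile ji; apply/andP; split.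
    apply: sumr_ge0 => l _.
    by have /andP[] := plateau01 (x ord0 j - o ord0 j - s * l%:R) (mesh_gt0 m) (ltW s0).
  by apply: plateau_sum; [exact: mesh_gt0|exact: ltW].
Qed.

(** The box is independent of m: the smoothing overhangs on the left by at most 2 [mesh m] <= 2, and
    the tent of the last cell reaches one cell beyond the grid, hence [N.+1]. *)
Lemma grid_field_eq0 m x :
  ~ cbox (\row_j (o ord0 j - 2)) (2 + s * N.+1%:R) x -> grid_field m x = 0.
Proof.
move=> /existsNP[j /negP xj]; apply: big1 => k _.
rewrite (bigD1 j)//= (_ : factor m k j _ = 0) ?mul0r ?mulr0//.
have m1 : mesh m <= 1 by rewrite invf_le1// ler1n.
have m0 : 0 < mesh m := mesh_gt0 m; have s0' := s0.
have kN : (k j)%:R + 1 <= N%:R :> R by rewrite natr1 ler_nat.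
have kge : 0 <= (k j)%:R :> R by [].
have sN : s * ((k j)%:R + 1) <= s * N%:R by rewrite ler_pM2l.
have sk : 0 <= s * (k j)%:R by rewrite mulr_ge0// ltW.
have H : x ord0 j - g k ord0 j <= - (2 * mesh m) \/ 2 * s <= x ord0 j - g k ord0 j.
  move: xj; rewrite /g !mxE negb_and -!ltNge -natr1 => /orP[xj|xj]; [left|right]; lra.
rewrite /factor /profile; case: ifPn => _.
  by apply: tent_eq0; [|exact: ltW|case: H => H; [left|right] => //; lra].
by apply: plateau_eq0; [|exact: ltW|case: H => H; [left|right] => //; lra].
Qed.

(** Crude, but uniform in m, as dominated convergence requires. *)
Lemma dgrid_field_le m x : `|dgrid_field m x| <= #|{ffun 'I_d -> 'I_N}|%:R.
Proof.
apply: (le_trans (ler_norm_sum _ _ _)).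
rewrite -sum1_card natr_sum; apply: ler_sum => k _.
rewrite normrM mulr_ile1// normrM mulr_ile1//.
  by apply: dtent_le1; [exact: mesh_gt0|exact: ltW].
rewrite normr_prod; apply: prodr_ile1 => j _; rewrite normr_ge0/=.
have /andP[p0 p1] := plateau01 (x ord0 j - g k ord0 j) (mesh_gt0 m) (ltW s0).
by rewrite ger0_norm.
Qed.

Lemma dgrid_field_cvg x : dgrid_field m x @[m --> \oo] -->
  \sum_(k : {ffun 'I_d -> 'I_N}) c k *
    (\1_(hbox (g k) s) x - \1_(hbox (g k + s *: unit_rV i) s) x).
Proof.
apply: cvg_sumR => k _; apply: cvgM; first exact: cvg_cst.
rewrite hbox_indic hbox_indic_shift (bigD1 i)//= -mulrBl.
apply: cvgM; first by apply: dtent_cvg; exact: ltW.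
by apply: cvg_prodR => j _; apply: plateau_cvg; exact: ltW.
Qed.

End approximation.

(* Test u against grid_field with c k the sign of the k-th difference: the i-th
   derivative of this field tends to sum_k c k (1_(Q k) - 1_(Q k + s e_i)), while
   its sup norm stays below s. *)
Theorem grid_variation u N o s i : leb.-integrable setT (EFin \o u) ->
  (variation u < +oo)%E -> 0 < s ->
  \sum_(k : {ffun 'I_d -> 'I_N})
    `|\int[leb]_(x in hbox (gpt o s k + s *: unit_rV i) s) u x
      - \int[leb]_(x in hbox (gpt o s k) s) u x| <= s * fine (variation u).
Proof.
move=> iu Vu s0.
pose U a := \int[leb]_(x in hbox a s) u x.
pose c (k : {ffun 'I_d -> 'I_N}) : R :=
  if 0 <= U (gpt o s k) - U (gpt o s k + s *: unit_rV i) then 1 else -1.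
have c1 k : `|c k| <= 1 by rewrite /c; case: ifP; rewrite ?normrN normr1.
pose G (x : V) := \sum_(k : {ffun 'I_d -> 'I_N}) c k *
    (\1_(hbox (gpt o s k) s) x - \1_(hbox (gpt o s k + s *: unit_rV i) s) x).
have iI a : leb.-integrable setT (EFin \o (fun x => u x * \1_(hbox a s) x)).
  apply: (@integrable_bounded_mul _ (rVleb R d) R leb setT u _ 1 measurableT iu).
    exact/measurable_indic/measurable_hbox.
  by move=> x _; rewrite indicE; case: (_ \in _); rewrite ?normr1 ?normr0.
have -> : \sum_(k : {ffun 'I_d -> 'I_N}) `|U (gpt o s k + s *: unit_rV i) - U (gpt o s k)| =
    \int[leb]_x (u x * G x).
  transitivity (\int[leb]_x (\sum_(k : {ffun 'I_d -> 'I_N}) c k *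
     (u x * \1_(hbox (gpt o s k) s) x - u x * \1_(hbox (gpt o s k + s *: unit_rV i) s) x))).
    rewrite Rintegral_sum//; last first.
      by move=> k _; apply: integrable_scale => //; exact: integrable_sub.
    apply: eq_bigr => k _; rewrite RintegralZl//; last exact: integrable_sub.
    rewrite RintegralB// !Rintegral_indic//; try exact: measurable_hbox.
    rewrite !setTI -/(U _) -/(U _) distrC /c.
    by case: ifPn => [/ger0_norm->|]; rewrite ?mul1r// -ltNge mulN1r => /ltr0_norm.
  apply: eq_Rintegral => x _; rewrite mulr_sumr; apply: eq_bigr => k _.
  by rewrite -mulrBr mulrCA.
have mdg m : measurable_fun setT (dgrid_field o s i c m : rVleb R d -> R).
  apply: measurable_fun_continuous_rV.
  have [_ /(_ (unit_rV i))] : C1rV (grid_field o s i c m) by exact: C1rV_grid_field.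
  rewrite (_ : (fun x => _) = dgrid_field o s i c m)//.
  by apply/funext => x; rewrite diff_grid_field.
have idg m : leb.-integrable setT (EFin \o (fun x => u x * dgrid_field o s i c m x)).
  apply: (integrable_bounded_mul (M := #|{ffun 'I_d -> 'I_N}|%:R)) => // x _.
  exact: dgrid_field_le.
have H : \int[leb]_x (u x * dgrid_field o s i c m x) @[m --> \oo] -->
    \int[leb]_x (u x * G x).
  apply: (@Rdominated_convergence _ _ R leb setT
    (fun m x => u x * dgrid_field o s i c m x) (fun x => u x * G x)
    (fun x => #|{ffun 'I_d -> 'I_N}|%:R * `|u x|)).
  - exact: measurableT.
  - by move=> m; exact: integrable_measurable (idg m).
  - move=> x _; apply: cvgM; first exact: cvg_cst.
    exact: dgrid_field_cvg.
  - by apply: integrable_scale; [exact: measurableT|exact: integrable_norm].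
  - move=> m x _; rewrite normrM mulrC; apply: ler_wpM2r; first exact: normr_ge0.
    exact: dgrid_field_le.
(* Each smoothed field already satisfies the bound, with sup norm at most s, so the limit does
   too. *)
apply: (cvgr_to_le H); apply: nearW => m.
have E x : dgrid_field o s i c m x = 'd (grid_field o s i c m) x (unit_rV i).
  by rewrite diff_grid_field.
under eq_Rintegral do rewrite E.
apply: (variation_ge_partial (a := \row_j (o ord0 j - 2)) (s := 2 + s * N.+1%:R)) => //.
- exact: C1rV_grid_field.
- by move=> x; exact: grid_field_le.
- by move=> x; exact: grid_field_eq0.
- rewrite (_ : _ \o _ = EFin \o (fun x => u x * dgrid_field o s i c m x))//.
  by apply/funext => x /=; rewrite E.
Qed.

End grid_variation.

(** * Upper bounds of the perimeter by translations *)

Section perimeter_translation.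
Context {R : realType} {d : nat}.
Local Notation V := 'rV[R]_d.
Implicit Types (f g phi : V -> R) (x e w a : V).

Lemma Rintegral_translate w (phi : rVleb R d -> R) :
  measurable_fun setT phi ->
  leb.-integrable setT (EFin \o (phi \o translate w)) ->
  \int[leb]_x phi (translate w x) = \int[leb]_x phi x.
Proof.
move=> mphi iphi; have mt := @measurable_translate R d w.
apply/esym; congr fine.
transitivity (\int[pushforward (@leb R d) (translate w : rVleb R d -> rVleb R d)]_x (phi x)%:E)%E.
  apply: (@eq_measure_integral _ (rVleb R d) _ setT
    (pushforward (@leb R d) (translate w : rVleb R d -> rVleb R d)) leb) => A mA _.
  by rewrite /= /pushforward leb_translate.
have mf : measurable_fun setT (EFin \o phi) by exact/measurable_EFinP.
exact: (@integral_pushforward _ _ (rVleb R d) (rVleb R d) R (translate w) mt leb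
  setT (EFin \o phi) mf iphi measurableT).
Qed.

Lemma is_derive_line f x e (t : R) : (forall y, differentiable f y) ->
  is_derive t 1 (fun t => f (x + t *: e)) ('d f (x + t *: e) e).
Proof.
move=> df; set F := fun t : R => f (x + t *: e).
have E : (fun h : R => h^-1 *: ((F \o shift t) (h *: 1) - F t)) =
   (fun h : R => h^-1 *: ((f \o shift (x + t *: e)) (h *: e) - f (x + t *: e))).
  apply/funext => h; congr (_ *: (_ - _)); rewrite /F /=; congr f.
  by rewrite [h *: 1]mulr1 scalerDl addrCA.
have de : derivable f (x + t *: e) e by exact: diff_derivable.
have Ee : 'D_e f (x + t *: e) = 'd f (x + t *: e) e by exact: deriveE.
apply: DeriveDef; first by rewrite /derivable E.
by rewrite /derive E -Ee.
Qed.

Lemma difference_quotient_cvg f x e (t : nat -> R) : differentiable f x ->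
  (forall m, t m != 0) -> t m @[m --> \oo] --> (0 : R) ->
  (t m)^-1 * (f (x + t m *: e) - f x) @[m --> \oo] --> ('d f x e : R).
Proof.
move=> df t0 tcvg.
have de : derivable f x e by exact: diff_derivable.
have Ee : 'D_e f x = 'd f x e by exact: deriveE.
have cv : h^-1 *: ((f \o shift x) (h *: e) - f x) @[h --> 0^'] --> ('d f x e : R).
  by rewrite -Ee; exact: de.
have [+ _] := @cvgr_dnbhsP R (fun h => h^-1 *: ((f \o shift x) (h *: e) - f x)) 0 ('d f x e).
move=> /(_ cv t) H.
rewrite (_ : (fun m => _) = fun m => (t m)^-1 *: ((f \o shift x) (t m *: e) - f x)).
  by apply: H; split.
by apply/funext => m; rewrite /= (addrC x).
Qed.

Lemma increment_bound f x e (h K : R) : (forall y, differentiable f y) -> 0 <= h ->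
  (forall t, 0 <= t <= h -> `|'d f (x + t *: e) e| <= K) ->
  `|f (x + h *: e) - f x| <= K * h.
Proof.
move=> df h0 fK.
have D t := @is_derive_line f x e t df.
have [||c cab] := @MVT_segment R (fun t => f (x + t *: e))
  (fun t => 'd f (x + t *: e) e) 0 h.
- by [].
- apply: continuous_subspaceT => t.
  apply: differentiable_continuous; apply/derivable1_diffP.
  by have [] := D t.
rewrite scale0r addr0 subr0 => ->.
by rewrite normrM (ger0_norm h0) ler_wpM2r// fK//; move: cab; rewrite in_itv.
Qed.

Lemma continuous_bounded_cbox g a (s : R) : continuous g ->
  exists2 K, 0 <= K & forall x, cbox a s x -> `|g x| <= K.
Proof.
move=> cg; have [->|/set0P ne] := eqVneq (cbox a s) set0.
  by exists 0.
have cng : continuous (fun x => `|g x|).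
  by move=> x; apply: (continuous_comp (cg x)); exact: norm_continuous.
have [c _ H] := EVT_max_rV ne (@compact_cbox R d a s) (continuous_subspaceT cng).
by exists `|g c| => // x xb; apply: H; rewrite inE.
Qed.

Lemma entry_le_enorm (x : V) i : `|x ord0 i| <= enorm x.
Proof.
rewrite -sqrtr_sqr ler_wsqrtr// (bigD1 i)//= lerDl.
by apply: sumr_ge0 => j _; exact: sqr_ge0.
Qed.

Lemma jacobian_entry (v : V -> V) x (i j : 'I_d) : differentiable v x ->
  jacobian v x j i = 'd (fun y => v y ord0 i) x (unit_rV j) /\
  differentiable (fun y => v y ord0 i) x.
Proof.
move=> dv.
have dc := @differentiable_coord R _ _ (v x) ord0 i.
rewrite (_ : (fun y => v y ord0 i) = (fun y : V => y ord0 i) \o v)//.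
split; last exact: differentiable_comp.
by rewrite diff_comp//= diff_coord /jacobian mxE.
Qed.

Section main_bound.
Variables (A : set V) (a : V) (s : R) (c : 'I_d -> R).
Hypothesis mA : measurable (A : set (rVleb R d)).
Hypothesis AS : A `<=` cbox a s.
Hypothesis Ac : exists2 h0 : R, 0 < h0 & forall i (h : R), 0 < h < h0 ->
  \int[leb]_x `|\1_A (x - h *: unit_rV i) - \1_A x| <= c i * h.

Let leb_finite (B : set V) (b : V) (r : R) : measurable (B : set (rVleb R d)) ->
  B `<=` cbox b r -> (leb B < +oo)%E.
Proof.
move=> mB Br; apply: (@le_lt_trans _ _ (leb (cbox b `|r|))).
  apply: le_measure; rewrite ?inE//; first exact: measurable_cbox.
  move=> x /Br H i; have := H i => /andP[-> /= Hi].
  by rewrite (le_trans Hi)// lerD2l ler_norm.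
by rewrite leb_cbox// ltry.
Qed.

Let m1 (B : set V) : measurable (B : set (rVleb R d)) ->
  measurable_fun setT (\1_B : rVleb R d -> R).
Proof. by move=> mB; exact: measurable_indic. Qed.

Let measurable_preimage (B : set V) w : measurable (B : set (rVleb R d)) ->
  measurable (translate w @^-1` B : set (rVleb R d)).
Proof.
move=> mB; have := @measurable_translate R d w measurableT B mB.
by rewrite setTI.
Qed.

Let integrable_indic_bounded (B : set V) f b r : measurable (B : set (rVleb R d)) ->
  B `<=` cbox b r -> measurable_fun setT (f : rVleb R d -> R) ->
  (forall x, `|f x| <= 1) ->
  leb.-integrable setT (EFin \o (fun x => \1_B x * f x)).
Proof.
move=> mB Br mf f1; apply: (integrable_bounded_mul (M := 1)) => //.
apply/integrableP; split; first exact/measurable_EFinP/m1.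
rewrite (eq_integral (fun x : rVleb R d => (\1_B x)%:E)); last first.
  by move=> x _; rewrite /= ger0_norm.
by rewrite integral_indic// setIT (leb_finite mB Br).
Qed.

(* The integral is the limit of difference quotients of f, and translation
   invariance moves the difference from f to the indicator of A. *)
Lemma partial_integral_le f i : (forall x, differentiable f x) ->
  continuous (fun x => 'd f x (unit_rV i)) -> (forall x, `|f x| <= 1) ->
  \int[leb]_(x in A) 'd f x (unit_rV i) <= c i.
Proof.
move=> df cg f1; have [h0 h00 Ach] := Ac.
set e := unit_rV i.
pose mesh m : R := m.+1%:R^-1.
have mesh0 m : 0 < mesh m by rewrite invr_gt0.
have mesh1 m : mesh m <= 1 by rewrite invf_le1// ler1n.
pose D m x := (mesh m)^-1 * (f (x + mesh m *: e) - f x).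
have cf : continuous f by move=> x; exact: differentiable_continuous.
have mf : measurable_fun setT (f : rVleb R d -> R).
  exact: measurable_fun_continuous_rV.
have mfs w : measurable_fun setT ((fun x => f (x + w)) : rVleb R d -> R).
  exact: (measurableT_comp mf (@measurable_translate R d w)).
(* The box is enlarged by 1 to contain the segments from points of A to their translates by [mesh m]
   <= 1. *)
have [K K0 gK] := @continuous_bounded_cbox _ a (s + 1) cg.
have DK m x : A x -> `|D m x| <= K.
  move=> /AS Ax; rewrite /D normrM normfV (gtr0_norm (mesh0 m)) mulrC.
  rewrite ler_pdivrMr//; apply: increment_bound => //; first exact: ltW.
  move=> t /andP[t0 th]; apply: gK => j.
  rewrite mxE [X in _ + X]mxE /e unit_rVE; have /andP[H1 H2] := Ax j.
  have tj : 0 <= t * (j == i)%:R <= 1.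
    case: (j == i); rewrite /= ?mulr1 ?mulr0 ?lexx ?ler01// t0.
    exact: le_trans th (mesh1 m).
  by move: tj => /andP[? ?]; apply/andP; split; lra.
have A_fin := leb_finite mA AS.
have Dcvg x : A x -> D m x @[m --> \oo] --> 'd f x e.
  move=> _; apply: difference_quotient_cvg; first exact: df.
    by move=> m; rewrite gt_eqF.
  exact: cvg_harmonic.
pose A' (h : R) := translate (- (h *: e)) @^-1` A.
have A'E h x : \1_(A' h) x = \1_A (x - h *: e) :> R.
  by rewrite !indicE; congr (nat_of_bool _)%:R; apply/idP/idP; rewrite !inE.
have mA' h : measurable (A' h : set (rVleb R d)) by exact: measurable_preimage.
have A'S h : A' h `<=` cbox (a + h *: e) s.
  move=> x /AS Ax j; have := Ax j; rewrite /translate !mxE => /andP[? ?].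
  by apply/andP; split; lra.
have I1 h := integrable_indic_bounded (mA' h) (A'S h) mf f1.
have I2 := integrable_indic_bounded mA AS mf f1.
have I3 h : leb.-integrable setT (EFin \o (fun x => \1_A x * f (x + h *: e))).
  exact: (integrable_indic_bounded mA AS (mfs _)).
have one_int (B : set V) b r : measurable (B : set (rVleb R d)) -> B `<=` cbox b r ->
    leb.-integrable setT (EFin \o (\1_B : V -> R)).
  move=> mB Br; have := @integrable_indic_bounded B (fun=> 1) b r mB Br.
  rewrite (_ : (fun x => _ * 1) = \1_B); last by apply/funext => x; rewrite mulr1.
  by apply => // x; rewrite normr1.
have intA g : \int[leb]_(x in A) g x = \int[leb]_x (\1_A x * g x).
  rewrite Rintegral_mkcond; apply: eq_Rintegral => x _.
  by rewrite /patch indicE; case: ifPn; rewrite ?mul1r ?mul0r.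
pose J (h : R) := \int[leb]_x (\1_(A' h) x * f x - \1_A x * f x).
have JE m : \int[leb]_(x in A) D m x = (mesh m)^-1 * J (mesh m).
  rewrite intA /J (RintegralB measurableT (I1 _) I2).
  have -> : \int[leb]_x (\1_(A' (mesh m)) x * f x) =
      \int[leb]_x (\1_A x * f (x + mesh m *: e)).
    rewrite -(@Rintegral_translate (mesh m *: e) (fun x => \1_(A' (mesh m)) x * f x)).
    - by apply: eq_Rintegral => x _; rewrite A'E /translate addrK.
    - exact: integrable_measurable (I1 _).
    - rewrite (_ : _ \o translate _ = fun x => \1_A x * f (x + mesh m *: e)); first exact: I3.
      by apply/funext => x /=; rewrite A'E /translate addrK.
  rewrite -(RintegralB measurableT (I3 _) I2).
  rewrite -(RintegralZl _ measurableT (integrable_sub measurableT (I3 _) I2)).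
  by apply: eq_Rintegral => x _; rewrite /D mulrCA mulrBr.
have Jle h : 0 < h < h0 -> J h <= c i * h.
  move=> hh; apply: le_trans (Ach i h hh).
  apply: le_Rintegral.
  - exact: measurableT.
  - exact: integrable_sub.
  - have -> : (fun x : V => `|\1_A (x - h *: unit_rV i) - \1_A x|) =
        (fun x => `|\1_(A' h) x - \1_A x| : R).
      by apply/funext => x; rewrite A'E.
    exact: (integrable_norm (integrable_sub measurableT
      (one_int _ _ _ (mA' h) (A'S h)) (one_int _ _ _ mA AS))).
  - move=> x _; rewrite -mulrBl; apply: (le_trans (ler_norm _)).
    by rewrite A'E normrM ler_piMr.
have DA : \int[leb]_(x in A) D m x @[m --> \oo] --> \int[leb]_(x in A) 'd f x e.
  apply: (@Rdominated_convergence _ (rVleb R d) R leb A D (fun x => 'd f x e) (fun=> K)).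
  - exact: mA.
  - move=> k; apply: measurable_funTS; apply: measurable_funM.
      exact: measurable_cst.
    by apply: measurable_funB; [exact: mfs|exact: mf].
  - exact: Dcvg.
  - apply: (@integrable_bounded _ _ _ _ _ _ K) => // x _.
    by rewrite ger0_norm.
  - exact: DK.
apply: (cvgr_to_le DA).
have : \forall m \near \oo, mesh m < h0 by exact: near_mesh_lt.
apply: filterS => m hm; rewrite JE mulrC ler_pdivrMr//.
by apply: Jle; rewrite mesh0.
Qed.

(** Each component of a test field is bounded by 1, so the divergence can be integrated one partial
    derivative at a time, and every axis contributes its own translation constant. The boundary of A
    is never described. *)
Theorem perimeter_le_translation : (perimeter A <= (\sum_i c i)%:E)%E.
Proof.
apply: ge_ereal_sup => _ [v [dv cJ _ v1] <-].
have E : (\int[leb]_x (\1_A x * divergence v x)%:E =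
    \int[leb]_(x in A) (divergence v x)%:E)%E.
  rewrite [RHS]integral_mkcond; apply: eq_integral => x _.
  by rewrite /patch indicE; case: ifPn => _; rewrite ?mul1r ?mul0r.
have A_fin := leb_finite mA AS.
have cg i : continuous (fun x => 'd (fun y => v y ord0 i) x (unit_rV i)).
  rewrite (_ : (fun x => _) = fun x => jacobian v x i i).
    by move=> x; exact: (continuous_comp (cJ x) (@coord_continuous _ _ _ i i _)).
  by apply/funext => x; have [-> _] := jacobian_entry i i (dv x).
have ig i : leb.-integrable A (EFin \o (fun x => 'd (fun y => v y ord0 i) x (unit_rV i))).
  have [K K0 gK] := @continuous_bounded_cbox _ a s (cg i).
  apply: (@integrable_bounded _ _ _ _ _ _ K).
  - exact: mA.
  - exact: A_fin.
  - exact/measurable_funTS/measurable_fun_continuous_rV/cg.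
  - by move=> x /AS; exact: gK.
have D x : divergence v x = \sum_i 'd (fun y => v y ord0 i) x (unit_rV i).
  by apply: eq_bigr => i _; have [-> _] := jacobian_entry i i (dv x).
have iD : leb.-integrable A (EFin \o divergence v).
  rewrite (_ : divergence v = fun x => \sum_i 'd (fun y => v y ord0 i) x (unit_rV i)).
    exact: integrable_Rsum.
  by apply/funext.
rewrite E -[X in (X <= _)%E]fineK; last exact: integrable_fin_num iD.
rewrite lee_fin -[fine _]/(\int[leb]_(x in A) divergence v x).
under eq_Rintegral do rewrite D.
rewrite Rintegral_sum//; apply: ler_sum => i _.
apply: partial_integral_le => // x; first by have [_] := jacobian_entry i i (dv x).
by apply: le_trans (v1 x); exact: entry_le_enorm.
Qed.

End main_bound.

End perimeter_translation.

Section symmetric_difference.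
Context d (T : measurableType d) (R : realType) (mu : {measure set T -> \bar R}).

(** Sets of equal finite measure exceed each other by the same amount, whence the factor 2. *)
Lemma integral_norm_indicB (A B : set T) : measurable A -> measurable B ->
  mu A \is a fin_num -> mu B = mu A ->
  \int[mu]_x `|\1_B x - \1_A x| = 2 * fine (mu (A `\` B)).
Proof.
move=> mA mB Afin BA; have mAB : measurable (A `&` B) by exact: measurableI.
have Bfin : mu B \is a fin_num by rewrite BA.
have ABfin : mu (A `&` B) \is a fin_num.
  rewrite ge0_fin_numE//; apply: (@le_lt_trans _ _ (mu A)).
    by apply: le_measure; rewrite ?inE//; exact: subIsetl.
  by rewrite -ge0_fin_numE.
have E : mu (B `\` A) = mu (A `\` B).
  rewrite !measureD//; [|by rewrite -ge0_fin_numE|by rewrite -ge0_fin_numE].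
  by congr (_ - _)%E; [exact: BA|rewrite setIC].
have Dfin : mu (A `\` B) \is a fin_num.
  rewrite ge0_fin_numE//; apply: (@le_lt_trans _ _ (mu A)).
    apply: le_measure; [apply/mem_set; exact: measurableD|exact/mem_set|].
    by move=> x [].
  by rewrite -ge0_fin_numE.
rewrite /Rintegral.
transitivity (fine (\int[mu]_x ((\1_(A `\` B) x)%:E + (\1_(B `\` A) x)%:E))%E).
  congr fine; apply: eq_integral => x _; rewrite -EFinD; congr EFin.
  rewrite !indicE !in_setD; case: (x \in A); case: (x \in B) => /=;
  by rewrite ?subrr ?normr0 ?addr0 ?add0r ?subr0 ?sub0r ?normrN ?normr1.
rewrite ge0_integralD//; last 2 first.
- exact/measurable_EFinP/measurable_indic/measurableD.
- exact/measurable_EFinP/measurable_indic/measurableD.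
rewrite !integral_indic//; try exact: measurableD.
by rewrite !setIT E fineD// mulr_natl mulr2n.
Qed.

End symmetric_difference.

(** * Perimeter of unions of grid cubes *)

Section figures.
Context {R : realType} {d : nat}.
Local Notation V := 'rV[R]_d.
Implicit Types (x a : V) (s h : R) (i : 'I_d).

(** The slab of thickness h along the lower face of a cube in direction i: the part of the cube that
    a translation by h e_i can uncover. *)
Definition cstrip a s i h : set V :=
  [set x | cbox a s x /\ x ord0 i < a ord0 i + h].

Lemma cstripE a s i h : h <= s -> cstrip a s i h =
  box (fun j => [set` Interval (BLeft (a ord0 j))
    (BSide (j == i) (a ord0 j + (if j == i then h else s)))]).
Proof.
move=> hs; apply/seteqP; split => x /=.
  move=> [H xi] j; have := H j; rewrite /= in_itv/=; case: eqP => [->|_]//=.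
  by rewrite xi andbT => /andP[].
move=> H; split; last by have := H i; rewrite /= in_itv/= eqxx => /andP[].
move=> j; have := H j; rewrite /= in_itv/=; case: eqP => [->|_]//= /andP[-> /=] /ltW H'.
by rewrite (le_trans H')// lerD2l.
Qed.

Lemma measurable_cstrip a s i h : h <= s ->
  measurable (cstrip a s i h : set (rVleb R d)).
Proof.
by move=> hs; rewrite cstripE//; apply: measurable_box => j; exact: measurable_itv.
Qed.

Lemma leb_cstrip a s i h : 0 <= h <= s ->
  leb (cstrip a s i h) = (h * s ^+ d.-1)%:E.
Proof.
move=> /andP[h0 hs].
rewrite cstripE// (@leb_box _ _ _ (fun j => if j == i then h else s)).
- congr EFin; rewrite (bigD1 i)//= eqxx; congr *%R.
  rewrite (eq_bigr (fun=> s)) => [|j /negbTE->//].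
  by rewrite prodr_const cardC1 card_ord.
- by move=> j; exact: measurable_itv.
- by move=> j; apply: itv_length; case: ifP => // _; exact: le_trans hs.
Qed.

Section grid_figure.
Variables (N : nat) (o : V) (s : R).
Hypothesis s0 : 0 < s.
Implicit Types (P : {set {ffun 'I_d -> 'I_N}}).

Definition gfig P : set V :=
  [set x | exists2 k, k \in P & cbox (gpt o s k) s x].

Lemma big_setUE (I : finType) (Q : pred I) (F : I -> set V) x :
  (\big[setU/set0]_(k | Q k) F k) x <-> exists2 k, Q k & F k x.
Proof.
rewrite -bigcup_seq_cond; split=> [[k /= /andP[_ Qk] xk]|[k Qk xk]]; first by exists k.
by exists k => //=; rewrite mem_index_enum.
Qed.

Lemma leb_big_setU_le (I : Type) (r : seq I) (Q : pred I) (F : I -> set V) :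
  (forall k, measurable (F k : set (rVleb R d))) ->
  (leb (\big[setU/set0]_(k <- r | Q k) F k) <= \sum_(k <- r | Q k) leb (F k))%E.
Proof.
move=> mF; elim: r => [|k r IH]; first by rewrite !big_nil measure0.
rewrite !big_cons; case: ifPn => // _.
have mU : measurable (\big[setU/set0]_(k <- r | Q k) F k : set (rVleb R d)).
  by apply: bigsetU_measurable => j _; exact: mF.
apply: (le_trans (measureU2 _ _ mU)); first exact: mF.
exact: leeD2l.
Qed.

Lemma gfigE P : gfig P = \big[setU/set0]_(k in P) cbox (gpt o s k) s.
Proof.
by apply/seteqP; split=> x; [move=> H; apply/big_setUE|move=> /big_setUE H].
Qed.

Lemma measurable_gfig P : measurable (gfig P : set (rVleb R d)).
Proof.
rewrite gfigE; apply: bigsetU_measurable => k _; exact: measurable_cbox.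
Qed.

Lemma gfig_sub_cbox P : gfig P `<=` cbox o (s * N%:R).
Proof.
move=> x [k _ xk] i; have := xk i; rewrite mxE => /andP[H1 H2].
have kN : (k i)%:R + 1 <= N%:R :> R by rewrite natr1 ler_nat.
have := s0; have : 0 <= s * (k i)%:R by rewrite mulr_ge0// ltW.
have : s * ((k i)%:R + 1) <= s * N%:R by rewrite ler_pM2l.
by move=> *; apply/andP; split; lra.
Qed.

(** The cubes of P whose lower neighbour in direction i is not in P. The neighbour is found through
    grid points and not through indices, so a cube at the edge of the grid needs no separate
    clause. *)
Definition gfig_border P i : {set {ffun 'I_d -> 'I_N}} :=
  [set k in P | ~~ [exists k' in P, gpt o s k' == gpt o s k - s *: unit_rV i]].

(** If x is at distance at least h from the lower face of its cube, then x - h e_i is in the same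
    cube; otherwise it is in the lower neighbour, as h < s. *)
Lemma gfig_shift_sub P i h : 0 < h < s ->
  gfig P `\` (translate (- (h *: unit_rV i)) @^-1` gfig P) `<=`
  \big[setU/set0]_(k in gfig_border P i) cstrip (gpt o s k) s i h.
Proof.
move=> /andP[h0 hs] x [[k kP xk] xh]; apply/big_setUE.
have xi : x ord0 i < gpt o s k ord0 i + h.
  rewrite ltNge; apply/negP => hx; apply: xh; exists k => // j.
  rewrite /translate [X in _ <= X <= _]mxE [X in _ + X]mxE [X in - X]mxE unit_rVE.
  have := xk j; case: eqP => [->|_]; rewrite ?mulr1 ?mulr0 ?subr0// => /andP[? ?].
  by apply/andP; split; lra.
exists k; last by split.
rewrite inE kP /=; apply/existsPn => k'; apply/negP => /andP[k'P /eqP E].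
apply: xh; exists k' => // j; rewrite E.
rewrite /translate !mxE eqxx /=; have := xk j; rewrite !mxE.
case: eqP => [->|_]; rewrite /= ?mulr1 ?mulr0 ?subr0// => /andP[? ?].
by move: xi; rewrite !mxE => xi; apply/andP; split; lra.
Qed.

Lemma leb_cbox_finite (A : set V) a r : measurable (A : set (rVleb R d)) ->
  A `<=` cbox a r -> leb A \is a fin_num.
Proof.
move=> mA Aa; rewrite ge0_fin_numE//.
apply: (@le_lt_trans _ _ (leb (cbox a `|r|))).
  apply: le_measure; rewrite ?inE//; first exact: measurable_cbox.
  move=> x /Aa H i; have := H i => /andP[-> /= Hi].
  by rewrite (le_trans Hi)// lerD2l ler_norm.
by rewrite leb_cbox// ltry.
Qed.

(** Only lower faces are counted; each accounts for a strip of volume h s^(d-1). The factor 2 covers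
    the upper faces, because a figure and its translate have the same measure. *)
Theorem perimeter_gfig P : (perimeter (gfig P) <=
  (2 * s ^+ d.-1 * \sum_i #|gfig_border P i|%:R)%:E)%E.
Proof.
have mP := measurable_gfig P.
rewrite mulr_sumr; apply: (perimeter_le_translation mP (@gfig_sub_cbox P)).
exists s => // i h /[dup] hs /andP[h0 hs'].
set B : set (rVleb R d) := translate (- (h *: unit_rV i)) @^-1` gfig P.
have mB : measurable B.
  have := @measurable_translate R d (- (h *: unit_rV i)) measurableT _ mP.
  by rewrite setTI.
have -> : (fun x => `|\1_(gfig P) (x - h *: unit_rV i) - \1_(gfig P) x|) =
    (fun x => `|\1_B x - \1_(gfig P) x| : R).
  by apply/funext => x; congr (`|_ - _|); rewrite !indicE; congr (nat_of_bool _)%:R.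
have Pfin := leb_cbox_finite mP (@gfig_sub_cbox P).
rewrite (integral_norm_indicB mP mB Pfin); last exact: leb_translate.
rewrite -!mulrA ler_pM2l//.
have mS (k : {ffun 'I_d -> 'I_N}) : measurable (cstrip (gpt o s k) s i h : set (rVleb R d)).
  by apply: measurable_cstrip; exact: ltW.
have H : (leb (gfig P `\` B) <= (s ^+ d.-1 * (#|gfig_border P i|%:R * h))%:E)%E.
  apply: (@le_trans _ _ (leb (\big[setU/set0]_(k in gfig_border P i) cstrip (gpt o s k) s i h))).
    apply: le_measure; rewrite ?inE; [exact: measurableD| |exact: gfig_shift_sub].
    by apply: bigsetU_measurable => k _; exact: mS.
  apply: (le_trans (leb_big_setU_le _ _ mS)).
  rewrite (eq_bigr (fun=> (h * s ^+ d.-1)%:E)); last first.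
    by move=> k _; rewrite leb_cstrip// (ltW h0) (ltW hs').
  rewrite sumEFin sumr_const lee_fin -mulr_natr; lra.
rewrite -lee_fin fineK//; rewrite ge0_fin_numE//; exact: le_lt_trans H (ltry _).
Qed.

End grid_figure.

End figures.

Section null_sets.
Context d (T : measurableType d) (R : realType) (mu : {measure set T -> \bar R}).

Lemma null_setD_eq (A B : set T) : measurable A -> measurable B ->
  A `<=` B -> mu A = mu B -> (mu A < +oo)%E -> mu (B `\` A) = 0%E.
Proof.
move=> mA mB AB E Aoo; have Boo : (mu B < +oo)%E by rewrite -E.
rewrite measureD// (setIidr AB).
transitivity (mu B - mu B)%E; first by congr (_ - _)%E; exact: E.
by rewrite subee// ge0_fin_numE.
Qed.

Lemma Rintegral_null_setD (A B : set T) (u : T -> R) : measurable A -> measurable B ->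
  A `<=` B -> mu (B `\` A) = 0%E -> mu.-integrable B (EFin \o u) ->
  \int[mu]_(x in B) u x = \int[mu]_(x in A) u x.
Proof.
move=> mA mB AB BA iu; have mBA : measurable (B `\` A) by exact: measurableD.
rewrite -[in LHS](setDUK AB) Rintegral_setU//.
- have iBA := integrableS mB mBA (@subDsetl _ B A) iu.
  have Z : \int[mu]_(x in B `\` A) u x = 0 by rewrite /Rintegral (null_set_integral mBA (measurable_int _ iBA) BA).
  by rewrite Z addr0.
- by rewrite setDUK.
- by apply/disj_setPS => x [Ax [_]].
Qed.

End null_sets.

(** * Dyadic cubes, their children, and the values of charges on figures *)

Section dyadic_cubes.
Context {R : realType} {d : nat}.
Local Notation V := 'rV[R]_d.
Implicit Types (x a : V) (i : 'I_d) (n : nat).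

Definition side n : R := (2 ^+ n)^-1.

Lemma side_gt0 n : 0 < side n. Proof. by rewrite invr_gt0 exprn_gt0. Qed.

Lemma sideS n : side n = 2 * side n.+1.
Proof. by rewrite /side exprS invfM mulVKf. Qed.

Lemma side0 : side 0 = 1. Proof. by rewrite /side expr0 invr1. Qed.

Lemma side_natr n : side n * (2 ^ n)%:R = 1.
Proof. by rewrite natrX mulVf// expf_neq0. Qed.

Definition dindex n := {ffun 'I_d -> 'I_(2 ^ n)}.
Definition corner n (k : dindex n) : V := gpt 0 (side n) k.
Definition dcube n (k : dindex n) : set V := cbox (corner k) (side n).
Definition hcube n (k : dindex n) : set V := hbox (corner k) (side n).
Definition dfig n (P : {set dindex n}) : set V := gfig 0 (side n) P.

Lemma cornerE n (k : dindex n) i : corner k ord0 i = side n * (k i)%:R.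
Proof. by rewrite !mxE add0r. Qed.

Lemma leb_dcube n (k : dindex n) : leb (dcube k) = (side n ^+ d)%:E.
Proof. exact/leb_cbox/ltW/side_gt0. Qed.

Lemma leb_hcube n (k : dindex n) : leb (hcube k) = (side n ^+ d)%:E.
Proof. exact/leb_hbox/ltW/side_gt0. Qed.

Lemma measurable_dcube n (k : dindex n) : measurable (dcube k : set (rVleb R d)).
Proof. exact: measurable_cbox. Qed.

Lemma measurable_hcube n (k : dindex n) : measurable (hcube k : set (rVleb R d)).
Proof. exact: measurable_hbox. Qed.

Lemma measurable_dfig n (P : {set dindex n}) : measurable (dfig P : set (rVleb R d)).
Proof. exact/measurable_gfig. Qed.

Lemma hcube_sub n (k : dindex n) : hcube k `<=` dcube k.
Proof. by move=> x H i; have := H i => /andP[-> /ltW->]. Qed.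

Lemma hcube_inj n (k l : dindex n) x : hcube k x -> hcube l x -> k = l.
Proof.
move=> kx lx; apply/ffunP => i; apply/val_inj/eqP => /=.
have := kx i; have := lx i; rewrite !cornerE => /andP[l1 l2] /andP[k1 k2].
have s0 := side_gt0 n.
have H1 : ((k i)%:R < (l i)%:R + 1 :> R) by rewrite -(ltr_pM2l s0); lra.
have H2 : ((l i)%:R < (k i)%:R + 1 :> R) by rewrite -(ltr_pM2l s0); lra.
by move: H1 H2; rewrite !natr1 !ltr_nat !ltnS eqn_leq => -> ->.
Qed.

Lemma leb_dcubeD n (k : dindex n) : leb (dcube k `\` hcube k) = 0%E.
Proof.
apply: null_setD_eq.
- exact: measurable_hcube.
- exact: measurable_dcube.
- exact: hcube_sub.
- by rewrite leb_dcube; exact: leb_hcube.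
- by rewrite leb_hcube ltry.
Qed.

(** The union of the upper faces of the closed cubes. It is a null set, and off it the closed cubes
    are pairwise disjoint. *)
Definition frame n : set V := \big[setU/set0]_(k : dindex n) (dcube k `\` hcube k).

Lemma measurable_frame n : measurable (frame n : set (rVleb R d)).
Proof.
apply: bigsetU_measurable => k _.
by apply: measurableD; [exact: measurable_dcube|exact: measurable_hcube].
Qed.

Lemma leb_frame n : leb (frame n) = 0%E.
Proof.
apply/eqP; rewrite eq_le measure_ge0 andbT.
apply: (le_trans (leb_big_setU_le _ _ _)) => [k|].
  by apply: measurableD; [exact: measurable_dcube|exact: measurable_hcube].
by rewrite big1// => k _; exact: leb_dcubeD.
Qed.

Lemma dcube_inj n (k l : dindex n) x : ~ frame n x -> dcube k x -> dcube l x -> k = l.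
Proof.
move=> Fx kx lx; apply: (@hcube_inj n k l x); apply: contrapT => nx; apply: Fx;
  apply/big_setUE; by [exists k|exists l].
Qed.

Lemma leb_dfigI n (P Q : {set dindex n}) :
  (forall k, k \in P -> k \notin Q) ->
  leb (dfig P `&` dfig Q) = 0%E.
Proof.
move=> PQ; apply/eqP; rewrite eq_le measure_ge0 andbT -(leb_frame n).
apply: le_measure.
- by apply/mem_set; apply: measurableI; exact: measurable_dfig.
- exact/mem_set/measurable_frame.
move=> x [[k kP kx] [l lQ lx]]; apply: contrapT => Fx.
have E := dcube_inj Fx kx lx; have := PQ k kP.
by rewrite E lQ.
Qed.

Lemma par_subproof n (k : dindex n.+1) i : ((k i)./2 < 2 ^ n)%N.
Proof.
case: (k i) => m /= mn; move: mn; rewrite expnS mul2n => H.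
by rewrite -ltn_double (leq_ltn_trans _ H)// -{2}(odd_double_half m) leq_addl.
Qed.

Definition par n (k : dindex n.+1) : dindex n :=
  [ffun i => Ordinal (par_subproof k i)].

Lemma parE n (k : dindex n.+1) i : par k i = (k i)./2 :> nat.
Proof. by rewrite ffunE. Qed.

Lemma half_natr (m : nat) : m%:R = 2 * (m./2)%:R + (odd m)%:R :> R.
Proof. by rewrite -natrM -natrD mul2n addnC odd_double_half. Qed.

Lemma dcube_par n (k : dindex n.+1) : dcube k `<=` dcube (par k).
Proof.
move=> x kx i; have := kx i; rewrite !cornerE parE (sideS n) (half_natr (k i)).
have s0 := side_gt0 n.+1; case: (odd _) => /= /andP[? ?]; apply/andP; split; lra.
Qed.

Lemma hcube_par n (k : dindex n.+1) : hcube k `<=` hcube (par k).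
Proof.
move=> x kx i; have := kx i; rewrite !cornerE parE (sideS n) (half_natr (k i)).
have s0 := side_gt0 n.+1; case: (odd _) => /= /andP[? ?]; apply/andP; split; lra.
Qed.

Lemma exists_child n (k : dindex n) x :
  (dcube k x -> exists2 k', par k' = k & dcube k' x) /\
  (hcube k x -> exists2 k', par k' = k & hcube k' x).
Proof.
(* The midpoint of the i-th side of the parent. A point on it is sent to the upper half, which is
   correct for closed and for half-open cubes alike. *)
pose b i := (side n.+1 * (2 * (k i)%:R + 1) <= x ord0 i)%R.
have bP i : ((k i).*2 + b i < 2 ^ n.+1)%N.
  rewrite expnS mul2n -addnn; have := ltn_ord (k i); rewrite -addnn.
  by case: (b i) => /=; lia.
pose k' : dindex n.+1 := [ffun i => Ordinal (bP i)].
have kE : par k' = k.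
  apply/ffunP => i; apply/val_inj => /=.
  by rewrite parE ffunE /= addnC half_bit_double.
have s0 := side_gt0 n.+1.
have E i : ((k i).*2 + b i)%:R = 2 * (k i)%:R +
    (if side n.+1 * (2 * (k i)%:R + 1) <= x ord0 i then 1 else 0) :> R.
  by rewrite natrD -mul2n natrM /b; case: ifP.
split=> kx; exists k' => // i; have := kx i; rewrite !cornerE ffunE /= (sideS n) E.
  by case: (leP (side n.+1 * (2 * (k i)%:R + 1)) (x ord0 i)) => ? /andP[? ?]; apply/andP; split; lra.
by case: (leP (side n.+1 * (2 * (k i)%:R + 1)) (x ord0 i)) => ? /andP[? ?]; apply/andP; split; lra.
Qed.

Lemma cube01E : cube01 R d = cbox 0 1.
Proof. by apply/seteqP; split=> x H i; have := H i; rewrite mxE add0r. Qed.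

Lemma index0_lt1 (i : 'I_d) : (0 < 2 ^ 0)%N. Proof. by []. Qed.

Definition dindex0 : dindex 0 := [ffun i => Ordinal (index0_lt1 i)].

Lemma corner0 : corner dindex0 = 0.
Proof. by apply/rowP => i; rewrite cornerE ffunE mulr0 mxE. Qed.

Lemma dcube_cover n x : cube01 R d x -> exists k : dindex n, dcube k x.
Proof.
rewrite cube01E => x01; elim: n => [|n [k kx]].
  by exists dindex0; rewrite /dcube corner0 side0.
by have [/(_ kx)[k' _ ?] _] := exists_child k x; exists k'.
Qed.

Lemma hcube_cover n x : hbox 0 1 x -> exists k : dindex n, hcube k x.
Proof.
move=> x01; elim: n => [|n [k kx]].
  by exists dindex0; rewrite /hcube corner0 side0.
by have [_ /(_ kx)[k' _ ?]] := exists_child k x; exists k'.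
Qed.

Lemma dcube_sub_cube01 n (k : dindex n) : dcube k `<=` cube01 R d.
Proof.
move=> x kx; rewrite cube01E -(side_natr n).
by apply: (@gfig_sub_cbox R d (2 ^ n) 0 (side n) (side_gt0 n) [set k]); exists k; rewrite ?inE.
Qed.

Lemma hcube_sub_hbox n (k : dindex n) : hcube k `<=` hbox 0 1.
Proof.
move=> x kx i; have := kx i; rewrite cornerE mxE add0r => /andP[k1 k2].
have s0 := side_gt0 n.
have kN : (k i)%:R + 1 <= (2 ^ n)%:R :> R by rewrite natr1 ler_nat.
have : 0 <= side n * (k i)%:R by rewrite mulr_ge0// ltW.
have : side n * ((k i)%:R + 1) <= side n * (2 ^ n)%:R by rewrite ler_pM2l.
by rewrite side_natr => *; apply/andP; split; lra.
Qed.

Lemma dfig_sub_cube01 n (P : {set dindex n}) : dfig P `<=` cube01 R d.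
Proof. by move=> x [k _ /dcube_sub_cube01]. Qed.

Lemma dfig_child n (P : {set dindex n}) :
  dfig P = dfig [set k' | par k' \in P].
Proof.
apply/seteqP; split=> x [k kP kx].
  by have [/(_ kx)[k' kk' ?] _] := exists_child k x; exists k' => //; rewrite inE kk'.
by exists (par k); [move: kP; rewrite inE|exact: dcube_par].
Qed.

Lemma dfig_refine n m (P : {set dindex n}) : (n <= m)%N ->
  exists Q : {set dindex m}, dfig Q = dfig P.
Proof.
move=> /subnK <-; elim: (m - n)%N => [|l [Q QP]]; first by exists P.
by exists [set k' : dindex (l + n).+1 | par k' \in Q]%SET; rewrite -(dfig_child Q).
Qed.

Lemma bounded_cube01 : bounded_set (cube01 R d).
Proof. by rewrite cube01E; apply: compact_bounded; exact: compact_cbox. Qed.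

Lemma BVcube_dfig n (P : {set dindex n}) : BVcube R d (dfig P).
Proof.
split; last exact: dfig_sub_cube01.
split; first exact: measurable_dfig.
- have [M [Mreal HM]] := bounded_cube01; exists M; split => // y My x /dfig_sub_cube01.
  exact: HM.
- exact: (le_lt_trans (perimeter_gfig 0 (side_gt0 n) P) (ltry _)).
Qed.

Definition bvfig n (P : {set dindex n}) : BVcube R d :=
  exist _ (dfig P) (mem_set (BVcube_dfig P)).

Definition bvcube n (k : dindex n) : BVcube R d := bvfig [set k].

Lemma bvcubeE n (k : dindex n) : \val (bvcube k) = dcube k.
Proof.
rewrite -[LHS]/(dfig [set k]%SET).
apply/seteqP; split; first by move=> x [l lk lx]; move: lk; rewrite inE => /eqP<-.
by move=> x kx; exists k => //; rewrite inE.
Qed.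

Let dyadicE n m : m%:R / 2 ^+ n = side n * m%:R /\
  m.+1%:R / 2 ^+ n = side n * m%:R + side n.
Proof. by rewrite -/(side n) -natr1 mulrC (mulrC _ (side n)) mulrDr mulr1. Qed.

Lemma dyadic_dcube n (k : dindex n) : dyadic_cube (dcube k).
Proof.
exists n, (fun i => k i : nat); split=> [i|]; first exact: ltn_ord.
by apply/seteqP; split=> x H i; have := H i; have [-> ->] := dyadicE n (k i);
  rewrite cornerE.
Qed.

Lemma dyadic_cubeP (K : set V) : dyadic_cube K ->
  exists n (k : dindex n), K = dcube k.
Proof.
move=> [n [k [kn ->]]]; exists n, [ffun i => Ordinal (kn i)].
by apply/seteqP; split=> x H i; have := H i; have [-> ->] := dyadicE n (k i);
  rewrite cornerE ffunE.
Qed.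

Section integrals.
Variable u : V -> R.
Hypothesis iu : leb.-integrable (cube01 R d : set (rVleb R d)) (EFin \o u).

Let iuS (A : set V) : measurable (A : set (rVleb R d)) -> A `<=` cube01 R d ->
  leb.-integrable (A : set (rVleb R d)) (EFin \o u).
Proof.
by move=> mA A01; apply: (integrableS _ mA A01 iu); rewrite cube01E; exact: measurable_cbox.
Qed.

Lemma hbox01_sub : hbox 0 1 `<=` cube01 R d.
Proof. by move=> x H i; have := H i; rewrite mxE add0r => /andP[-> /ltW]. Qed.

Lemma Rintegral_dcube n (k : dindex n) :
  \int[leb]_(x in dcube k) u x = \int[leb]_(x in hcube k) u x.
Proof.
apply: Rintegral_null_setD.
- exact: measurable_hcube.
- exact: measurable_dcube.
- exact: hcube_sub.
- exact: leb_dcubeD.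
- by apply: iuS; [exact: measurable_dcube|exact: dcube_sub_cube01].
Qed.

Lemma Rintegral_hcube_children n (k : dindex n) :
  \int[leb]_(x in hcube k) u x =
  \sum_(k' | par k' == k) \int[leb]_(x in hcube k') u x.
Proof.
apply: Rintegral_partition.
- exact: measurable_hcube.
- by move=> l _; exact: measurable_hcube.
- by move=> x kx; have [_ /(_ kx)[k' /eqP ? ?]] := exists_child k x; exists k'.
- by move=> l m x _ _; exact: hcube_inj.
- by move=> l /eqP <-; exact: hcube_par.
- apply: iuS; [exact: measurable_hcube|].
  by move=> x /hcube_sub_hbox/hbox01_sub.
Qed.

Lemma Rintegral_cube01 n :
  \int[leb]_(x in cube01 R d) u x = \sum_(k : dindex n) \int[leb]_(x in hcube k) u x.
Proof.
transitivity (\int[leb]_(x in hbox (0 : V) 1) u x).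
  have := @Rintegral_dcube 0 dindex0; rewrite /dcube /hcube corner0 side0.
  by rewrite cube01E.
apply: (@Rintegral_partition _ (rVleb R d) R leb (dindex n) xpredT
  (fun k => hcube k) (hbox (0 : V) 1) u).
- exact: measurable_hbox.
- by move=> l _; exact: measurable_hcube.
- by move=> x /(@hcube_cover n)[k ?]; exists k.
- by move=> l m x _ _; exact: hcube_inj.
- by move=> l _; exact: hcube_sub_hbox.
- by apply: iuS; [exact: measurable_hbox|exact: hbox01_sub].
Qed.

End integrals.

Section charges.
Variable w : BVcube R d -> R.
Hypothesis cw : charge01 w.

Lemma charge_bvfig0 n : w (bvfig (finset.set0 : {set dindex n})) = 0.
Proof.
have [wD _] := cw; set B := bvfig _.
have B0 : \val B = classical_sets.set0 by apply/seteqP; split=> x // [k]; rewrite inE.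
(* The empty set is a null intersection with itself, so w(B) = w(B) + w(B). *)
have := wD B B B; rewrite setUid setIid B0 measure0 => /(_ erefl erefl).
by move=> H; lra.
Qed.

Lemma charge_bvfigU n (P Q : {set dindex n}) :
  (forall k, k \in P -> k \notin Q) ->
  w (bvfig (P :|: Q)) = w (bvfig P) + w (bvfig Q).
Proof.
move=> PQ; have [wD _] := cw; apply: wD; last exact: leb_dfigI.
apply/seteqP; split=> x /= => [[k]|[] [k kP kx]]; last 2 first.
- by exists k; rewrite // inE kP.
- by exists k; rewrite // inE kP orbT.
by rewrite inE => /orP[kP|kQ] kx; [left|right]; exists k.
Qed.

Lemma charge_bvfig n (P : {set dindex n}) :
  w (bvfig P) = \sum_(k in P) w (bvcube k).
Proof.
elim: {P}#|P| {-2}P (leqnn #|P|) => [|m IH] P Pm.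
  move: Pm; rewrite leqn0 cards_eq0 => /eqP ->.
  by rewrite big_set0 charge_bvfig0.
have [->|[k kP]] := set_0Vmem P; first by rewrite big_set0 charge_bvfig0.
rewrite (big_setD1 k)//= -IH; last by rewrite -ltnS (leq_trans _ Pm)// [leqRHS](cardsD1 k) kP.
rewrite -charge_bvfigU ?finset.setD1K// => l.
by rewrite !inE => /eqP->; rewrite eqxx.
Qed.

Lemma charge_children n (k : dindex n) :
  w (bvcube k) = \sum_(k' | par k' == k) w (bvcube k').
Proof.
transitivity (w (bvfig [set k' | par k' \in [set k]%SET])).
  by congr w; apply/val_inj; exact: (dfig_child [set k]).
by rewrite charge_bvfig; apply: eq_bigl => k'; rewrite !inE.
Qed.

End charges.

End dyadic_cubes.

(** * Approximation in measure by dyadic figures *)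

Lemma measure_bigcupD_lt d (T : measurableType d) (R : realType)
    (mu : {measure set T -> \bar R}) (F : nat -> set T) (e : R) :
  (forall n, measurable (F n)) -> nondecreasing_seq F ->
  (mu (\bigcup_n F n) < +oo)%E -> 0 < e ->
  exists n, (mu (\bigcup_n F n `\` F n) < e%:E)%E.
Proof.
move=> mF ndF Foo e0; set U := \bigcup_n F n.
have mU : measurable U by exact: bigcupT_measurable.
have C : (mu \o (fun n => U `\` F n)) @ \oo --> mu (\bigcap_n (U `\` F n)).
  apply: nonincreasing_cvg_mu.
  - apply: le_lt_trans Foo; apply: le_measure; rewrite ?inE//.
    exact: measurableD.
  - by move=> n; exact: measurableD.
  - by apply: bigcapT_measurable => n; exact: measurableD.
  - by move=> n m nm; apply/subsetPset; apply: setDS; apply/subsetPset/ndF.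
have E0 : \bigcap_n (U `\` F n) = set0.
  apply/seteqP; split=> x // H; have [[n _ Fnx] _] := H 0%N I.
  by have [_] := H n I.
rewrite E0 measure0 in C.
have : \forall n \near \oo, (mu (U `\` F n) < e%:E)%E.
  by apply: (C [set y | (y < e%:E)%E]); apply: open_nbhs_nbhs; split;
    [exact: open_ereal_lt_ereal|rewrite /= lte_fin].
by move=> [N _ /(_ N (leqnn N))]; exists N.
Qed.

Section approximation_by_figures.
Context {R : realType} {d : nat}.
Local Notation V := 'rV[R]_d.
Implicit Types (A B C : set V).

Lemma le_leb A B : A `<=` B -> (leb A <= leb B)%E.
Proof. exact: (@le_outer_measure R _ (lebesgue_borel d)^*%mu A B). Qed.

Lemma leb_setU_le A B : (leb (A `|` B) <= leb A + leb B)%E.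
Proof. exact: (outer_measureU2 (lebesgue_borel d)^*%mu A B). Qed.

Lemma leb_setY_triangle A B C : (leb (A `+` C) <= leb (A `+` B) + leb (B `+` C))%E.
Proof.
apply: le_trans (leb_setU_le _ _); apply: le_leb => x /=.
by case: (EM (B x)); tauto.
Qed.

Definition figure_approx A := forall e : R, 0 < e ->
  exists n (P : {set dindex n}), (leb (A `+` dfig P) < e%:E)%E.

Lemma figure_approx_near A : (forall e : R, 0 < e ->
    exists2 B, figure_approx B & (leb (A `+` B) < e%:E)%E) -> figure_approx A.
Proof.
move=> H e e0; have e20 : 0 < e / 2 by rewrite divr_gt0.
have [B aB AB] := H _ e20; have [n [P BP]] := aB _ e20.
exists n, P; apply: (le_lt_trans (leb_setY_triangle _ B _)).
by rewrite [e]splitr EFinD lteD.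
Qed.

Lemma figure_approx0 : figure_approx set0.
Proof.
move=> e e0; exists 0%N, finset.set0; rewrite (_ : _ `+` _ = set0) ?measure0 ?lte_fin//.
by apply/seteqP; split=> x //= [[]//|[[k]]]; rewrite inE.
Qed.

Lemma figure_approxU A B : figure_approx A -> figure_approx B ->
  figure_approx (A `|` B).
Proof.
move=> aA aB e e0; have e20 : 0 < e / 2 by rewrite divr_gt0.
have [n [P AP]] := aA _ e20; have [m [Q BQ]] := aB _ e20.
have [P' EP] := @dfig_refine R d _ _ P (leq_maxl n m).
have [Q' EQ] := @dfig_refine R d _ _ Q (leq_maxr n m).
exists (maxn n m), (P' :|: Q'); rewrite [e]splitr EFinD.
apply: (le_lt_trans _ (lteD AP BQ)); apply: le_trans (leb_setU_le _ _).
have E : dfig (P' :|: Q') = dfig P `|` dfig Q :> set V.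
  rewrite -EP -EQ; apply/seteqP; split=> x /= => [[k]|[] [k kP kx]].
  - by rewrite inE => /orP[kP|kQ] kx; [left|right]; exists k.
  - by exists k; rewrite // inE kP.
  - by exists k; rewrite // inE kP orbT.
by rewrite E; apply: le_leb => x /=; tauto.
Qed.

(** In the unit cube and off the null set [frame n], the complement of a figure is the figure of the
    complementary index set. *)
Lemma figure_approxC A : figure_approx (A `&` cube01 R d) ->
  figure_approx (~` A `&` cube01 R d).
Proof.
move=> aA e e0; have [n [P AP]] := aA _ e0; exists n, (~: P).
apply: le_lt_trans AP; rewrite -[leRHS]adde0 -(@leb_frame R d n).
apply: le_trans (leb_setU_le _ _); apply: le_leb => x /=.
case: (EM (frame n x)) => [|nF]; first by right.
move=> H; left.
have c01 : cube01 R d x by case: H => [[[_]]//|[]]; move/dfig_sub_cube01.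
have [k kx] := dcube_cover n c01.
have D1 : dfig P x <-> k \in P.
  by split=> [[l lP lx]|kP]; [rewrite (dcube_inj nF kx lx)|exists k].
have D2 : dfig (~: P) x <-> k \notin P.
  split=> [[l]|kP]; last by exists k; rewrite // inE.
  by rewrite inE => lP lx; rewrite (dcube_inj nF kx lx).
have D3 : dfig (~: P) x <-> ~ dfig P x.
  split=> [/D2/negP nk /D1//|nP].
  by apply/D2/negP => /D1.
by move: H; case: (EM (A x)); case: (EM (dfig P x)); tauto.
Qed.

(** Figures stay inside the unit cube, so only the trace of A on it is approximated. Measurability
    is part of the class because the argument for countable unions uses continuity of the
    measure. *)
Definition approximable A := measurable (A : set (rVleb R d)) /\
  figure_approx (A `&` cube01 R d).

Lemma measurable_cube01 : measurable (cube01 R d : set (rVleb R d)).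
Proof. by rewrite cube01E; exact: measurable_cbox. Qed.

Lemma leb_cube01 : leb (cube01 R d) = 1%E.
Proof. by rewrite cube01E leb_cbox// expr1n. Qed.

(** For a countable union, finite unions exhaust the trace up to a set of small measure, because the
    unit cube has finite measure. *)
Lemma sigma_algebra_approximable : sigma_algebra setT approximable.
Proof.
split.
- by split=> //; rewrite set0I; exact: figure_approx0.
- move=> A [mA aA]; rewrite setTD; split; first exact: measurableC.
  exact: figure_approxC.
- move=> A aA; split; first by apply: bigcupT_measurable => n; case: (aA n).
  pose F n := \big[setU/set0]_(k < n) (A k `&` cube01 R d).
  have mF n : measurable (F n : set (rVleb R d)).
    apply: bigsetU_measurable => k _; apply: measurableI; first by case: (aA k).
    exact: measurable_cube01.
  have fF n : figure_approx (F n).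
    elim: n => [|n IH]; first by rewrite /F big_ord0; exact: figure_approx0.
    by rewrite /F big_ord_recr /=; apply: figure_approxU => //; case: (aA n).
  have UF : \bigcup_n A n `&` cube01 R d = \bigcup_n F n.
    apply/seteqP; split=> x.
      move=> [[n _ Anx] x01]; exists n.+1 => //.
      by rewrite /F big_ord_recr /=; right.
    move=> [n _] /big_setUE[k _ [Akx x01]].
    by split=> //; exists k.
  apply: figure_approx_near => e e0; rewrite UF.
  have [|||n nF] := @measure_bigcupD_lt _ (rVleb R d) R leb F e mF.
  - apply/nondecreasing_seqP => n; apply/subsetPset.
    by rewrite /F big_ord_recr /=; exact: subsetUl.
  - rewrite -UF; apply: (@le_lt_trans _ _ (leb (cube01 R d))).
      by apply: le_leb => x [].
    by rewrite leb_cube01 ltry.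
  - exact: e0.
  exists (F n) => //; apply: le_lt_trans nF; apply: le_leb => x /= [//|].
  by move=> [Fnx nU]; exfalso; apply: nU; exists n.
Qed.

(** The cubes whose lower corner lies beyond a fill the half-space up to a slab of thickness
    [side n]. *)
Lemma approximable_ray (i : 'I_d) (a : R) : approximable [set x : V | a < x ord0 i].
Proof.
split.
  rewrite (_ : [set _ | _] = (fun x : rVleb R d => x ord0 i) @^-1` `]a, +oo[%classic).
    by rewrite -[X in measurable X]setTI; apply: measurable_coord => //; exact: measurable_itv.
  by apply/seteqP; split=> x /=; rewrite in_itv/= andbT.
move=> e e0.
have [n ne] : exists n, side n < e.
  have [n _ /(_ n (leqnn n))] : \forall n \near \oo, (2^-1 : R) ^+ n < e.
    have : (2^-1 : R) ^+ n @[n --> \oo] --> (0 : R).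
      by apply: cvg_expr; rewrite ger0_norm// invf_lt1// ltr1n.
    move/cvgrPdist_lt => /(_ _ e0); apply: filterS => m.
    by rewrite sub0r normrN ger0_norm// exprn_ge0.
  by rewrite /= exprVn; exists n.
exists n, [set k | a < corner k ord0 i]%SET.
pose B (j : 'I_d) : set (measurableTypeR R) :=
  if j == i then `]a, a + side n]%classic else `[0, 0 + 1]%classic.
have s0 : 0 < side n :> R := side_gt0 n.
apply: (@le_lt_trans _ _ (leb (box B))).
  apply: le_leb => x /= H.
  have c01 : cube01 R d x by case: H => [[[_]]//|[]]; move/dfig_sub_cube01.
  move=> j; rewrite /B; case: eqP => [->|_]; last first.
    by rewrite /= in_itv/= add0r; exact: c01.
  rewrite /= in_itv/=; case: H => [[[ax _] nP]|[[k]]].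
    rewrite ax /=; have [k kx] := dcube_cover n c01.
    have : ~~ (a < corner k ord0 i).
      by apply/negP => ak; apply: nP; exists k; rewrite // inE.
    by have := kx i => /andP[_ ?]; rewrite -leNgt; lra.
  rewrite inE => ak kx nH; exfalso; apply: nH; split=> //.
  by have /andP[kx1 _] := kx i; exact: lt_le_trans kx1.
rewrite (@leb_box _ _ _ (fun j => if j == i then side n else 1)).
- by rewrite (bigD1 i)//= eqxx big1 ?mulr1 ?lte_fin// => j /negbTE->.
- by move=> j; rewrite /B; case: eqP => _; exact: measurable_itv.
- move=> j; rewrite /B; case: eqP => _; last exact: itv_length.
  by apply: itv_length; exact: ltW.
Qed.

Lemma sigma_algebra_preimage_in (T : Type) (f : V -> T) :
  sigma_algebra setT [set A : set T | approximable (f @^-1` A)].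
Proof.
have [S0 SC SU] := sigma_algebra_approximable; split => /=.
- by rewrite preimage_set0.
- by move=> A /SC; rewrite !setTD preimage_setC.
- by move=> A aA; rewrite preimage_bigcup; exact: SU.
Qed.

(** Two generations of sigma-algebras are unfolded: that of R^d is generated by the coordinates, and
    that of the line by open rays, so half-spaces suffice. *)
Lemma approximable_borel (A : set (@rVborel R d)) : measurable A -> approximable A.
Proof.
move=> [B mB <-]; rewrite setTI.
suff : (<<s \big[setU/set0]_(i < d) preimage_set_system setT
    (fun t : d.-tuple (measurableTypeR R) => tnth t i) measurable >>) `<=`
    [set B | approximable (@tuple_of_rV R d @^-1` B)] by exact.
apply: smallest_sub; first exact: sigma_algebra_preimage_in.
move=> C; rewrite -bigcup_seq => -[i _ [D mD <-]]; rewrite /= setTI.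
have -> : @tuple_of_rV R d @^-1` ((fun t => tnth t i) @^-1` D) =
    (fun x : V => x ord0 i) @^-1` D.
  by apply/seteqP; split => x /=; rewrite tnth_mktuple.
move: mD; rewrite RGenOInfty.measurableE => mD.
suff : (<<s @RGenOInfty.G R >>) `<=` [set D | approximable ((fun x : V => x ord0 i) @^-1` D)].
  exact.
apply: smallest_sub; first exact: sigma_algebra_preimage_in.
move=> _ [a ->] /=; rewrite (_ : _ @^-1` _ = [set x : V | a < x ord0 i]).
  exact: approximable_ray.
by apply/seteqP; split=> x /=; rewrite in_itv/= andbT.
Qed.

(** The outer measure of A is nearly attained by a Borel cover G, whose trace on the unit cube is
    approximable. *)
Theorem figure_approx_measurable A : measurable (A : set (rVleb R d)) ->
  A `<=` cube01 R d -> figure_approx A.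
Proof.
move=> mA A01; apply: figure_approx_near => e e0.
have Afin : leb A \is a fin_num.
  rewrite ge0_fin_numE//; apply: (@le_lt_trans _ _ (leb (cube01 R d))).
    exact: le_leb.
  by rewrite leb_cube01 ltry.
have [_ [F [mF AF] <-] Fe] := lb_ereal_inf_adherent e0 Afin.
set G := \bigcup_k F k.
have mG : measurable (G : set (@rVborel R d)) by exact: bigcupT_measurable.
have mG' : measurable (G : set (rVleb R d)) by exact: measurable_borel_leb.
have [_ aG] := approximable_borel mG.
exists (G `&` cube01 R d) => //.
have GF : (leb G <= \sum_(k <oo) lebesgue_borel d (F k))%E.
  rewrite leb_borelE//; apply: measure_sigma_subadditive => //.
apply: (@le_lt_trans _ _ (leb (G `\` A))).
  by apply: le_leb => x /= [[Ax nG]|[[Gx _] nA]//]; exfalso; apply: nG; split; [exact: AF|exact: A01].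
have Ge : (leb G < leb A + e%:E)%E by exact: le_lt_trans GF Fe.
have E : leb G = (leb A + leb (G `\` A))%E.
  have AG : A `&` (G `\` A) = set0 by apply/seteqP; split=> x // [Ax [_ /(_ Ax)]].
  rewrite -{1}(@setDUK _ A G AF); apply: measureU => //; exact: measurableD.
by move: Ge; rewrite E lteD2lE.
Qed.

End approximation_by_figures.

(** * Approximation of BV sets by figures of controlled perimeter *)

Lemma Rintegral_indic_le dT (T : measurableType dT) (R : realType)
    (mu : {measure set T -> \bar R}) (D A : set T) (r : R) :
  measurable D -> measurable A -> (mu A <= r%:E)%E -> \int[mu]_(x in D) \1_A x <= r.
Proof.
move=> mD mA Ar; rewrite /Rintegral integral_indic//.
have ADr : (mu (A `&` D) <= r%:E)%E.
  by apply: le_trans Ar; apply: le_measure; rewrite ?inE//; exact: measurableI.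
rewrite -lee_fin fineK// ge0_fin_numE//; exact: le_lt_trans ADr (ltry _).
Qed.

(* The integral of the left-hand side over t in [1/4, 3/4] is at most the sum of
   the |b k - a k|, and this interval has length 1/2. *)
Lemma exists_threshold (R : realType) (I : finType) (a b : I -> R) (eta : R) : 0 < eta ->
  exists2 t : R, 1 / 4 <= t <= 3 / 4 &
    \sum_k ((a k < t <= b k)%R%:R : R) <= 2 * \sum_k `|b k - a k| + eta.
Proof.
move=> eta0; apply: contrapT => /forall2NP H.
pose mu : {measure set (measurableTypeR R) -> \bar R} := @lebesgue_measure R.
pose D : set R := `[1 / 4, 1 / 4 + 1 / 2]%classic.
have mD : measurable D by exact: measurable_itv.
have muD : mu D = (1 / 2)%:E by apply: itv_length.
have Doo : (mu D < +oo)%E by rewrite muD ltry.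
pose J k : set R := `]a k, b k]%classic.
have mJ k : measurable (J k) by exact: measurable_itv.
have muJ k : (mu (J k) <= `|b k - a k|%:E)%E.
  have := @lebesgue_measure_itv R `]a k, b k]; rewrite /= lte_fin => E.
  rewrite [X in (X <= _)%E]E; case: ifPn => ab; last by rewrite lee_fin.
  by rewrite -EFinD lee_fin ler_norm.
have iJ k : mu.-integrable D (EFin \o (\1_(J k) : R -> R)).
  apply: (@integrable_bounded _ _ _ _ _ _ 1) => //.
  - by apply: measurable_funTS; apply: measurable_indic; exact: mJ.
  - by move=> x _; rewrite indicE; case: (_ \in _); rewrite ?normr1 ?normr0.
(* Over an interval of length 1/2, this constant integrates to the sum of the |b k - a k| plus eta /
   2. Integration keeps only the weak inequality, and eta makes the contradiction strict. *)
pose c := 2 * \sum_k `|b k - a k| + eta.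
have : \int[mu]_(t in D) c <= \int[mu]_(t in D) (\sum_k \1_(J k) t).
  apply: le_Rintegral => //.
  - exact: (@integrable_bounded _ _ _ _ _ _ `|c|).
  - exact: integrable_Rsum.
  - move=> t; rewrite /D /= in_itv/= => tD.
    case: (H t) => [|/negP]; first by case; move: tD; lra.
    rewrite -ltNge => /ltW/le_trans; apply; apply: ler_sum => k _.
    by rewrite indicE /J mem_setE in_itv.
rewrite Rintegral_cst// muD Rintegral_sum//.
have : \sum_k \int[mu]_(t in D) \1_(J k) t <= \sum_k `|b k - a k|.
  apply: ler_sum => k _.
  exact: (@Rintegral_indic_le _ _ _ mu D (J k) _ mD (mJ k) (muJ k)).
by rewrite /c /=; lra.
Qed.

Section bv_approximation.
Context {R : realType} {d : nat}.
Local Notation V := 'rV[R]_d.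
Variables (B : set V) (n : nat).
Hypothesis mB : measurable (B : set (rVleb R d)).
Hypothesis B01 : B `<=` cube01 R d.

Let s : R := side n.
Let s0 : 0 < s. Proof. exact: side_gt0. Qed.
Let sd0 : 0 < s ^+ d. Proof. by rewrite exprn_gt0. Qed.

Let avg (p : V) : R := (s ^+ d)^-1 * \int[leb]_(x in hbox p s) \1_B x.

Definition threshold_set (t : R) : {set dindex n} := [set k | t <= avg (corner k)]%SET.

Let indic_integrable (A D : set V) : measurable (A : set (rVleb R d)) ->
  measurable (D : set (rVleb R d)) -> (leb D < +oo)%E ->
  leb.-integrable (D : set (rVleb R d)) (EFin \o (\1_A : V -> R)).
Proof.
move=> mA mD Doo; apply: (@integrable_bounded _ _ _ _ _ _ 1).
- exact: mD.
- exact: Doo.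
- exact/measurable_funTS/measurable_indic.
- by move=> x _; rewrite indicE; case: (_ \in _); rewrite ?normr1 ?normr0.
Qed.

Let cube01_fin : (leb (cube01 R d) < +oo)%E.
Proof. by rewrite leb_cube01 ltry. Qed.

Let indicB_integrable : leb.-integrable setT (EFin \o (\1_B : V -> R)).
Proof.
apply/integrableP; split; first exact/measurable_EFinP/measurable_indic.
rewrite (eq_integral (fun x : rVleb R d => (\1_B x)%:E)); last first.
  by move=> x _; rewrite /= ger0_norm.
rewrite integral_indic// setIT; apply: le_lt_trans cube01_fin.
exact: le_leb.
Qed.

(** The lower neighbour of a border cube either belongs to the grid and failed the threshold, or
    lies outside the unit cube, where B has no mass and the average is 0 < t. *)
Lemma border_threshold (t : R) i (k : dindex n) : 0 < t ->
  k \in gfig_border 0 s (threshold_set t) i ->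
  avg (corner k - s *: unit_rV i) < t <= avg (corner k).
Proof.
move=> t0; rewrite inE => /andP[]; rewrite inE => -> /=; rewrite andbT => /existsPn nk.
case: (posnP (k i)) => [k0|k0].
  rewrite /avg (_ : \int[leb]_(x in _) _ = 0) ?mulr0//.
  have := @Rintegral_cst _ _ _ leb (hbox (corner k - s *: unit_rV i) s)
    (measurable_hbox _ _) 0.
  rewrite mul0r => <-; apply: eq_Rintegral => x /set_mem/(_ i).
  rewrite mxE [X in _ + X]mxE [X in - X]mxE unit_rVE eqxx mulr1 cornerE k0 mulr0 add0r.
  rewrite addNr => /andP[_ xi]; rewrite indicE memNset// => /B01/(_ i) /andP[+ _].
  by rewrite leNgt xi.
have k'P (j : 'I_d) : ((if j == i then (k i).-1 else k j) < 2 ^ n)%N.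
  by case: ifP => _; rewrite // (leq_ltn_trans (leq_pred _)).
pose k' : dindex n := [ffun j => Ordinal (k'P j)].
have k'E : corner k' = corner k - s *: unit_rV i.
  apply/rowP => j; rewrite [RHS]mxE [X in _ = _ + X]mxE [X in _ = _ - X]mxE unit_rVE !cornerE ffunE /=.
  case: eqP => [->|_]; last by rewrite mulr0 subr0.
  by rewrite mulr1 -{2}(prednK k0) -natr1 mulrDr mulr1 addrK.
have := nk k'; rewrite negb_and -k'E /corner eqxx orbF inE -ltNge.
exact.
Qed.

(** A cube is on the border only if t separates its average from that of its lower neighbour, so a
    good t makes the border at most twice the total oscillation of the averages, plus eta. This
    oscillation is at most d s^(1-d) times the perimeter of B. With the factor 2 s^(d-1) of
    [perimeter_gfig] this gives 4 d, and eta = s^(1-d) gives the summand 2. *)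
Theorem perimeter_threshold : (perimeter B < +oo)%E ->
  exists2 t : R, 1 / 4 <= t <= 3 / 4 &
    (perimeter (dfig (threshold_set t)) <= (4 * d%:R * fine (perimeter B) + 2)%:E)%E.
Proof.
move=> PB; have eta0 : 0 < (s ^+ d.-1)^-1 by rewrite invr_gt0 exprn_gt0.
have [t t14 tle] := @exists_threshold R ('I_d * dindex n)%type
  (fun p => avg (corner p.2 - s *: unit_rV p.1)) (fun p => avg (corner p.2)) _ eta0.
exists t => //; apply: (le_trans (perimeter_gfig 0 s0 (threshold_set t))).
rewrite lee_fin.
have H1 : \sum_i #|gfig_border 0 s (threshold_set t) i|%:R <=
    \sum_(p : 'I_d * dindex n)
      ((avg (corner p.2 - s *: unit_rV p.1) < t <= avg (corner p.2))%R%:R : R).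
  rewrite -(pair_bigA _ (fun i k =>
    ((avg (corner k - s *: unit_rV i) < t <= avg (corner k))%R%:R : R))).
  apply: ler_sum => i _; rewrite -sum1_card natr_sum big_mkcond /=.
  apply: ler_sum => k _; case: ifPn => // /border_threshold ->//.
  by move: t14 => /andP[? _]; lra.
have dist (x y : R) : `|(s ^+ d)^-1 * x - (s ^+ d)^-1 * y| = (s ^+ d)^-1 * `|x - y|.
  by rewrite -mulrBr normrM ger0_norm// invr_ge0 ltW.
have H2 : \sum_(p : 'I_d * dindex n)
    `|avg (corner p.2) - avg (corner p.2 - s *: unit_rV p.1)| <=
    d%:R * ((s ^+ d)^-1 * (s * fine (perimeter B))).
  rewrite -(pair_bigA _ (fun i k =>
    `|avg (corner k) - avg (corner k - s *: unit_rV i)|)).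
  have -> : d%:R = \sum_(i < d) 1 :> R by rewrite sumr_const card_ord.
  rewrite mulr_suml; apply: ler_sum => i _; rewrite mul1r.
  (* Moving the origin of the grid by - s e_i pairs every cube with its lower neighbour, also when
     that neighbour lies outside the unit cube. *)
  have -> : \sum_(k : dindex n) `|avg (corner k) - avg (corner k - s *: unit_rV i)| =
      (s ^+ d)^-1 * \sum_(k : dindex n)
       `|\int[leb]_(x in hbox (gpt (- (s *: unit_rV i)) s k + s *: unit_rV i) s) \1_B x
         - \int[leb]_(x in hbox (gpt (- (s *: unit_rV i)) s k) s) \1_B x|.
    rewrite mulr_sumr; apply: eq_bigr => k _.
    have E : gpt (- (s *: unit_rV i)) s k = corner k - s *: unit_rV i.
      by apply/rowP => j; rewrite [RHS]mxE cornerE mxE addrC.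
    by rewrite E subrK dist.
  by rewrite ler_pM2l ?invr_gt0//; exact: grid_variation.
apply: (@le_trans _ _ (2 * s ^+ d.-1 *
   (2 * (d%:R * ((s ^+ d)^-1 * (s * fine (perimeter B)))) + (s ^+ d.-1)^-1))).
  rewrite ler_pM2l ?mulr_gt0 ?exprn_gt0//.
  by apply: (le_trans H1); apply: (le_trans tle); rewrite lerD2r ler_pM2l.
(* When d = 0, [d.-1] is 0 and not -1, so the powers of s do not cancel, but the perimeter term
   carries a factor d. *)
case: (posnP d) => [d0|d0].
  rewrite mulrDr; have := mulfV (lt0r_neq0 (exprn_gt0 d.-1 s0)).
  have -> : (d%:R = 0 :> R) by rewrite d0.
  by rewrite mul0r !mulr0 mul0r !add0r -mulrA => ->; rewrite mulr1.
have E1 : s ^+ d.-1 * ((s ^+ d)^-1 * s) = 1.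
  rewrite mulrCA -exprSr prednK// mulVf// gt_eqF//.
have E2 : s ^+ d.-1 / s ^+ d.-1 = 1 by rewrite divff// gt_eqF// exprn_gt0.
rewrite [leLHS](_ : _ = 4 * d%:R * fine (perimeter B) * (s ^+ d.-1 * ((s ^+ d)^-1 * s))
  + 2 * (s ^+ d.-1 / s ^+ d.-1)); first by rewrite E1 E2 !mulr1.
lra.
Qed.

(* If P and the threshold set disagree about a cube, then B and the figure of P
   differ on at least a quarter of it. *)
Lemma threshold_approx (P : {set dindex n}) (t : R) : 1 / 4 <= t <= 3 / 4 ->
  (leb (dfig P `+` dfig (threshold_set t)) <= 4%:E * leb (B `+` dfig P))%E.
Proof.
move=> /andP[t1 t2]; set Q := threshold_set t.
(* The frame is added because a cube outside P may touch the figure of P along its faces. *)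
pose X : set V := (B `+` dfig P) `|` frame n.
have mP := @measurable_dfig R d n P.
have mX : measurable (X : set (rVleb R d)).
  apply: measurableU; last exact: measurable_frame.
  by apply: measurableU; exact: measurableD.
have lX : leb X = leb (B `+` dfig P).
  apply/eqP; rewrite eq_le; apply/andP; split; last by apply: le_leb => x; left.
  by apply: (le_trans (leb_setU_le _ _)); rewrite leb_frame adde0.
have X01 : X `<=` cube01 R d.
  move=> x [[[/B01//]|[/dfig_sub_cube01//]]|/big_setUE[k _ [/dcube_sub_cube01//]]].
have Xfin : leb X \is a fin_num.
  by rewrite ge0_fin_numE//; apply: le_lt_trans cube01_fin; exact: le_leb.
pose D := [set k | (k \in P) != (k \in Q)]%SET.
have mh (k : dindex n) := @measurable_hcube R d n k.
have hfin (k : dindex n) : (leb (hcube k : set V) < +oo)%E by rewrite leb_hcube ltry.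
have I1 (k : @dindex d n) : \int[leb]_(x in hcube k) (1 : R) = s ^+ d.
  rewrite (Rintegral_cst leb (mh k) 1) mul1r.
  exact: (congr1 fine (leb_hcube k)).
have avgE (k : @dindex d n) : avg (corner k) * s ^+ d = \int[leb]_(x in hcube k) \1_B x.
  by rewrite /avg mulrAC mulVf ?mul1r// gt_eqF.
(* On a cube of P that is not in Q, B misses more than 1 - t >= 1/4 of the volume; on a cube of Q
   that is not in P, B fills at least t >= 1/4 of it. *)
have Dk k : k \in D -> s ^+ d / 4 <= \int[leb]_(x in hcube k) \1_X x.
  rewrite inE; case: (boolP (k \in P)) => kP; case: (boolP (k \in Q)) => kQ //= _.
    apply: (@le_trans _ _ (\int[leb]_(x in hcube k) (1 - \1_B x))).
      rewrite RintegralB//; last 2 first.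
      - by apply: (@integrable_bounded _ _ _ _ _ _ 1) => // x _; rewrite normr1.
      - exact: indic_integrable.
      rewrite I1 -avgE; move: kQ; rewrite inE -ltNge -(ltr_pM2r sd0).
      by have : t * s ^+ d <= 3 / 4 * s ^+ d by [rewrite ler_pM2r]; lra.
    apply: le_Rintegral => //.
    - apply: integrable_sub => //; last exact: indic_integrable.
      by apply: (@integrable_bounded _ _ _ _ _ _ 1) => // x _; rewrite normr1.
    - exact: indic_integrable.
    - move=> x kx; rewrite !indicE; case: (boolP (x \in B)) => xB.
        by rewrite subrr.
      rewrite subr0 mem_set//; left; right; split; last by move: xB => /negP xB /mem_set.
      by exists k => //; exact: hcube_sub.
  apply: (@le_trans _ _ (\int[leb]_(x in hcube k) \1_B x)).
    rewrite -avgE; move: kQ; rewrite inE -(ler_pM2r sd0).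
    by have : 1 / 4 * s ^+ d <= t * s ^+ d by [rewrite ler_pM2r]; lra.
  apply: le_Rintegral => //.
  - exact: indic_integrable.
  - exact: indic_integrable.
  - move=> x kx; rewrite !indicE; case: (boolP (x \in B)) => xB; last by [].
    rewrite mem_set//; case: (EM (frame n x)) => [|nF]; first by right.
    left; left; split; first exact: set_mem.
    move=> [l lP lx]; move: kP; rewrite (dcube_inj nF (hcube_sub kx) lx).
    by rewrite lP.
have DX : #|D|%:R * (s ^+ d / 4) <= fine (leb X).
  have iX01 : leb.-integrable (cube01 R d : set (rVleb R d)) (EFin \o (\1_X : V -> R)).
    by apply: indic_integrable => //; exact: measurable_cube01.
  have -> : fine (leb X) = \int[leb]_(x in cube01 R d) \1_X x.
    rewrite /Rintegral integral_indic//; last exact: measurable_cube01.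
    by rewrite setIidl.
  rewrite (Rintegral_cube01 iX01 n) -sum1_card natr_sum mulr_suml big_mkcond /=.
  apply: ler_sum => k _; case: ifPn => kD; first by rewrite mul1r; exact: Dk.
  by apply: Rintegral_ge0 => x _; rewrite indicE.
apply: (@le_trans _ _ (leb (\big[setU/set0]_(k in D) dcube k))).
  apply: le_leb => x /= [[[k kP kx] nQ]|[[k kQ kx] nP]]; apply/big_setUE; exists k => //.
    rewrite inE kP eq_sym; apply/negP => /eqP kQ; apply: nQ; exists k => //.
  rewrite inE kQ; apply/negP => /eqP kP; apply: nP; exists k => //.
apply: (le_trans (leb_big_setU_le _ _ (@measurable_dcube R d n))).
under eq_bigr do rewrite leb_dcube.
rewrite sumEFin sumr_const -lX -(fineK Xfin) -EFinM lee_fin -mulr_natr -/s.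
by move: DX; lra.
Qed.

End bv_approximation.

(** Measure theory yields a figure P close to B but with uncontrolled perimeter. It serves only as a
    witness that level n is fine enough: the threshold set of that level is close to P, and it has
    the required perimeter. *)
Theorem bv_approx (R : realType) (d : nat) (B : BVcube R d) (e : R) : 0 < e ->
  exists n (P : {set dindex n}), (leb (\val B `+` dfig P) < e%:E)%E /\
    (perimeter (dfig P) <= (4 * d%:R * fine (perimeter (\val B)) + 2)%:E)%E.
Proof.
move=> e0; have [[mB _ PB] B01] : BVcube R d (\val B) by exact: set_mem (valP B).
(* The error is that of P plus at most four times as much for the passage from P to the threshold
   set. *)
have [|n [P BP]] := figure_approx_measurable mB B01 (e := e / 5).
  by rewrite divr_gt0.
have [t t14 Pt] := perimeter_threshold n mB B01 PB.
exists n, (threshold_set (\val B) n t); split => //.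
apply: (le_lt_trans (leb_setY_triangle _ (dfig P) _)).
have := threshold_approx mB B01 P t14.
have : (0 <= leb (\val B `+` dfig P))%E by exact: measure_ge0.
move: BP; set y := leb (\val B `+` dfig P); set z := leb (dfig P `+` _).
case: y => [r| |]; [|by []|by []]; rewrite lte_fin lee_fin => re r0 H.
apply: (@le_lt_trans _ _ (r%:E + 4%:E * r%:E)%E); first exact: leeD2l.
by rewrite -EFinM -EFinD lte_fin; lra.
Qed.

(** * Geometric tails and powers of the side *)

Section geometric_sequences.
Context {R : realType}.
Implicit Types (u : nat -> R) (c rho x l K : R).

Lemma cvg_dist_le u l x K n : u m @[m --> \oo] --> l ->
  (forall m, (n <= m)%N -> `|u m - x| <= K) -> `|l - x| <= K.
Proof.
move=> ul uK; have H : `|u m - x| @[m --> \oo] --> `|l - x|.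
  by apply: cvg_norm; apply: cvgB => //; exact: cvg_cst.
rewrite -(cvg_lim (@norm_hausdorff _ R) H); apply: limr_le; first exact: cvgP H.
by near=> m; apply: uK; near: m; exists n.
Unshelve. all: by end_near. Qed.

Lemma geometric_increment_cvg u c rho : 0 <= rho < 1 ->
  (forall n, `|u n.+1 - u n| <= c * rho ^+ n) ->
  cvgn u /\ forall n, `|limn u - u n| <= c * rho ^+ n / (1 - rho).
Proof.
move=> /andP[r0 r1] uc; have cu : cvgn u.
  have -> : u = (fun n => u 0%N + series (telescope u) n).
    by apply/funext => n; exact: eq_sum_telescope.
  apply: is_cvgD; first exact: is_cvg_cst.
  apply: normed_cvg; apply: (@series_le_cvg _ _ (geometric c rho)) => //.
  - by move=> n; exact: normr_ge0.
  - by move=> n; apply: le_trans (uc n); exact: normr_ge0.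
  - by apply: is_cvg_geometric_series; rewrite ger0_norm.
split=> // n; apply: (cvg_dist_le (n := n) cu) => m /subnKC <-.
have q0 : 0 < (1 - rho)^-1 by rewrite invr_gt0 subr_gt0.
have c0 k : 0 <= c * rho ^+ k by apply: le_trans (uc k).
(* The exact partial geometric sum is kept, as the induction does not close with the bound of the
   full tail. *)
suff H k : `|u (n + k)%N - u n| <= c * rho ^+ n * (1 - rho ^+ k) / (1 - rho).
  apply: le_trans (H _) _; rewrite ler_pM2r// ler_piMr//.
  by rewrite lerBlDr lerDl exprn_ge0.
elim: k => [|k IH]; first by rewrite addn0 subrr normr0 subrr mulr0 mul0r.
rewrite addnS -(subrKA (u (n + k)%N)); apply: (le_trans (ler_normD _ _)).
apply: (le_trans (lerD (uc _) IH)).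
have q1 : (1 - rho) * (1 - rho)^-1 = 1 by rewrite mulfV// gt_eqF// subr_gt0.
rewrite exprD exprS; move: q1; set q := (1 - rho)^-1 => q1.
have -> : c * (rho ^+ n * rho ^+ k) = c * (rho ^+ n * rho ^+ k) * ((1 - rho) * q).
  by rewrite q1 mulr1.
by rewrite le_eqVlt; apply/orP; left; apply/eqP; lra.
Qed.

End geometric_sequences.

Section powers.
Context {R : realType}.

Lemma side_powR n (a : R) : side n `^ a = (2^-1 `^ a) ^+ n :> R.
Proof.
rewrite -powR_mulrn ?powR_ge0// -powRrM mulrC powRrM powR_mulrn ?invr_ge0//.
by rewrite exprVn.
Qed.

Lemma half_powR_lt1 (a : R) : 0 < a -> 0 <= (2^-1 : R) `^ a < 1.
Proof.
move=> a0; rewrite powR_ge0/=; have -> : 1 = 1 `^ a :> R by rewrite powR1.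
apply: gt0_ltr_powR => //.
- by rewrite nnegrE invr_ge0.
- by rewrite nnegrE.
- by rewrite powR1 invf_lt1// ltr1n.
Qed.

Lemma side_exprn_powR n d (a : R) : (side n ^+ d) `^ a = side n `^ (d%:R * a) :> R.
Proof. by rewrite powRrM powR_mulrn// ltW// side_gt0. Qed.

End powers.

(** * Hölder functions and charges on dyadic cubes *)

Section holder_functions.
Context {R : realType} {d : nat}.
Local Notation V := 'rV[R]_d.
Implicit Types (x y : V) (f : cube01 R d -> R).

Lemma ext0E f (x : cube01 R d) : ext0 f (\val x) = f x.
Proof. by have := congr1 (@^~ x) (valLK 0 f). Qed.

Lemma ext0_out f x : ~ cube01 R d x -> ext0 f x = 0.
Proof.
move=> nx; have /(congr1 (@^~ x)) := congr1 (@^~ (ext0 f)) (sigLK (0 : R) (A := cube01 R d)).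
rewrite [_ x in LHS](congr1 (fun h => ext0 h x) (valLK 0 f)) => ->.
by rewrite patchE memNset.
Qed.

Lemma ext0_in f x (x01 : cube01 R d x) : ext0 f x = f (exist _ x (mem_set x01)).
Proof. by rewrite -[RHS]ext0E. Qed.

Lemma ext0D (a : R) f g x : ext0 (a *: f + g) x = a * ext0 f x + ext0 g x.
Proof.
have [x01|nx] := EM (cube01 R d x); first by rewrite !(ext0_in _ x01).
by rewrite !ext0_out// mulr0 addr0.
Qed.

Lemma enorm_gt0 x : x != 0 -> 0 < enorm x.
Proof.
apply: contraNT; rewrite -leNgt => x0; apply/eqP/rowP => i; rewrite mxE.
by apply/eqP; rewrite -normr_le0; exact: le_trans (entry_le_enorm x i) x0.
Qed.

(** The cruder d in place of sqrt d is the origin of the powers d^beta in later constants. *)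
Lemma enorm_le (r : R) x : (forall i, `|x ord0 i| <= r) -> enorm x <= d%:R * r.
Proof.
move=> xr; case: (posnP d) => [d0|d0].
  rewrite /enorm (_ : \sum_i _ = 0) ?sqrtr0 ?d0 ?mul0r//.
  by apply: big1 => -[i id]; exfalso; move: id; rewrite d0.
have r0 : 0 <= r by apply: le_trans (xr (Ordinal d0)).
rewrite -[leRHS]ger0_norm ?mulr_ge0// -sqrtr_sqr ler_wsqrtr//.
apply: (@le_trans _ _ (\sum_(i < d) r ^+ 2)).
  by apply: ler_sum => i _; rewrite -real_normK ?num_real// ler_sqr ?nnegrE.
rewrite sumr_const card_ord exprMn -[leLHS]mulr_natl ler_wpM2r ?sqr_ge0//.
by rewrite expr2 -natrM ler_nat leq_pmulr.
Qed.

Lemma corner_hcube n (k : @dindex d n) : hcube k (corner k : V).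
Proof. by move=> i; rewrite lexx ltrDl side_gt0. Qed.

Lemma corner_cube01 n (k : @dindex d n) : cube01 R d (corner k).
Proof. exact: (dcube_sub_cube01 (hcube_sub (corner_hcube k))). Qed.

Lemma dcube_enorm n (k : @dindex d n) x y : dcube k x -> dcube k y ->
  enorm (x - y) <= d%:R * side n.
Proof.
move=> kx ky; apply: enorm_le => i; rewrite mxE [X in _ + X]mxE.
have := kx i; have := ky i => /andP[? ?] /andP[? ?].
by rewrite ler_norml; apply/andP; split; lra.
Qed.

Section holder.
Variables (beta L : R) (f : cube01 R d -> R).
Hypotheses (b0 : 0 < beta) (L0 : 0 <= L) (fL : (lip beta f <= L%:E)%E).

Lemma lip_dist x y : cube01 R d x -> cube01 R d y ->
  `|ext0 f x - ext0 f y| <= L * enorm (x - y) `^ beta.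
Proof.
move=> x01 y01; have [->|xy] := eqVneq x y.
  by rewrite subrr normr0 mulr_ge0// powR_ge0.
pose x' : cube01 R d := exist _ x (mem_set x01).
pose y' : cube01 R d := exist _ y (mem_set y01).
rewrite -[x]/(\val x') -[y]/(\val y') !ext0E.
rewrite -ler_pdivrMr ?powR_gt0 ?enorm_gt0 ?subr_eq0// -lee_fin.
by apply: le_trans fL; apply: ereal_sup_ubound; exists (x', y').
Qed.

Lemma dcube_lip n (k : @dindex d n) x y : dcube k x -> dcube k y ->
  `|ext0 f x - ext0 f y| <= L * (d%:R * side n) `^ beta.
Proof.
move=> kx ky; apply: (le_trans (lip_dist _ _)); try exact: dcube_sub_cube01 _.
rewrite ler_wpM2l// ge0_ler_powR ?nnegrE ?sqrtr_ge0 ?mulr_ge0//.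
- exact: ltW.
- exact/ltW/side_gt0.
- exact: (dcube_enorm kx ky).
Qed.

Lemma measurable_ext0_holder :
  measurable_fun (cube01 R d : set (rVleb R d)) (ext0 f : rVleb R d -> R).
Proof.
apply: measurable_fun_locally => [|x x01 e e0]; first exact: measurable_cube01.
(* The solution of (L + 1) t^beta = e; using L + 1 covers L = 0 and makes the final estimate
   strict. *)
pose t := (e / (L + 1)) `^ beta^-1; have L1 : 0 < L + 1 by rewrite ltr_wpDl.
have t0 : 0 < t by apply: powR_gt0; rewrite divr_gt0.
have d1 : 0 < d%:R + 1 :> R by rewrite ltr_wpDl.
exists (t / (d%:R + 1)) => [|y y01 yx]; first by rewrite divr_gt0.
apply: (le_lt_trans (lip_dist y01 x01)).
have xyt : enorm (y - x) <= t.
  apply: (le_trans (enorm_le (r := t / (d%:R + 1)) _)) => [i|].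
    by rewrite mxE [X in _ + X]mxE ltW.
  by rewrite mulrCA ler_piMr ?(ltW t0)// ler_pdivrMr// mul1r lerDl.
apply: (@le_lt_trans _ _ (L * (e / (L + 1)))).
  rewrite ler_wpM2l//; have <- : t `^ beta = e / (L + 1).
    by rewrite -powRrM mulVf ?gt_eqF// powRr1// divr_ge0// ltW.
  by rewrite ge0_ler_powR ?nnegrE ?sqrtr_ge0// ltW.
by rewrite mulrCA gtr_pMr// ltr_pdivrMr// mul1r ltrDl.
Qed.

Lemma cube01_0 : cube01 R d 0.
Proof. by move=> i; rewrite mxE lexx ler01. Qed.

Lemma ext0_holder_bounded x : cube01 R d x ->
  `|ext0 f x| <= `|ext0 f 0| + L * d%:R `^ beta.
Proof.
move=> x01; rewrite -lerBlDl; apply: (le_trans (lerB_dist _ _)).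
apply: (le_trans (lip_dist x01 cube01_0)); rewrite ler_wpM2l//.
rewrite ge0_ler_powR ?nnegrE ?sqrtr_ge0//; first exact: ltW.
rewrite subr0 -[leRHS]mulr1; apply: enorm_le => i.
by have /andP[x0 x1] := x01 i; rewrite ger0_norm.
Qed.

End holder.

Lemma holder_normP (gamma H : R) (w : BVcube R d -> R) n (k : @dindex d n) :
  (holder_norm gamma w <= H%:E)%E ->
  `|w (bvcube k)| <= H * side n `^ (d%:R * gamma).
Proof.
move=> wH; rewrite -side_exprn_powR -ler_pdivrMr ?powR_gt0 ?exprn_gt0 ?side_gt0//.
rewrite -lee_fin; apply: le_trans wH; apply: ereal_sup_ubound.
exists (bvcube k); first by move: (@dyadic_dcube R d n k); rewrite -bvcubeE.
by rewrite bvcubeE; congr (_ / _ `^ _)%:E; exact: (congr1 fine (leb_dcube k)).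
Qed.

Lemma card_dindex n : #|{: @dindex d n}|%:R * side n ^+ d = 1 :> R.
Proof.
rewrite card_ffun !card_ord natrX -exprMn mulrC mulrC -[X in X ^+ d]mulrC side_natr.
by rewrite expr1n.
Qed.

End holder_functions.

(** * The strong norm controls the value on each BV set *)

Lemma integrable_indic_mul dT (T : measurableType dT) (R : realType)
    (mu : {measure set T -> \bar R}) (B : set T) (g : T -> R) : measurable B ->
  mu.-integrable B (EFin \o g) ->
  mu.-integrable setT (EFin \o (fun x => \1_B x * g x)).
Proof.
move=> mB /(iffLR (integrable_mkcond (EFin \o g) mB)).
congr integrable; apply/funext => x.
by rewrite /patch /= indicE; case: ifPn => _; rewrite ?mul1r ?mul0r.
Qed.

Section strong_evaluation.
Context {R : realType} {d : nat}.
Local Notation V := 'rV[R]_d.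
Implicit Types (B : BVcube R d) (w : BVcube R d -> R).

Lemma BVcubeP B : [/\ measurable (\val B : set (rVleb R d)),
  (perimeter (\val B) < +oo)%E & \val B `<=` cube01 R d].
Proof. by have [[mB _ PB] B01] : BVcube R d (\val B) by exact: set_mem (valP B). Qed.

Lemma continuous_divergence (v : V -> V) : test_field v -> continuous (divergence v).
Proof.
move=> [_ cJ _ _]; rewrite /divergence /mxtrace.
elim: (index_enum _) => [|i r IH].
  by under eq_fun do rewrite big_nil; exact: cst_continuous.
under eq_fun do rewrite big_cons.
apply: continuousD_rV => // x.
exact: (continuous_comp (cJ x) (@coord_continuous _ _ _ i i _)).
Qed.

Lemma integrable_indic_divergence (v : V -> V) B : test_field v ->
  leb.-integrable setT (EFin \o (fun x => \1_(\val B) x * divergence v x)).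
Proof.
move=> /continuous_divergence cv; have [mB _ B01] := BVcubeP B.
have [K K0 vK] := @continuous_bounded_cbox R d _ 0 1 cv.
have iB : leb.-integrable (\val B : set (rVleb R d)) (EFin \o divergence v).
  apply: (@integrable_bounded _ _ _ _ _ _ K).
  - exact: mB.
  - by apply: (le_lt_trans (le_leb B01)); rewrite leb_cube01 ltry.
  - exact/measurable_funTS/measurable_fun_continuous_rV.
  - by move=> x /B01; rewrite cube01E; exact: vK.
exact: (integrable_indic_mul mB iB).
Qed.

Lemma variationZ_indic (c : R) B : 0 <= c ->
  (variation (c *: \1_(\val B)) <= c%:E * perimeter (\val B))%E.
Proof.
move=> c0; apply: ge_ereal_sup => _ [v tv <-].
have iBv := integrable_indic_divergence B tv.
have -> : (\int[leb]_x ((c *: \1_(\val B)) x * divergence v x)%:E =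
    c%:E * \int[leb]_x (\1_(\val B) x * divergence v x)%:E)%E.
  rewrite -(integralZl measurableT iBv); apply: eq_integral => x _.
  by rewrite -EFinM mulrA.
by apply: lee_wpmul2l; [rewrite lee_fin|apply: ereal_sup_ubound; exists v].
Qed.

Lemma BVfun_indic B : BVfun (\1_(\val B) : V -> R).
Proof.
have [mB PB B01] := BVcubeP B; split=> //.
  apply/integrableP; split; first exact/measurable_EFinP/measurable_indic.
  rewrite (eq_integral (fun x : rVleb R d => (\1_(\val B) x)%:E)); last first.
    by move=> x _; rewrite /= ger0_norm.
  rewrite integral_indic// setIT.
  by apply: (le_lt_trans (le_leb B01)); rewrite leb_cube01 ltry.
by apply: aeW => x nx; rewrite indicE memNset// => /B01.
Qed.

Lemma BVfun0 : BVfun (0 : V -> R).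
Proof.
have := BVfun_indic (bvfig (finset.set0 : {set dindex 0})).
congr BVfun; apply/funext => x; rewrite indicE memNset//.
by move=> [k]; rewrite inE.
Qed.

Lemma BVdual0 (l : (V -> R) -> R) : BVdual l -> l (0 : V -> R) = 0.
Proof.
move=> [lin _]; have := lin 1 0 0 BVfun0 BVfun0.
by rewrite scaler0 addr0 => H; lra.
Qed.

(** A representing functional is tested on 1_B / (1 + P), where P is the perimeter of B; this
    function has variation at most 1. The added 1 avoids a division by zero. Norm convergence of
    strong charges therefore implies convergence on every BV set. *)
Lemma strong_norm_eval w B (e : R) : (strong_norm w < e%:E)%E ->
  `|w B| <= e * (1 + fine (perimeter (\val B))).
Proof.
move=> we; have [_ [l [[lB _] wl] <-] le_] : exists2 x,
    [set opnorm l | l in [set l | strong_dual l /\ represents l w]] x & (x < e%:E)%E.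
  by apply/ereal_inf_lt.
have [_ PB _] := BVcubeP B; set P := fine (perimeter (\val B)).
have P0 : 0 <= P by exact/fine_ge0/variation_ge0.
have PE : perimeter (\val B) = P%:E by rewrite fineK// ge0_fin_numE// variation_ge0.
have P1 : 0 < 1 + P by rewrite ltr_pwDl.
pose u : V -> R := (1 + P)^-1 *: \1_(\val B).
have uV : (variation u <= 1)%E.
  apply: (le_trans (variationZ_indic _ _)); first by rewrite invr_ge0 ltW.
  by rewrite PE -EFinM lee_fin mulrC ler_pdivrMr// mul1r lerDr.
have [i1 _ a1] := BVfun_indic B; have uB : BVfun u.
  split; last by apply: aeW => x nx; have [_ _ B01] := BVcubeP B;
    rewrite /u fctE indicE memNset ?scaler0// => /B01.
  - exact: (integrable_scale (1 + P)^-1 measurableT i1).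
  - exact: (le_lt_trans uV (ltry 1)).
have lu : `|l u| < e.
  rewrite -lte_fin; apply: le_lt_trans le_; apply: ereal_sup_ubound.
  by exists u.
have uE : l u = (1 + P)^-1 * w B.
  have := (proj1 lB) (1 + P)^-1 _ _ (BVfun_indic B) BVfun0.
  by rewrite (BVdual0 lB) !addr0 (wl B).
move: lu; rewrite uE normrM ger0_norm ?invr_ge0 ?(ltW P1)//.
by rewrite mulrC ltr_pdivrMr// => /ltW.
Qed.

End strong_evaluation.

(** * Riemann sums and the integral *)

Lemma Rintegral_oscillation_le dT (T : measurableType dT) (R : realType)
    (mu : {measure set T -> \bar R}) (D : set T) (u g : T -> R) (c e : R) :
  measurable D -> mu.-integrable D (EFin \o u) -> measurable_fun D g ->
  (forall x, D x -> `|g x - c| <= e) ->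
  `|\int[mu]_(x in D) (u x * g x) - c * \int[mu]_(x in D) u x| <=
    e * \int[mu]_(x in D) `|u x|.
Proof.
move=> mD iu mg ge; have mgc : measurable_fun D (fun x => g x - c).
  by apply: measurable_funB => //; exact: measurable_cst.
have iug : mu.-integrable D (EFin \o (fun x => u x * g x)).
  apply: (integrable_bounded_mul (M := e + `|c|)) => // x Dx.
  by rewrite -(subrK c (g x)) (le_trans (ler_normD _ _))// lerD2r ge.
apply: le_trans (Rintegral_mul_le mD iu mgc ge).
rewrite -RintegralZl// -RintegralB//; last exact: integrable_scale.
by rewrite le_eqVlt; apply/orP; left; apply/eqP; congr `|_|; apply: eq_Rintegral => x _; lra.
Qed.

Section riemann_sums.
Context {R : realType} {d : nat}.
Local Notation V := 'rV[R]_d.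
Implicit Types (f : cube01 R d -> R) (w : BVcube R d -> R).

Definition rsum n f w : R := \sum_(k : @dindex d n) ext0 f (corner k) * w (bvcube k).

Definition charge_int f w : R := limn (fun n => rsum n f w).

(** Additivity distributes w(K) over the children of K, while f is still sampled at the corner of
    the parent. Consecutive sums thereby become sums over the same cubes. *)
Lemma rsum_par n f w : charge01 w ->
  rsum n f w = \sum_(k : @dindex d n.+1) ext0 f (corner (par k)) * w (bvcube k).
Proof.
move=> cw; rewrite (partition_big (@par d n) xpredT)//=; apply: eq_bigr => k _.
rewrite (charge_children cw k) mulr_sumr; apply: eq_big => // k' /eqP <-.
by [].
Qed.

Lemma rsumDl n a f g w : rsum n (a *: f + g) w = a * rsum n f w + rsum n g w.
Proof.
rewrite /rsum mulr_sumr -big_split/=; apply: eq_bigr => k _.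
by rewrite ext0D mulrDl mulrA.
Qed.

Lemma rsumDr n f a w z : rsum n f (a *: w + z) = a * rsum n f w + rsum n f z.
Proof.
rewrite /rsum mulr_sumr -big_split/=; apply: eq_bigr => k _.
by rewrite !fctE mulrDr mulrCA.
Qed.

Section holder.
Variables beta gamma : R.
Hypotheses (beta0 : 0 < beta) (beta_gamma : d%:R < beta + d%:R * gamma).

Definition decay : R := 2^-1 `^ (beta + d%:R * gamma - d%:R).
(** Comes from (2 d s)^beta, where d times the parent side 2 s bounds the diameter of the parent of
    a cube of side s. *)
Definition step_const : R := d%:R `^ beta * 2 `^ beta.

Lemma decay01 : 0 <= decay < 1.
Proof. by apply: half_powR_lt1; rewrite subr_gt0. Qed.

Lemma step_const_ge0 : 0 <= step_const.
Proof. by rewrite mulr_ge0 ?powR_ge0. Qed.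

(** Each fine cube contributes at most the oscillation of f over its parent times H s^(d gamma), and
    there are s^-d fine cubes. The estimate produces the exponent [n.+1]; the spare factor [decay]
    is bounded by 1. *)
Lemma rsum_step (L H : R) f w n : 0 <= L -> 0 <= H -> charge01 w ->
  (lip beta f <= L%:E)%E -> (holder_norm gamma w <= H%:E)%E ->
  `|rsum n.+1 f w - rsum n f w| <= step_const * L * H * decay ^+ n.
Proof.
move=> L0 H0 cw fL wH; rewrite (rsum_par n f cw) -sumrB.
apply: (le_trans (ler_norm_sum _ _ _)).
set s : R := side n.+1; have s0 : 0 < s by exact: side_gt0.
apply: (@le_trans _ _ (\sum_(k : @dindex d n.+1)
    (L * (d%:R * side n) `^ beta) * (H * s `^ (d%:R * gamma)))).
  apply: ler_sum => k _; rewrite -mulrBl normrM ler_pM//.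
    apply: (dcube_lip beta0 L0 fL (k := par k)); last exact/hcube_sub/corner_hcube.
    exact/dcube_par/hcube_sub/corner_hcube.
  exact: holder_normP.
rewrite sumr_const -[leLHS]mulr_natl (sideS n) -/s.
rewrite !powRM ?mulr_ge0 ?(ltW s0)//.
(* The factor s^d is split off to cancel the number of cubes. *)
have sE : s `^ beta * s `^ (d%:R * gamma) = s ^+ d * decay ^+ n.+1.
  rewrite -side_powR -/s -powR_mulrn ?(ltW s0)// -!powRD ?(gt_eqF s0) ?implybT//.
  by congr (_ `^ _); lra.
rewrite [leLHS](_ : _ = step_const * L * H * (#|{: @dindex d n.+1}|%:R * s ^+ d)
    * decay ^+ n.+1); last first.
  rewrite -[RHS]mulrA -(mulrA _ (s ^+ d)) -sE /step_const.
  by rewrite -[#|{: @dindex d n.+1}|%:R]/(#|{: @dindex d n.+1}|%:R : R); lra.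
rewrite card_dindex mulr1 ler_wpM2l ?mulr_ge0 ?step_const_ge0//.
have /andP[r0 r1] := decay01; rewrite exprS ler_piMl ?exprn_ge0//; exact: ltW.
Qed.

Section tail.
Variables (L H : R) (f : cube01 R d -> R) (w : BVcube R d -> R).
Hypotheses (L0 : 0 <= L) (H0 : 0 <= H) (cw : charge01 w).
Hypotheses (fL : (lip beta f <= L%:E)%E) (wH : (holder_norm gamma w <= H%:E)%E).

Let tail := geometric_increment_cvg decay01 (fun n => rsum_step n L0 H0 cw fL wH).

Lemma rsum_cvg : rsum n f w @[n --> \oo] --> charge_int f w.
Proof. exact: tail.1. Qed.

Lemma charge_int_tail n : `|charge_int f w - rsum n f w| <=
  step_const * L * H * decay ^+ n / (1 - decay).
Proof. exact: tail.2. Qed.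

(** The sum of level 0 is the single term f(0) w([0,1]^d); the rest is the tail from level 0. *)
Lemma charge_int_le : `|charge_int f w| <=
  (`|ext0 f 0| + step_const / (1 - decay) * L) * H.
Proof.
have T := charge_int_tail 0; rewrite expr0 mulr1 in T.
rewrite -(subrK (rsum 0 f w) (charge_int f w)) addrC.
apply: (le_trans (ler_normD _ _)); rewrite mulrDl lerD//; last first.
  by apply: le_trans T _; rewrite le_eqVlt; apply/orP; left; apply/eqP; lra.
rewrite /rsum (big_pred1 (@dindex0 d)) => [|k /=]; last first.
  by apply/esym/eqP/ffunP => i; apply/val_inj; rewrite ffunE; case: (k i) => -[|m].
rewrite corner0 normrM ler_wpM2l//; have := holder_normP dindex0 wH.
by rewrite side0 powR1 mulr1.
Qed.

End tail.

Lemma lt_pinfty_bound (x : \bar R) : (x < +oo)%E -> exists2 r : R, 0 <= r & (x <= r%:E)%E.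
Proof.
case: x => [r _| |_] //; last by exists 0 => //; rewrite leNye.
by exists `|r| => //; rewrite lee_fin ler_norm.
Qed.

(** Replacing f by its corner value on each cube costs at most L (d [side n])^beta times the
    integral of |g| over that cube. This yields clause (A). *)
Lemma rsum_density_cvg f (g : cube01 R d -> R) w (L : R) : 0 <= L ->
  (lip beta f <= L%:E)%E ->
  leb.-integrable (cube01 R d : set (rVleb R d)) (EFin \o ext0 g) ->
  w = density_charge g ->
  rsum n f w @[n --> \oo] --> \int[leb]_(x in cube01 R d) (ext0 f x * ext0 g x).
Proof.
move=> L0 fL ig wE; have mf := measurable_ext0_holder beta0 L0 fL.
have ifg : leb.-integrable (cube01 R d : set (rVleb R d))
    (EFin \o (fun x => ext0 g x * ext0 f x)).
  apply: (integrable_bounded_mul (M := `|ext0 f 0| + L * d%:R `^ beta)).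
  - exact: measurable_cube01.
  - exact: ig.
  - exact: mf.
  - by move=> x x01; exact: (ext0_holder_bounded beta0 L0 fL).
have ign : leb.-integrable (cube01 R d : set (rVleb R d)) (EFin \o (fun x => `|ext0 g x|)).
  exact: integrable_norm ig.
set G := \int[leb]_(x in cube01 R d) `|ext0 g x|.
have rsum_dist n : `|\int[leb]_(x in cube01 R d) (ext0 f x * ext0 g x) - rsum n f w| <=
    L * (d%:R * side n) `^ beta * G.
  under eq_Rintegral do rewrite mulrC.
  rewrite (Rintegral_cube01 ifg n) /G (Rintegral_cube01 ign n) -sumrB mulr_sumr.
  apply: (le_trans (ler_norm_sum _ _ _)); apply: ler_sum => k _.
  have mk := @measurable_hcube R d n k.
  have k01 : hcube k `<=` cube01 R d by move=> x /hcube_sub/dcube_sub_cube01.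
  have igk : leb.-integrable (hcube k : set (rVleb R d)) (EFin \o ext0 g).
    exact: (integrableS (@measurable_cube01 R d) mk k01 ig).
  have mfk : measurable_fun (hcube k : set (rVleb R d)) (ext0 f : rVleb R d -> R).
    exact: (measurable_funS (@measurable_cube01 R d) k01 mf).
  rewrite wE /density_charge bvcubeE (Rintegral_dcube ig).
  apply: Rintegral_oscillation_le => // x kx.
  exact: (dcube_lip beta0 L0 fL (hcube_sub kx) (hcube_sub (corner_hcube k))).
have cv : L * (d%:R * side n) `^ beta * G @[n --> \oo] --> (0 : R).
  have E n : L * (d%:R * side n) `^ beta * G =
      geometric (L * d%:R `^ beta * G) (2^-1 `^ beta) n.
    by rewrite powRM ?(ltW (side_gt0 _))// side_powR /=; lra.
  under eq_fun do rewrite E; apply: cvg_geometric.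
  by have /andP[? ?] := half_powR_lt1 beta0; rewrite ger0_norm.
apply/cvgrPdist_le => e e0; have /cvgrPdist_le/(_ e e0) := cv.
apply: filterS => n; rewrite sub0r normrN => /(le_trans (ler_norm _)).
exact: le_trans.
Qed.

Lemma sup_pinfty_bound (T : Type) (x : T -> \bar R) :
  (ereal_sup (range x) < +oo)%E ->
  exists2 r : R, 0 <= r & forall t, (x t <= r%:E)%E.
Proof.
move=> /lt_pinfty_bound[r r0 xr]; exists r => // t.
by apply: le_trans xr; apply: ereal_sup_ubound; exists t.
Qed.

Lemma charge_int_cvg (f_ : nat -> cube01 R d -> R) f
    (w_ : nat -> BVcube R d -> R) w :
  (forall p, charge01 (w_ p)) -> charge01 w ->
  (lip beta f < +oo)%E -> (holder_norm gamma w < +oo)%E ->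
  (forall x, f_ p x @[p --> \oo] --> f x) ->
  (forall n (k : @dindex d n), w_ p (bvcube k) @[p --> \oo] --> w (bvcube k)) ->
  (ereal_sup (range (fun p => lip beta (f_ p))) < +oo)%E ->
  (ereal_sup (range (fun p => holder_norm gamma (w_ p))) < +oo)%E ->
  charge_int (f_ p) (w_ p) @[p --> \oo] --> charge_int f w.
Proof.
move=> cw_ cw /lt_pinfty_bound[L0 L00 fL] /lt_pinfty_bound[H0 H00 wH] ff ww.
move=> /sup_pinfty_bound[L1 L10 fL1] /sup_pinfty_bound[H1 H10 wH1].
(* Common bounds for the sequence and its limit, so that one tail estimate serves both. *)
pose L := L0 + L1; pose H := H0 + H1.
have LP : 0 <= L by rewrite addr_ge0.
have HP : 0 <= H by rewrite addr_ge0.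
have fL' : (lip beta f <= L%:E)%E by apply: (le_trans fL); rewrite lee_fin lerDl.
have wH' : (holder_norm gamma w <= H%:E)%E by apply: (le_trans wH); rewrite lee_fin lerDl.
have fL1' p : (lip beta (f_ p) <= L%:E)%E by apply: (le_trans (fL1 p)); rewrite lee_fin lerDr.
have wH1' p : (holder_norm gamma (w_ p) <= H%:E)%E.
  by apply: (le_trans (wH1 p)); rewrite lee_fin lerDr.
pose t n := step_const * L * H / (1 - decay) * decay ^+ n.
have tE n : step_const * L * H * decay ^+ n / (1 - decay) = t n.
  by rewrite /t mulrAC.
have t0 : t n @[n --> \oo] --> (0 : R).
  by apply: cvg_geometric; have /andP[? ?] := decay01; rewrite ger0_norm.
apply/cvgrPdist_le => e e0; have e3 : 0 < e / 3 by rewrite divr_gt0.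
(* The level n is fixed by the tail, uniformly in p; what remains is a finite sum, in which p may
   tend to infinity. *)
have /cvgrPdist_le/(_ _ e3)[n _ /(_ n (leqnn n))] := t0.
rewrite sub0r normrN => /(le_trans (ler_norm _)) tn.
have rcv : rsum n (f_ p) (w_ p) @[p --> \oo] --> rsum n f w.
  apply: cvg_sumR => k _; apply: cvgM; last exact: ww.
  rewrite (ext0_in _ (corner_cube01 k)).
  by under eq_fun do rewrite (ext0_in _ (corner_cube01 k)); exact: ff.
have /cvgrPdist_le/(_ _ e3) := rcv; apply: filterS => p rp.
have T1 := charge_int_tail LP HP cw fL' wH' n.
have T2 := charge_int_tail LP HP (cw_ p) (fL1' p) (wH1' p) n.
rewrite tE in T1; rewrite tE in T2.
rewrite -(subrKA (rsum n f w)) (le_trans (ler_normD _ _))//.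
rewrite -(subrKA (rsum n (f_ p) (w_ p)) (rsum n f w)).
apply: (le_trans (lerD (lexx _) (ler_normD _ _))).
rewrite (distrC (rsum n (f_ p) (w_ p))); lra.
Qed.

End holder.

(** On a set of finite measure, |g| <= 1 + |g|^p suffices. *)
Lemma Lpcube_integrable (p : R) (g : cube01 R d -> R) : 1 <= p -> Lpcube p g ->
  leb.-integrable (cube01 R d : set (rVleb R d)) (EFin \o ext0 g).
Proof.
move=> p1 gp; have ip := Lfun_integrable p1 gp.
have mg : measurable_fun setT (ext0 g : rVleb R d -> R).
  by move: gp; rewrite /Lpcube /= inE => /andP[]; rewrite inE.
have m01 := @measurable_cube01 R d.
have i1 : leb.-integrable (cube01 R d : set (rVleb R d)) (EFin \o (fun=> 1 : R)).
  apply: (integrable_bounded (M := 1)) => //; first by rewrite leb_cube01 ltry.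
  by move=> x _; rewrite normr1.
have ip1 : leb.-integrable (cube01 R d : set (rVleb R d))
    (EFin \o (fun x => 1 + `|ext0 g x| `^ p)).
  by apply: integrable_add => //; exact: (integrableS measurableT m01 (@subsetT _ _) ip).
apply: (le_integrable m01 _ _ ip1); first exact/measurable_EFinP/measurable_funTS.
move=> x _; rewrite /= lee_fin [leRHS]ger0_norm ?addr_ge0 ?powR_ge0//.
have [x1|x1] := leP `|ext0 g x| 1; first by rewrite (le_trans x1)// lerDl powR_ge0.
by rewrite (le_trans (le1r_powR (ltW x1) p1))// lerDr.
Qed.

End riemann_sums.

(** * Oscillation between sibling cubes *)

(** Exchanges 2 m and 2 m + 1, the two indices with the same half. *)
Definition flip_nat n := if odd n then n.-1 else n.+1.

Lemma half_flip_nat n : (flip_nat n)./2 = n./2.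
Proof. by rewrite /flip_nat; case: ifP => on; lia. Qed.

Lemma odd_flip_nat n : odd (flip_nat n) = ~~ odd n.
Proof. by rewrite /flip_nat; case: ifP => on; lia. Qed.

Lemma flip_natK : involutive flip_nat.
Proof.
by move=> n; rewrite {1}/flip_nat odd_flip_nat /flip_nat; case: (boolP (odd n)) => /= on; lia.
Qed.

Lemma flip_natP n m : n./2 = m./2 -> n != m -> flip_nat n = m.
Proof. by rewrite /flip_nat; case: ifP => on; lia. Qed.

Lemma flip_nat_neq n : flip_nat n != n.
Proof. by rewrite /flip_nat; case: ifP => on; lia. Qed.

Lemma flip_nat_lt m n : (n < 2 ^ m.+1)%N -> (flip_nat n < 2 ^ m.+1)%N.
Proof. by rewrite /flip_nat expnS; case: ifP => on; lia. Qed.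

Section flips.
Context {d n : nat}.
Implicit Types (S : {set 'I_d}) (k : @dindex d n.+1).

(* The siblings of k are its images under the involutions flip S, which exchange
   in each coordinate of S the two halves of the parent interval. *)
Definition flip S k : @dindex d n.+1 :=
  [ffun i => if i \in S then Ordinal (flip_nat_lt (ltn_ord (k i))) else k i].

Lemma flipE S k i : flip S k i = (if i \in S then flip_nat (k i) else k i) :> nat.
Proof. by rewrite ffunE; case: ifP. Qed.

Lemma par_flip S k : par (flip S k) = par k.
Proof.
apply/ffunP => i; apply/val_inj; rewrite /= !parE flipE.
by case: ifP => // _; exact: half_flip_nat.
Qed.

Lemma flipK S : involutive (flip S).
Proof.
move=> k; apply/ffunP => i; apply/val_inj; rewrite /= !flipE.
by case: (i \in S); rewrite ?flip_natK.
Qed.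

Lemma flip0 k : flip finset.set0 k = k.
Proof. by apply/ffunP => i; apply/val_inj; rewrite /= flipE inE. Qed.

Lemma flipU1 i S k : i \notin S -> flip (i |: S)%SET k = flip [set i] (flip S k).
Proof.
move=> iS; apply/ffunP => j; apply/val_inj; rewrite /= !flipE !inE.
by case: eqP => //= ->; rewrite (negbTE iS).
Qed.

(** A sibling is determined by the set of coordinates in which it differs from k, so siblings are
    indexed by the subsets of the axes. In particular there are 2^d of them. *)
Lemma sum_siblings (R : realType) (F : @dindex d n.+1 -> R) k :
  \sum_(k' | par k' == par k) F k' = \sum_S F (flip S k).
Proof.
rewrite (reindex_onto (fun S => flip S k) (fun k' => [set i | k' i != k i]%SET)).
  apply: eq_bigl => S; rewrite par_flip eqxx/=; apply/eqP/setP => i.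
  rewrite inE -val_eqE /= flipE; case: ifP => _; first exact: flip_nat_neq.
  by rewrite eqxx.
move=> k' /eqP kk'; apply/ffunP => i; apply/val_inj; rewrite /= flipE inE -val_eqE /=.
case: eqP => [->//|/eqP kk]; apply: flip_natP; last by rewrite eq_sym.
by rewrite -!parE kk'.
Qed.

End flips.

Section flip_variation.
Context {R : realType} {d n : nat}.
Local Notation V := 'rV[R]_d.
Variable u : V -> R.
Hypotheses (iu : leb.-integrable (setT : set (rVleb R d)) (EFin \o u)).
Hypothesis Vu : (variation u < +oo)%E.
Let s : R := side n.+1.
Let U (k : @dindex d n.+1) : R := \int[leb]_(x in hcube k) u x.

Lemma corner_flip1 i (k : @dindex d n.+1) : ~~ odd (k i) ->
  corner (flip [set i] k) = gpt 0 s k + s *: unit_rV i.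
Proof.
move=> ek; apply/rowP => j.
rewrite cornerE flipE inE mxE [X in _ = X + _]cornerE [X in _ = _ + X]mxE unit_rVE.
case: eqP => [->|_]; last by rewrite mulr0 addr0.
by rewrite /flip_nat (negbTE ek) -natr1 mulrDr mulr1.
Qed.

(** For an even index the flip is the translation by s e_i, to which [grid_variation] applies. The
    involution carries the odd indices to the even ones, whence the factor 2. *)
Lemma flip1_variation i :
  \sum_k `|U k - U (flip [set i] k)| <= 2 * (s * fine (variation u)).
Proof.
rewrite (bigID (fun k : dindex n.+1 => odd (k i)))/= mulr_natl mulr2n.
have even_le : \sum_(k : dindex n.+1 | ~~ odd (k i)) `|U k - U (flip [set i] k)| <=
    s * fine (variation u).
  apply: le_trans (@grid_variation R d u (2 ^ n.+1) 0 s i iu Vu (side_gt0 _)).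
  rewrite big_mkcond/=; apply: ler_sum => k _; case: ifPn => // ek.
  by rewrite distrC -(corner_flip1 ek); exact: lexx.
rewrite lerD// (reindex_inj (inv_inj (flipK [set i]))).
apply: le_trans even_le; rewrite le_eqVlt; apply/orP; left; apply/eqP.
apply: eq_big => k; first by rewrite flipE inE eqxx odd_flip_nat.
by rewrite flipK distrC.
Qed.

(** The coordinates of S are flipped one at a time. By the triangle inequality each costs one single
    flip, after a reindexing by the flips already made. *)
Lemma flip_variation S :
  \sum_k `|U k - U (flip S k)| <= d%:R * (2 * (s * fine (variation u))).
Proof.
have V0 : 0 <= 2 * (s * fine (variation u)).
  by rewrite !mulr_ge0 ?(ltW (side_gt0 _)) ?fine_ge0 ?variation_ge0.
apply: (@le_trans _ _ (#|S|%:R * (2 * (s * fine (variation u))))); last first.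
  by rewrite ler_wpM2r// ler_nat -[leqRHS]card_ord max_card.
elim: {S}#|S| {-2}S (erefl #|S|) => [|m IH] S.
  move=> S0; rewrite S0 mul0r; move/eqP: S0; rewrite cards_eq0 => /eqP ->.
  rewrite big1// => k _.
  by rewrite flip0 subrr normr0.
have [->|[i iS]] := set_0Vmem S; first by rewrite cards0.
rewrite (cardsD1 i) iS add1n => -[] /IH {}IH.
rewrite -[in leLHS](finset.setD1K iS) -natr1 mulrDl mul1r.
apply: le_trans (lerD IH (flip1_variation i)).
rewrite [X in _ <= _ + X](reindex_inj (inv_inj (flipK (S :\ i)))) -big_split/=.
apply: ler_sum => k _; rewrite flipU1 ?inE ?eqxx//.
exact: ler_distD.
Qed.

Lemma sibling_variation :
  \sum_(k : @dindex d n.+1) \sum_(k' | par k' == par k) `|U k - U k'| <=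
  2 ^+ d * (d%:R * (2 * (s * fine (variation u)))).
Proof.
under eq_bigr do rewrite sum_siblings.
rewrite exchange_big/=; apply: (le_trans (ler_sum _ (fun S _ => flip_variation S))).
by rewrite sumr_const -cardsT -powersetT card_powerset cardsT card_ord -[leLHS]mulr_natl natrX.
Qed.

End flip_variation.

(** * Densities that are constant on dyadic cubes *)

Section simple_integral.
Context dT (T : measurableType dT) (R : realType) (mu : {measure set T -> \bar R}).

Lemma Rintegral_simple_mul (I : finType) (c : I -> R) (A : I -> set T) (D : set T)
    (u : T -> R) : measurable D -> (forall i, measurable (A i)) ->
  mu.-integrable D (EFin \o u) ->
  \int[mu]_(x in D) ((\sum_i c i * \1_(A i) x) * u x) =
  \sum_i c i * \int[mu]_(x in D `&` A i) u x.
Proof.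
move=> mD mA iu.
have iuA i : mu.-integrable D (EFin \o (fun x => u x * \1_(A i) x)).
  apply: (integrable_bounded_mul (M := 1)) => //.
  by move=> x _; rewrite indicE; case: (_ \in _); rewrite ?normr1 ?normr0.
under eq_Rintegral => x _ do rewrite mulr_suml.
transitivity (\int[mu]_(x in D) (\sum_i c i * (u x * \1_(A i) x))).
  by apply: eq_Rintegral => x _; apply: eq_bigr => i _; rewrite -mulrA (mulrC (u x)).
rewrite Rintegral_sum// => [|i _]; last exact: integrable_scale.
by apply: eq_bigr => i _; rewrite RintegralZl// Rintegral_indic.
Qed.

Lemma measureU_null (A B : set T) : measurable A -> measurable B ->
  (mu A < +oo)%E -> mu (A `&` B) = 0%E -> mu (A `|` B) = (mu A + mu B)%E.
Proof. by move=> mA mB Aoo AB; rewrite measureUfinl// AB sube0. Qed.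

Lemma Lfun_bounded_support (p M : R) (D : set T) (g : T -> R) : 1 <= p ->
  measurable D -> (mu D < +oo)%E -> measurable_fun setT g ->
  (forall x, `|g x| <= M) -> (forall x, ~ D x -> g x = 0) -> g \in Lfun mu p%:E.
Proof.
move=> p1 mD Doo mg gM gD; rewrite inE; apply/andP; split; first by rewrite inE.
have p0 : 0 < p by exact: lt_le_trans p1.
rewrite inE /= /finite_norm unlock poweR_lty//.
apply: (@le_lt_trans _ _ (\int[mu]_x ((M `^ p)%:E * (\1_D x)%:E))%E).
  apply: ge0_le_integral => //.
  - by move=> x _; rewrite poweR_EFin lee_fin powR_ge0.
  - apply/measurable_EFinP; apply: (measurableT_comp (measurable_powR _)) => //.
    exact: measurableT_comp.
  - apply/measurable_EFinP; apply: measurable_funM; first exact: measurable_cst.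
    exact: measurable_indic.
  - move=> x _; rewrite /= -EFinM lee_fin indicE; have [Dx|nx] := EM (D x).
      rewrite mem_set// mulr1 ge0_ler_powR ?nnegrE//; first exact: ltW.
      exact: le_trans (gM x).
    by rewrite memNset// mulr0 gD// normr0 powR0// gt_eqF.
have m1 : measurable_fun setT (fun x => (\1_D x : R)%:E) by exact/measurable_EFinP/measurable_indic.
rewrite ge0_integralZl// ?lee_fin ?powR_ge0//.
by rewrite integral_indic// setIT lte_mul_pinfty// lee_fin powR_ge0.
Qed.

End simple_integral.

Section bounded_Lp.
Context {R : realType} {d : nat}.

Lemma Lpcube_bounded (p M : R) (g : cube01 R d -> R) : 1 <= p ->
  measurable_fun setT (ext0 g : rVleb R d -> R) -> (forall x, `|ext0 g x| <= M) ->
  Lpcube p g.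
Proof.
move=> p1 mg gM; apply: (Lfun_bounded_support p1 (@measurable_cube01 R d) _ mg gM).
- by rewrite leb_cube01 ltry.
- by move=> x; exact: ext0_out.
Qed.

End bounded_Lp.

Section dyadic_density.
Context {R : realType} {d : nat}.
Local Notation V := 'rV[R]_d.
Implicit Types (w : BVcube R d -> R) (B : BVcube R d).

Definition density_coef w m (k : @dindex d m) : R := w (bvcube k) / side m ^+ d.

(** Half-open cubes are used so that no two values add up on a common face. *)
Definition step_density w m (x : V) : R :=
  \sum_(k : @dindex d m) density_coef w k * \1_(hcube k) x.

Definition density w m (x : cube01 R d) : R := step_density w m (\val x).

Lemma ext0_density w m : ext0 (density w m) = step_density w m.
Proof.
apply/funext => x; have [x01|nx] := EM (cube01 R d x).
  by rewrite (ext0_in _ x01).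
rewrite ext0_out// /step_density big1// => k _.
by rewrite indicE memNset ?mulr0// => /hcube_sub/dcube_sub_cube01.
Qed.

Lemma measurable_step_density w m :
  measurable_fun setT (step_density w m : rVleb R d -> R).
Proof.
apply: measurable_sum => k; apply: measurable_funM; first exact: measurable_cst.
exact/measurable_indic/measurable_hcube.
Qed.

Lemma step_density_bounded w m x :
  `|step_density w m x| <= \sum_(k : @dindex d m) `|density_coef w k|.
Proof.
apply: (le_trans (ler_norm_sum _ _ _)); apply: ler_sum => k _.
rewrite normrM ler_piMr// indicE; by case: (_ \in _); rewrite ?normr1 ?normr0.
Qed.

Definition hmeas m (k : @dindex d m) B : R := fine (leb (\val B `&` hcube k)).

Lemma density_chargeE w m B :
  density_charge (density w m) B = \sum_(k : @dindex d m) density_coef w k * hmeas k B.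
Proof.
have [mB _ B01] := BVcubeP B.
have Boo : (leb (\val B) < +oo)%E by apply: (le_lt_trans (le_leb B01)); rewrite leb_cube01 ltry.
have i1 : leb.-integrable (\val B : set (rVleb R d)) (EFin \o (fun=> 1 : R)).
  apply: (integrable_bounded (M := 1)) => //.
  by move=> x _; rewrite normr1.
rewrite /density_charge ext0_density.
under eq_Rintegral => x _ do rewrite -[step_density _ _ _]mulr1.
have mh (k : @dindex d m) := @measurable_hcube R d m k.
rewrite (Rintegral_simple_mul (@density_coef w m) mB mh i1).
by apply: eq_bigr => k _; rewrite (Rintegral_cst leb (measurableI _ _ mB (mh k)) 1) mul1r.
Qed.

Lemma density_dualE w m (u : V -> R) : leb.-integrable (setT : set (rVleb R d)) (EFin \o u) ->
  density_dual (density w m) u =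
  \sum_(k : @dindex d m) density_coef w k * \int[leb]_(x in hcube k) u x.
Proof.
move=> iu; rewrite /density_dual ext0_density.
rewrite (Rintegral_simple_mul (@density_coef w m) measurableT (fun k => @measurable_hcube R d m k) iu).
by apply: eq_bigr => k _; rewrite setTI.
Qed.

Lemma density_dual_indic w m B :
  density_dual (density w m) \1_(\val B) = density_charge (density w m) B.
Proof.
rewrite /density_dual /density_charge [RHS]Rintegral_mkcond.
apply: eq_Rintegral => x _; rewrite /patch indicE.
by case: ifPn; rewrite ?mulr1 ?mulr0.
Qed.

Lemma charge01_sum (I : finType) (c : I -> R) (z : I -> BVcube R d -> R) :
  (forall i, charge01 (z i)) -> charge01 (fun B => \sum_i c i * z i B).
Proof.
move=> cz; split=> [B1 B2 B BE B0|B_ B BB].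
  by rewrite -big_split/=; apply: eq_bigr => i _; rewrite ((cz i).1 B1 B2 B)// mulrDr.
by apply: cvg_sumR => i _; apply: cvgM; [exact: cvg_cst|exact: (cz i).2].
Qed.

(** Continuity holds because the values at two sets differ by at most the measure of their symmetric
    difference. The charge of a step density is a linear combination of these. *)
Lemma charge01_hmeas m (k : @dindex d m) : charge01 (hmeas k).
Proof.
have mh := @measurable_hcube R d m k.
have fin (A : set V) : leb (A `&` hcube k) \is a fin_num.
  rewrite ge0_fin_numE//; apply: (@le_lt_trans _ _ (leb (hcube k))).
    by apply: le_leb => x [].
  by rewrite leb_hcube ltry.
split=> [B1 B2 B BE B0|B_ B [BB _]].
  have [mB1 _ _] := BVcubeP B1; have [mB2 _ _] := BVcubeP B2.
  have mI1 : measurable (\val B1 `&` hcube k : set (rVleb R d)) by exact: measurableI.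
  have mI2 : measurable (\val B2 `&` hcube k : set (rVleb R d)) by exact: measurableI.
  rewrite /hmeas BE setIUl -fineD//; congr fine.
  apply: measureU_null => //; first by rewrite ltey_eq fin.
  apply/eqP; rewrite eq_le measure_ge0 andbT -B0.
  by apply: le_leb => x [[? _] [? _]].
have sub (A1 A2 : set V) : (leb (A1 `&` hcube k) <= leb (A2 `&` hcube k) + leb (A1 `+` A2))%E.
  apply: le_trans (leb_setU_le _ _); apply: le_leb => x [A1x hx] /=.
  by have [A2x|nA2x] := EM (A2 x); [left|right; left].
apply/cvgrPdist_le => e e0; have /fine_cvgP[Bfin /cvgrPdist_le/(_ _ e0)] := BB.
move: Bfin; apply: filterS2 => n Bn; rewrite sub0r normrN => Be.
have BE := fineK Bn; rewrite ler_norml; apply/andP; split.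
  rewrite -lerN2 opprB opprK lerBlDr addrC -lee_fin EFinD !fineK//.
  apply: (le_trans (sub _ (\val B))); apply: leeD2l; rewrite -BE lee_fin.
  exact: le_trans (ler_norm _) Be.
rewrite lerBlDr addrC -lee_fin EFinD !fineK//.
apply: (le_trans (sub _ (\val (B_ n)))); apply: leeD2l; rewrite setYC -BE lee_fin.
exact: le_trans (ler_norm _) Be.
Qed.

Lemma charge01_density w m : charge01 (density_charge (density w m)).
Proof.
rewrite (_ : density_charge _ = fun B => \sum_(k : @dindex d m) density_coef w k * hmeas k B).
  exact: charge01_sum (@charge01_hmeas m).
by apply/funext => B; exact: density_chargeE.
Qed.

Lemma hmeas_ge0 m (k : @dindex d m) B : 0 <= hmeas k B.
Proof. exact/fine_ge0/measure_ge0. Qed.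

Lemma hmeasE m (k l : @dindex d m) : hmeas l (bvcube k) = (k == l)%:R * side m ^+ d.
Proof.
rewrite /hmeas bvcubeE; case: eqP => [<-|kl].
  rewrite mul1r; have -> : dcube k `&` hcube k = (hcube k : set V).
    by apply/seteqP; split=> [x []//|x hx]; split=> //; exact: hcube_sub.
  exact: (congr1 fine (leb_hcube k)).
rewrite mul0r (_ : leb _ = 0%E)//; apply/eqP; rewrite eq_le measure_ge0 andbT.
rewrite -(@leb_frame R d m); apply: le_leb => x [kx /hcube_sub lx].
by apply: contrapT => nF; apply: kl; exact: dcube_inj nF kx lx.
Qed.

Lemma sum_hmeas_dcube m n (k : @dindex d n) :
  \sum_(l : @dindex d m) hmeas l (bvcube k) = side n ^+ d.
Proof.
have mk := @measurable_dcube R d n k; have m01 := @measurable_cube01 R d.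
have ik : leb.-integrable (cube01 R d : set (rVleb R d)) (EFin \o (\1_(dcube k) : V -> R)).
  apply: (@integrable_bounded _ _ _ _ _ _ 1).
  - exact: m01.
  - by rewrite leb_cube01 ltry.
  - exact/measurable_funTS/measurable_indic.
  - by move=> x _; rewrite indicE; case: (_ \in _); rewrite ?normr1 ?normr0.
transitivity (\int[leb]_(x in cube01 R d) (\1_(dcube k) x : R)).
  rewrite (Rintegral_cube01 ik m); apply: eq_bigr => l _.
  rewrite /hmeas bvcubeE /Rintegral integral_indic//; exact: measurable_hcube.
rewrite /Rintegral integral_indic// setIidl; last exact: dcube_sub_cube01.
exact: (congr1 fine (leb_dcube k)).
Qed.

(** True at level m by the choice of the coefficients, and inherited by coarser levels because both
    sides are additive over children. *)
Lemma density_charge_dyadic w m n (k : @dindex d n) : charge01 w -> (n <= m)%N ->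
  density_charge (density w m) (bvcube k) = w (bvcube k).
Proof.
move=> cw nm; rewrite -(subnK nm); move: (m - n)%N => j.
elim: j n k {nm} => [|j IH] n k; last first.
  rewrite (charge_children (charge01_density w _) k) (charge_children cw k).
  by apply: eq_bigr => k' _; rewrite addSnnS; exact: IH.
rewrite density_chargeE (bigD1 k)//= big1 => [|l lk]; last first.
  by rewrite hmeasE eq_sym (negbTE lk) mul0r mulr0.
by rewrite addr0 hmeasE eqxx mul1r /density_coef mulfVK// expf_neq0// gt_eqF// side_gt0.
Qed.

Lemma density_charge_bvfig w m n (P : {set @dindex d n}) : charge01 w -> (n <= m)%N ->
  density_charge (density w m) (bvfig P) = w (bvfig P).
Proof.
move=> cw nm; rewrite (charge_bvfig (charge01_density w m)) (charge_bvfig cw).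
by apply: eq_bigr => k _; exact: density_charge_dyadic.
Qed.

Lemma holder_norm_le (gamma H : R) w :
  (forall n (k : @dindex d n), `|w (bvcube k)| <= H * side n `^ (d%:R * gamma)) ->
  (holder_norm gamma w <= H%:E)%E.
Proof.
move=> wH; apply: ge_ereal_sup => _ [K dK <-].
have [n [k Kk]] := dyadic_cubeP dK.
have -> : K = bvcube k by apply/val_inj; rewrite bvcubeE.
rewrite lee_fin ler_pdivrMr bvcubeE; last first.
  by apply: powR_gt0; rewrite (congr1 fine (leb_dcube k)) exprn_gt0// side_gt0.
by rewrite [fine _](congr1 fine (leb_dcube k)) side_exprn_powR.
Qed.

Lemma ext0_densityB w m n x :
  ext0 (density w m - density w n) x = step_density w m x - step_density w n x.
Proof. by rewrite -scaleN1r addrC ext0D !ext0_density mulN1r addrC. Qed.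

Lemma Lpcube_density (p : R) w m n : 1 <= p -> Lpcube p (density w m) /\
  Lpcube p (density w m - density w n).
Proof.
move=> p1; split.
  apply: (Lpcube_bounded p1); first by rewrite ext0_density; exact: measurable_step_density.
  by move=> x; rewrite ext0_density; exact: step_density_bounded.
have E : ext0 (density w m - density w n) = fun x => step_density w m x - step_density w n x.
  by apply/funext => x; exact: ext0_densityB.
apply: (Lpcube_bounded p1); rewrite E.
  by apply: measurable_funB; exact: measurable_step_density.
move=> x; apply: (le_trans (ler_normB _ _)).
by apply: lerD; exact: step_density_bounded.
Qed.

Section holder_bounds.
Variables (gamma H : R) (w : BVcube R d -> R).
Hypotheses (gamma1 : gamma <= 1) (H0 : 0 <= H).
Hypothesis wH : (holder_norm gamma w <= H%:E)%E.

Lemma density_coef_le m (k : @dindex d m) :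
  `|density_coef w k| <= H * side m `^ (d%:R * gamma) / side m ^+ d.
Proof.
rewrite normrM [X in _ * X]ger0_norm ?invr_ge0 ?exprn_ge0 ?(ltW (side_gt0 _))//.
by rewrite ler_pM2r ?invr_gt0 ?exprn_gt0 ?side_gt0//; exact: holder_normP.
Qed.

(** Down to level m the values are those of w. On a smaller cube the density is at most H
    [side m]^(d gamma - d), and since gamma <= 1 this is at most the same expression at the smaller
    side. The bound does not depend on m, as clause (B) demands. *)
Lemma holder_norm_density m : charge01 w ->
  (holder_norm gamma (density_charge (density w m)) <= H%:E)%E.
Proof.
move=> cw; apply: holder_norm_le => n k; case: (leqP n m) => nm.
  by rewrite density_charge_dyadic//; exact: holder_normP.
rewrite density_chargeE; apply: (le_trans (ler_norm_sum _ _ _)).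
apply: (@le_trans _ _ (\sum_(l : @dindex d m)
    (H * side m `^ (d%:R * gamma) / side m ^+ d) * hmeas l (bvcube k))).
  apply: ler_sum => l _; rewrite normrM [X in _ * X]ger0_norm ?hmeas_ge0//.
  by rewrite ler_wpM2r ?hmeas_ge0//; exact: density_coef_le.
rewrite -mulr_sumr sum_hmeas_dcube -!mulrA ler_wpM2l// mulrA mulrAC ler_pdivrMr.
- have E j : side j ^+ d = side j `^ (d%:R * gamma) * side j `^ (d%:R * (1 - gamma)) :> R.
    rewrite -powRD ?(gt_eqF (side_gt0 _)) ?implybT// -powR_mulrn ?(ltW (side_gt0 _))//.
    by congr (_ `^ _); lra.
  rewrite !E mulrCA ler_wpM2l ?powR_ge0// ler_wpM2l ?powR_ge0//.
  apply: ge0_ler_powR; rewrite ?nnegrE ?(ltW (side_gt0 _))//.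
    by rewrite mulr_ge0// subr_ge0.
  rewrite /side lef_pV2 ?posrE ?exprn_gt0//; apply: ler_weXn2l; last exact: ltnW.
  by rewrite ler1n.
- by rewrite exprn_gt0// side_gt0.
Qed.

End holder_bounds.

End dyadic_density.

(** * Convergence of the densities in the strong norm *)

Lemma cvg_lin (R : realType) (u v : nat -> R) (a l k : R) :
  u n @[n --> \oo] --> l -> v n @[n --> \oo] --> k ->
  a * u n + v n @[n --> \oo] --> a * l + k.
Proof. by move=> ul vk; apply: cvgD => //; apply: cvgM => //; exact: cvg_cst. Qed.

Lemma Rintegral_lin dT (T : measurableType dT) (R : realType)
    (mu : {measure set T -> \bar R}) (a : R) (f h : T -> R) :
  mu.-integrable setT (EFin \o f) -> mu.-integrable setT (EFin \o h) ->
  \int[mu]_x (a * f x + h x) = a * \int[mu]_x f x + \int[mu]_x h x.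
Proof.
move=> fi hi; rewrite RintegralD//; last exact: integrable_scale.
by rewrite RintegralZl.
Qed.

Section density_convergence.
Context {R : realType} {d : nat}.
Local Notation V := 'rV[R]_d.
Implicit Types (u v : V -> R) (B : BVcube R d).

Lemma card_siblings n (k : @dindex d n.+1) : \sum_(k' | par k' == par k) (1 : R) = 2 ^+ d.
Proof.
rewrite sum_siblings sumr_const -cardsT -powersetT card_powerset cardsT card_ord.
by rewrite natrX.
Qed.

Lemma integrable_density_mul (w : BVcube R d -> R) m u :
  leb.-integrable (setT : set (rVleb R d)) (EFin \o u) ->
  leb.-integrable (setT : set (rVleb R d)) (EFin \o (fun x => step_density w m x * u x)).
Proof.
move=> iu; rewrite (_ : (fun x => _) = fun x => u x * step_density w m x); last first.
  by apply/funext => x; rewrite mulrC.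
apply: (@integrable_bounded_mul _ _ _ _ _ _ _ _ measurableT iu).
  exact: measurable_step_density.
by move=> x _; exact: step_density_bounded.
Qed.

Lemma density_dual_lin (w : BVcube R d -> R) m (a : R) u v : BVfun u -> BVfun v ->
  density_dual (density w m) (a *: u + v) =
  a * density_dual (density w m) u + density_dual (density w m) v.
Proof.
move=> [iu _ _] [iv _ _]; rewrite /density_dual ext0_density.
have <- := Rintegral_lin a (integrable_density_mul w m iu) (integrable_density_mul w m iv).
by apply: eq_Rintegral => x _; rewrite mulrDr mulrCA.
Qed.

Lemma density_dualB (w : BVcube R d -> R) m n u : BVfun u ->
  density_dual (density w m - density w n) u =
  density_dual (density w m) u - density_dual (density w n) u.
Proof.
move=> [iu _ _]; rewrite /density_dual !ext0_density [RHS]addrC -[X in _ = X + _]mulN1r.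
have <- := Rintegral_lin (-1) (integrable_density_mul w n iu) (integrable_density_mul w m iu).
by apply: eq_Rintegral => x _; rewrite ext0_densityB mulN1r mulrBl addrC.
Qed.

Lemma variation0_le1 : (variation (0 : V -> R)%R <= 1)%E.
Proof.
apply: ge_ereal_sup => _ [v _ <-]; rewrite (eq_integral (fun=> 0%E)) ?integral0//.
by move=> x _; rewrite mul0r.
Qed.

Lemma strong_norm_ge0 (w : BVcube R d -> R) : (0 <= strong_norm w)%E.
Proof.
apply/le_ereal_inf_tmp => _ [l _ <-].
apply: (@le_trans _ _ `|l (0 : V -> R)%R|%:E); first by rewrite lee_fin.
by apply: ereal_sup_ubound; exists 0 => //; split; [exact: BVfun0|exact: variation0_le1].
Qed.

Variable gamma : R.
Hypothesis gamma_gt : d%:R < 1 + d%:R * gamma.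

(** The counterpart of [decay] with 1 in place of beta: between neighbouring cubes, averages of a BV
    function vary in total like those of a function of Hölder exponent 1. *)
Definition dual_decay : R := 2^-1 `^ (1 + d%:R * gamma - d%:R).

Lemma dual_decay01 : 0 <= dual_decay < 1.
Proof. by apply: half_powR_lt1; rewrite subr_gt0. Qed.

Section approximation.
Variables (H : R) (w : BVcube R d -> R).
Hypotheses (H0 : 0 <= H) (cw : charge01 w) (wH : (holder_norm gamma w <= H%:E)%E).

Local Notation T m := (density_dual (density w m)).

(** On the finer grid, the coarse density replaces the integral over a cube k by its mean over the
    2^d siblings of k. The difference is thus a sum over sibling pairs, with coefficients at most
    2^-d H s^(d gamma - d); [sibling_variation] bounds the sum over pairs by 2^d 2 d s V(u). *)
Lemma density_dual_step m u : BVfun u ->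
  `|T m.+1 u - T m u| <= d%:R * 2 * H * fine (variation u) * dual_decay ^+ m.
Proof.
move=> [iu Vu _]; rewrite !density_dualE//.
set U := fun k : @dindex d m.+1 => \int[leb]_(x in hcube k) u x.
set s : R := side m.+1; have s0 : 0 < s by exact: side_gt0.
have sd0 : 0 < s ^+ d by rewrite exprn_gt0.
have iuc : leb.-integrable (cube01 R d : set (rVleb R d)) (EFin \o u).
  exact: (integrableS measurableT (@measurable_cube01 R d) (@subsetT _ _) iu).
have Tm : \sum_(k : @dindex d m) density_coef w k * \int[leb]_(x in hcube k) u x =
    \sum_(k : @dindex d m.+1) density_coef w k / 2 ^+ d * \sum_(k' | par k' == par k) U k'.
  rewrite [RHS](partition_big (@par d m) xpredT)//=; apply: eq_bigr => k _.
  rewrite (Rintegral_hcube_children iuc) /density_coef (charge_children cw k) !mulr_suml.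
  apply: eq_bigr => k' /eqP kk'; rewrite kk' (sideS m) exprMn -/s invfM.
  by rewrite (mulrC (_ ^- _) (_ ^-1)) mulrA.
rewrite Tm -sumrB (eq_bigr (fun k => density_coef w k / 2 ^+ d *
    \sum_(k' | par k' == par k) (U k - U k'))); last first.
  move=> k _; rewrite sumrB mulrBr; congr (_ - _).
  have -> : \sum_(k' | par k' == par k) U k = U k * 2 ^+ d.
    by rewrite -(card_siblings k) mulr_sumr; apply: eq_bigr => *; rewrite mulr1.
  by rewrite (mulrC (U k)) mulrA divfK// expf_neq0.
apply: (le_trans (ler_norm_sum _ _ _)).
pose M : R := H * s `^ (d%:R * gamma) / s ^+ d.
apply: (@le_trans _ _ (\sum_(k : @dindex d m.+1) M / 2 ^+ d *
    \sum_(k' | par k' == par k) `|U k - U k'|)).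
  apply: ler_sum => k _; rewrite normrM; apply: ler_pM => //; last exact: ler_norm_sum.
  rewrite normrM [X in _ * X]ger0_norm ?invr_ge0 ?exprn_ge0//.
  by rewrite ler_wpM2r ?invr_ge0 ?exprn_ge0//; exact: density_coef_le.
have M0 : 0 <= M by rewrite !mulr_ge0 ?powR_ge0// invr_ge0 ltW.
have M2 : 0 <= M / 2 ^+ d by rewrite mulr_ge0// invr_ge0 exprn_ge0.
have := ler_wpM2l M2 (@sibling_variation R d m u iu Vu).
rewrite mulr_sumr => /le_trans; apply.
have Ms : M * s = H * dual_decay ^+ m.+1.
  have E : s `^ (d%:R * gamma) * s = dual_decay ^+ m.+1 * s ^+ d.
    rewrite -side_powR -/s -[X in _ * X = _](powRr1 (ltW s0)) -powR_mulrn ?(ltW s0)//.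
    rewrite -!powRD ?(gt_eqF s0) ?implybT//; congr (_ `^ _); lra.
  by apply: (mulIf (lt0r_neq0 sd0)); rewrite /M mulrAC divfK ?gt_eqF// -!mulrA E.
rewrite [leLHS](_ : _ = d%:R * 2 * fine (variation u) * (M * s)); last first.
  by rewrite [LHS]mulrA divfK ?expf_neq0// -[side m.+1]/s; lra.
rewrite Ms exprS; have /andP[r0 r1] := dual_decay01.
have c0 : 0 <= d%:R * 2 * fine (variation u) * H * dual_decay ^+ m.
  by rewrite !mulr_ge0 ?exprn_ge0// fine_ge0// variation_ge0.
have := ler_wpM2l c0 (ltW r1); lra.
Qed.

Definition dual_const : R := d%:R * 2 * H / (1 - dual_decay).

Lemma dual_const_ge0 : 0 <= dual_const.
Proof. by have /andP[_ ?] := dual_decay01; rewrite !mulr_ge0// invr_ge0 subr_ge0 ltW. Qed.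

Lemma density_dual_tail u : BVfun u -> cvgn (fun m => T m u) /\
  forall m, `|limn (fun m => T m u) - T m u| <=
    dual_const * fine (variation u) * dual_decay ^+ m.
Proof.
move=> bu; have [cv tl] := geometric_increment_cvg dual_decay01 (fun m => density_dual_step m bu).
split=> // m; apply: le_trans (tl m) _.
by rewrite /dual_const le_eqVlt; apply/orP; left; apply/eqP; lra.
Qed.

(** From level n on, the densities reproduce the value of w on a figure of level n exactly, so the
    limit in the tail estimate is w itself. *)
Lemma density_charge_tail_bvfig m n (P : {set @dindex d n}) :
  `|w (bvfig P) - density_charge (density w m) (bvfig P)| <=
    dual_const * fine (perimeter (dfig P)) * dual_decay ^+ m.
Proof.
have [cv tl] := density_dual_tail (BVfun_indic (bvfig P)).
apply: le_trans (tl m); rewrite density_dual_indic.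
have -> // : limn (fun m => T m \1_(\val (bvfig P))) = w (bvfig P).
apply: (@cvg_lim _ (@Rhausdorff R)); apply: cvg_near_cst; exists n => // j nj.
by rewrite density_dual_indic density_charge_bvfig.
Qed.

(** With m fixed, both w and the charge of the density are continuous along figures that BV-converge
    to B, so the estimate on figures passes to the limit, with the perimeters of the figures bounded
    by that of B. *)
Lemma density_charge_tail m B : `|w B - density_charge (density w m) B| <=
  dual_const * (4 * d%:R * fine (perimeter (\val B)) + 2) * dual_decay ^+ m.
Proof.
set P := 4 * d%:R * fine (perimeter (\val B)) + 2.
have P0 : 0 <= P.
  by rewrite /P addr_ge0// !mulr_ge0// fine_ge0// variation_ge0.
have /choice[F HF] : forall j, exists F : BVcube R d,
    [/\ (leb (\val B `+` \val F) < (j.+1%:R^-1)%:E)%E, (perimeter (\val F) <= P%:E)%E &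
      `|w F - density_charge (density w m) F| <= dual_const * P * dual_decay ^+ m].
  move=> j; have j0 : 0 < j.+1%:R^-1 :> R by rewrite invr_gt0.
  have [n [Q [BQ PQ]]] := bv_approx B j0; exists (bvfig Q); split => //.
  apply: (le_trans (density_charge_tail_bvfig m Q)).
  rewrite ler_wpM2r ?exprn_ge0//; first by have /andP[] := dual_decay01.
  rewrite ler_wpM2l ?dual_const_ge0// -lee_fin fineK//.
  rewrite ge0_fin_numE ?variation_ge0//; exact: le_lt_trans PQ (ltry _).
have FB : BVcvg F B.
  split; last first.
    apply: (@le_lt_trans _ _ P%:E); last exact: ltry.
    by apply: ge_ereal_sup => _ [j _ <-]; have [] := HF j.
  apply: (@squeeze_cvge _ _ _ _ (fun=> 0%E) _ (fun j => (j.+1%:R^-1)%:E)).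
  - by apply: nearW => j; rewrite measure_ge0/= setYC; have [/ltW] := HF j.
  - exact: cvg_cst.
  - apply: cvg_EFin; first by apply: nearW.
    exact: cvg_harmonic.
have cF : w (F j) - density_charge (density w m) (F j) @[j --> \oo] -->
    w B - density_charge (density w m) B.
  by apply: cvgB; [exact: cw.2|exact: (charge01_density w m).2].
have := cvg_dist_le (n := 0) (x := 0) (K := dual_const * P * dual_decay ^+ m) cF.
by rewrite subr0; apply => j _; rewrite subr0; have [] := HF j.
Qed.

Lemma density_charge_cvg B : density_charge (density w m) B @[m --> \oo] --> w B.
Proof.
set K := dual_const * (4 * d%:R * fine (perimeter (\val B)) + 2).
have K0 : K * dual_decay ^+ m @[m --> \oo] --> 0.
  by apply: cvg_geometric; have /andP[? ?] := dual_decay01; rewrite ger0_norm.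
apply/cvgrPdist_le => e e0; have /cvgrPdist_le/(_ e e0) := K0.
apply: filterS => m; rewrite sub0r normrN => /(le_trans (ler_norm _)).
exact: le_trans (density_charge_tail m B).
Qed.

Definition limit_dual u : R := limn (fun m => T m u).

Lemma limit_dual_lin (a : R) u v : BVfun u -> BVfun v ->
  limit_dual (a *: u + v) = a * limit_dual u + limit_dual v.
Proof.
move=> bu bv; have [cu _] := density_dual_tail bu; have [cv _] := density_dual_tail bv.
apply: (@cvg_lim _ (@Rhausdorff R)).
under eq_fun do rewrite density_dual_lin//.
exact: cvg_lin cu cv.
Qed.

Lemma opnorm_density_limit m :
  (opnorm (fun u => T m u - limit_dual u)%R <= (dual_const * dual_decay ^+ m)%:E)%E.
Proof.
apply: ge_ereal_sup => _ [u [bu u1] <-]; rewrite lee_fin distrC.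
have [_ tl] := density_dual_tail bu; apply: (le_trans (tl m)).
have /andP[r0 _] := dual_decay01.
rewrite ler_wpM2r ?exprn_ge0// ler_piMr ?dual_const_ge0//.
by rewrite -lee_fin fineK// ge0_fin_numE ?variation_ge0//; exact: le_lt_trans u1 (ltry _).
Qed.

(** The difference of charges is represented by T_m minus its limit. This functional is strong: T_m
    - T_n is given by a bounded density, and it misses the functional only by T_n minus the limit,
    which is small in operator norm for large n. *)
Lemma strong_norm_density m : (0 < d)%N ->
  (strong_norm (density_charge (density w m) - w)%R <= (dual_const * dual_decay ^+ m)%:E)%E.
Proof.
move=> d0; apply: le_trans (opnorm_density_limit m).
apply: ereal_inf_lbound; exists (fun u => T m u - limit_dual u) => //; split; last first.
  move=> B; rewrite density_dual_indic /limit_dual !fctE; congr (_ - _).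
  apply/esym/(@cvg_lim _ (@Rhausdorff R)).
  under eq_fun do rewrite density_dual_indic.
  exact: density_charge_cvg.
split; first split.
- by move=> a u v bu bv; rewrite density_dual_lin// limit_dual_lin// opprD mulrBr addrACA.
- exact: le_lt_trans (opnorm_density_limit m) (ltry _).
move=> e e0; have K0 : dual_const * dual_decay ^+ n @[n --> \oo] --> 0.
  by apply: cvg_geometric; have /andP[? ?] := dual_decay01; rewrite ger0_norm.
have /cvgrPdist_lt/(_ e e0)[n _ /(_ n (leqnn n))] := K0.
rewrite sub0r normrN => /(le_lt_trans (ler_norm _)) ne.
exists (density w m - density w n).
  have d1 : 1 <= d%:R :> R by rewrite ler1n.
  by have [_] := Lpcube_density w m n d1.
apply: (@le_lt_trans _ _ (opnorm (fun u => T n u - limit_dual u)%R)).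
  apply: ge_ereal_sup => _ [u [bu u1] <-]; apply: ereal_sup_ubound; exists u => //.
  by rewrite density_dualB// opprB [T m u - _ + _]addrC addrA subrK.
by apply: (le_lt_trans (opnorm_density_limit n)); rewrite lte_fin.
Qed.

Lemma strong_norm_density_cvg : (0 < d)%N ->
  strong_norm (density_charge (density w m) - w) @[m --> \oo] --> 0%E.
Proof.
move=> d0.
apply: (@squeeze_cvge _ _ _ _ (fun=> 0%E) _ (fun m => (dual_const * dual_decay ^+ m)%:E)).
- by apply: nearW => m; rewrite strong_norm_ge0 strong_norm_density.
- exact: cvg_cst.
- apply: cvg_EFin; first by apply: nearW.
  by apply: cvg_geometric; have /andP[? ?] := dual_decay01; rewrite ger0_norm.
Qed.

End approximation.

End density_convergence.

(** * The integral: existence, uniqueness and the bound *)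

Section main.
Context (R : realType) (d : nat) (beta gamma : R).
Hypotheses (d_ge1 : (1 <= d)%N) (beta01 : 0 < beta < 1) (gamma01 : 0 < gamma < 1).
Hypothesis beta_gamma : d%:R < beta + d%:R * gamma.
Implicit Types (f : Cbeta d beta) (w : sch d gamma).

Let beta_gt0 : 0 < beta. Proof. by case/andP: beta01. Qed.

Let gamma_le1 : gamma <= 1. Proof. by case/andP: gamma01 => _ /ltW. Qed.

Let conj_ge1 : 1 <= (1 - gamma)^-1.
Proof. by have /andP[? ?] := gamma01; rewrite invf_ge1 ?subr_gt0//; lra. Qed.

Lemma CbetaP f : (lip beta (\val f) < +oo)%E.
Proof. by have := valP f; rewrite inE. Qed.

Lemma schP w : charge01 (\val w) /\ (holder_norm gamma (\val w) < +oo)%E.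
Proof. by have := valP w; rewrite inE. Qed.

Definition young f w : R := charge_int (\val f) (\val w).

Lemma young_cvg f w : rsum n (\val f) (\val w) @[n --> \oo] --> young f w.
Proof.
have [L L0 fL] := lt_pinfty_bound (CbetaP f); have [cw woo] := schP w.
have [H H0 wH] := lt_pinfty_bound woo.
exact: (rsum_cvg beta_gt0 beta_gamma L0 H0 cw fL wH).
Qed.

Lemma young_linearl (a : R) f g w : young (a *: f + g) w = a * young f w + young g w.
Proof.
have E : (fun n => rsum n (\val (a *: f + g)) (\val w)) =
    (fun n => a * rsum n (\val f) (\val w) + rsum n (\val g) (\val w)).
  by apply/funext => n; exact: rsumDl.
rewrite /young /charge_int E; apply: (@cvg_lim _ (@Rhausdorff R)).
exact: cvg_lin (@young_cvg f w) (@young_cvg g w).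
Qed.

Lemma young_linearr (a : R) f w z : young f (a *: w + z) = a * young f w + young f z.
Proof.
have E : (fun n => rsum n (\val f) (\val (a *: w + z))) =
    (fun n => a * rsum n (\val f) (\val w) + rsum n (\val f) (\val z)).
  by apply/funext => n; exact: rsumDr.
rewrite /young /charge_int E; apply: (@cvg_lim _ (@Rhausdorff R)).
exact: cvg_lin (@young_cvg f w) (@young_cvg f z).
Qed.

Lemma young_bilinear : bilinear_for *%R *%R young.
Proof. by split=> [w|f] a x y; [exact: young_linearl|exact: young_linearr]. Qed.

Lemma young_density f (g : cube01 R d -> R) w : Lpcube (1 - gamma)^-1 g ->
  \val w = density_charge g ->
  young f w = \int[leb]_(x in cube01 R d) (ext0 (\val f) x * ext0 g x).
Proof.
move=> gp wE; have [L L0 fL] := lt_pinfty_bound (CbetaP f).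
apply: (@cvg_lim _ (@Rhausdorff R)).
exact: (rsum_density_cvg beta_gt0 L0 fL (Lpcube_integrable conj_ge1 gp) wE).
Qed.

Lemma strong_norm_pointwise (w_ : nat -> BVcube R d -> R) (w : BVcube R d -> R) (B : BVcube R d) :
  strong_norm (w_ p - w) @[p --> \oo] --> 0%E -> w_ p B @[p --> \oo] --> w B.
Proof.
move=> sw; apply/cvgrPdist_le => e e0.
pose P := 1 + fine (perimeter (\val B)).
have P0 : 0 < P by rewrite ltr_pwDl// fine_ge0// variation_ge0.
have eP : 0 < e / P by rewrite divr_gt0.
have : \forall p \near \oo, (strong_norm (w_ p - w)%R < (e / P)%:E)%E.
  have /fine_cvgP[sfin /cvgrPdist_lt/(_ _ eP)] := sw.
  move: sfin; apply: filterS2 => p sp; rewrite sub0r normrN => /(le_lt_trans (ler_norm _)).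
  by rewrite -lte_fin fineK.
apply: filterS => p sp; have := @strong_norm_eval R d _ B _ sp.
by rewrite -/P divfK ?gt_eqF// !fctE distrC.
Qed.

Lemma young_continuous : forall (f_ : nat -> Cbeta d beta) f (w_ : nat -> sch d gamma) w,
  {uniform, (fun p => \val (f_ p)) @ \oo --> \val f} ->
  strong_norm (\val (w_ p) - \val w) @[p --> \oo] --> 0%E ->
  (ereal_sup (range (fun p => lip beta (\val (f_ p)))) < +oo)%E ->
  (ereal_sup (range (fun p => holder_norm gamma (\val (w_ p)))) < +oo)%E ->
  young (f_ p) (w_ p) @[p --> \oo] --> young f w.
Proof.
move=> f_ f w_ w ff ww fL wH; apply: (charge_int_cvg beta_gt0 beta_gamma).
- by move=> p; have [] := schP (w_ p).
- by have [] := schP w.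
- exact: CbetaP.
- by have [] := schP w.
- move=> x; have FF : Filter ((fun p => \val (f_ p)) @ \oo) by exact: fmap_filter.
  have := uniform_subset_cvg FF (@subsetT _ [set x]) ff.
  by rewrite uniform_set1.
- by move=> n k; exact: strong_norm_pointwise ww.
- exact: fL.
- exact: wH.
Qed.

Let d0 : (0 < d)%N. Proof. by []. Qed.

(** Over an empty set of pairs the supremum would be -oo; since d >= 1, the points 0 and (1, ..., 1)
    form a pair. *)
Lemma lip_ge0 f : (0 <= lip beta (\val f))%E.
Proof.
have x1 : cube01 R d (const_mx 1) by move=> i; rewrite mxE ler01 lexx.
pose a : cube01 R d := exist _ 0 (mem_set (@cube01_0 R d)).
pose b : cube01 R d := exist _ (const_mx 1) (mem_set x1).
apply: (@le_trans _ _ (`|\val f a - \val f b| / enorm (\val a - \val b) `^ beta)%:E).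
  by rewrite lee_fin divr_ge0// powR_ge0.
apply: ereal_sup_ubound; exists (a, b) => //=.
apply/eqP => /(congr1 val)/= /rowP /(_ (Ordinal d0)); rewrite !mxE => /esym/eqP.
by rewrite oner_eq0.
Qed.

Lemma holder_norm_ge0 w : (0 <= holder_norm gamma (\val w))%E.
Proof.
pose K := bvcube (@dindex0 d) : BVcube R d.
apply: (@le_trans _ _ (`|\val w K| / fine (leb (\val K)) `^ gamma)%:E).
  by rewrite lee_fin divr_ge0// powR_ge0.
apply: ereal_sup_ubound; exists K => //.
by have := @dyadic_dcube R d 0 (@dindex0 d); rewrite -bvcubeE.
Qed.

(** In [charge_int_le] the coefficient of |f(0)| is 1 and that of the Lipschitz constant is c, so C
    = 1 + c serves both. *)
Lemma young_le : exists2 C : R, 0 <= C & forall f w,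
  (`|young f w|%:E <= C%:E * (supnorm (\val f) + lip beta (\val f)) *
    holder_norm gamma (\val w))%E.
Proof.
pose c := @step_const R d beta / (1 - @decay R d beta gamma).
have c0 : 0 <= c.
  have /andP[_ ?] := decay01 beta_gamma.
  by rewrite divr_ge0 ?step_const_ge0// subr_ge0 ltW.
exists (1 + c) => [|f w]; first by rewrite addr_ge0.
have [cw woo] := schP w; have foo := CbetaP f.
have lE : lip beta (\val f) = (fine (lip beta (\val f)))%:E.
  by rewrite fineK// ge0_fin_numE// lip_ge0.
have wE : holder_norm gamma (\val w) = (fine (holder_norm gamma (\val w)))%:E.
  by rewrite fineK// ge0_fin_numE// holder_norm_ge0.
move: lE wE; set L := fine _; set H := fine _ => lE wE.
have L0 : 0 <= L by rewrite fine_ge0// lip_ge0.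
have H0 : 0 <= H by rewrite fine_ge0// holder_norm_ge0.
have fL : (lip beta (\val f) <= L%:E)%E by rewrite lE.
have wH : (holder_norm gamma (\val w) <= H%:E)%E by rewrite wE.
have := charge_int_le beta_gt0 beta_gamma L0 H0 cw fL wH.
rewrite -/(young f w) -/c => yle.
have f0 : (`|ext0 (\val f) 0|%:E <= supnorm (\val f))%E.
  by rewrite (ext0_in _ (@cube01_0 R d)); apply: ereal_sup_ubound; eexists.
rewrite lE wE; apply: (@le_trans _ _ ((1 + c)%:E * (`|ext0 (\val f) 0|%:E + L%:E) * H%:E)%E).
  rewrite -EFinD -!EFinM lee_fin; apply: (le_trans yle); rewrite ler_wpM2r//.
  have := mulr_ge0 c0 (normr_ge0 (ext0 (\val f) 0)); lra.
apply: lee_wpmul2r; first by rewrite lee_fin.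
by apply: lee_wpmul2l; [rewrite lee_fin addr_ge0|apply: leeD2r].
Qed.

Let gamma_gt : d%:R < 1 + d%:R * gamma.
Proof. by have /andP[_ ?] := beta01; apply: lt_trans beta_gamma _; rewrite ltrD2r. Qed.

Lemma density_sch w m : (density_charge (density (\val w) m)) \in @sch_pred R d gamma.
Proof.
have [cw woo] := schP w; have [H H0 wH] := lt_pinfty_bound woo.
rewrite inE /=; split; first exact: charge01_density.
exact: le_lt_trans (holder_norm_density gamma_le1 H0 wH m cw) (ltry _).
Qed.

Definition density_element w m : sch d gamma :=
  exist (fun z => z \in @sch_pred R d gamma) _ (density_sch w m).

(** Clause (A) evaluates J at the densities, and clause (B), with f constant along the sequence,
    passes to the limit. The integrals on the left do not mention J, so any two solutions share this
    limit. *)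
Lemma charge_integral_density_cvg (J : Cbeta d beta -> sch d gamma -> R) f w :
  charge_integral J ->
  \int[leb]_(x in cube01 R d) (ext0 (\val f) x * ext0 (density (\val w) m) x)
    @[m --> \oo] --> J f w.
Proof.
move=> [_ JA JB]; have [cw woo] := schP w; have [H H0 wH] := lt_pinfty_bound woo.
under eq_fun => m.
  rewrite -(JA f (density (\val w) m) (density_element w m)) //; last first.
    by have [] := Lpcube_density (\val w) m m conj_ge1.
  over.
apply: (JB (fun=> f)).
- by move=> A fA; exists 0%N => // p _; exact: nbhs_singleton fA.
- exact: (strong_norm_density_cvg gamma_gt H0 cw wH d0).
- apply: (@le_lt_trans _ _ (lip beta (\val f))); last exact: CbetaP.
  by apply: ge_ereal_sup => _ [p _ <-].
- apply: (@le_lt_trans _ _ H%:E); last exact: ltry.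
  apply: ge_ereal_sup => _ [p _ <-]; exact: (holder_norm_density gamma_le1 H0 wH p cw).
Qed.

Lemma charge_integral_unique (I J : Cbeta d beta -> sch d gamma -> R) :
  charge_integral I -> charge_integral J -> I = J.
Proof.
move=> cI cJ; apply/funext => f; apply/funext => w.
rewrite -(cvg_lim (@Rhausdorff R) (@charge_integral_density_cvg I f w cI)).
exact: (cvg_lim (@Rhausdorff R) (@charge_integral_density_cvg J f w cJ)).
Qed.

End main.

Theorem theorem4 (R : realType) (d : nat) (beta gamma : R)
    (d_ge1 : (1 <= d)%N) (beta01 : 0 < beta < 1) (gamma01 : 0 < gamma < 1)
    (beta_gamma : d%:R < beta + d%:R * gamma) :
  exists I : Cbeta d beta -> sch d gamma -> R,
    unique (@charge_integral R d beta gamma) I /\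
    exists2 C : R, 0 <= C &
      forall (f : Cbeta d beta) (w : sch d gamma),
        (`|I f w|%:E <=
           C%:E * (supnorm (\val f) + lip beta (\val f)) *
           holder_norm gamma (\val w))%E.
Proof.
exists (@young R d beta gamma); split; last exact: young_le.
have cI : charge_integral (@young R d beta gamma).
  split; [exact: young_bilinear|exact: young_density|exact: young_continuous].
by split=> // J; exact: charge_integral_unique.
Qed.
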